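(* Work over $\mathbb{C}$. For integers $d\geq 1$ and $0\leq m\leq d$, let $p_0,p_1,\ldots,p_{m(2d-m)}$ be general points in the projective plane $\mathbb{P}^2$, and let $\xi_{d,m}$ be the class (complete linear system) of plane curves of degree $d$ with a point of multiplicity at least $d-m$ at $p_0$ and passing through $p_1,\ldots,p_{m(2d-m)}$. For a positive integer $k$, let $k\xi_{d,m}$ be the linear system of plane curves of degree $kd$ with multiplicity at least $k(d-m)$ at $p_0$ and multiplicity at least $k$ at each of $p_1,\ldots,p_{m(2d-m)}$. Fix an integer $k\geq 1$. Then: (a) For any $d\geq 4$ and any $m$ with $2\leq m\leq d$, the class $k\xi_{d,m}$ is not effective (i.e. there is no plane curve in the system $k\xi_{d,m}$). (b) For any $d$, the system $\xi_{d,1}$ is a pencil of rational curves, and $\xi_{d,0}$ is composed with the pencil of lines through the point $p_0$ and has dimension $d$. The multiple linear systems $k\xi_{d,1}$ are composed with the corresponding pencil $\xi_{d,1}$ and have dimension $k$. There is no member of these systems that contains an irreducible curve which is not a component of a member of the corresponding pencil. The same is true for the system $\xi_{2,2}$ (that is, $\xi_{2,2}$ is a pencil of rational curves, $k\xi_{2,2}$ is composed with this pencil and has dimension $k$, and no member of $k\xi_{2,2}$ contains an irreducible curve which is not a component of a member of the pencil). (c) For $d=3$, the systems $\xi_{3,3}$ and $\xi_{3,2}$ coincide with the system of cubics through $9$ general points, which consists of a unique cubic $C$. The systems $k\xi_{3,3}$ and $k\xi_{3,2}$ consist of the unique divisor $kC$.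
   Context: ''Curve'' in a linear system means an effective divisor in $\mathbb{P}^2$ (possibly reducible or non-reduced). ''Dimension'' of a linear system means its projective dimension. A linear system is ''composed with'' a pencil if each of its members is a sum of members of that pencil. Equivalently, $\xi_{d,m}$ may be regarded as the divisor class $dH-(d-m)E_0-\sum_{i=1}^{m(2d-m)}E_i$ on the blow-up of $\mathbb{P}^2$ at $p_0,\ldots,p_{m(2d-m)}$ ($H$ the pullback of the line class, $E_i$ the exceptional curve over $p_i$), and $k\xi_{d,m}$ as its $k$-th multiple. ''General points'' means that, for the fixed values of $d,m,k$, the tuple of points lies in a suitable nonempty Zariski open subset of $(\mathbb{P}^2)^{m(2d-m)+1}$. *)

(* Defs.v *)
From HB Require Import structures.
From mathcomp Require Import all_boot all_order all_algebra.
From mathcomp Require Import mpoly.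

Set Implicit Arguments.
Unset Strict Implicit.
Unset Printing Implicit Defensive.

Import GRing.Theory.
Local Open Scope ring_scope.

(* A point of P^r is given by homogeneous coordinates.  Every notion below is *)
(* invariant under rescaling them, so quantifying over coordinate vectors is  *)
(* the same as quantifying over points.                                       *)
Definition point (K : fieldType) (r : nat) : Type :=
  {v : 'rV[K]_r.+1 | v != 0}.

Definition hcoord (K : fieldType) (r : nat) (p : point K r) (j : 'I_r.+1) : K :=
  sval p 0 j.

Section Zariski.

Variables (K : fieldType) (N r : nat).
Implicit Types (p : 'I_N -> point K r) (F : {mpoly K[N * r.+1]}).

(* The variable of index [mxvec_index i j] stands for the j-th homogeneous    *)
(* coordinate on the i-th factor of (P^r)^N.                                  *)
Definition multihomogeneous F : Prop :=
  exists e : 'I_N -> nat, forall mon, mon \in msupp F ->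
    forall i : 'I_N, (\sum_(j < r.+1) mon (mxvec_index i j))%N = e i.

Definition eval_at F p : K :=
  F.@[fun l => mxvec (\matrix_(i < N, j < r.+1) hcoord (p i) j) 0 l].

Definition zariski_open (U : ('I_N -> point K r) -> Prop) : Prop :=
  exists S : {mpoly K[N * r.+1]} -> Prop,
    (forall F, S F -> multihomogeneous F)
    /\ (forall p, U p <-> exists2 F, S F & eval_at F p != 0).

Definition for_general (Q : ('I_N -> point K r) -> Prop) : Prop :=
  exists U : ('I_N -> point K r) -> Prop,
    [/\ zariski_open U, exists p, U p & forall p, U p -> Q p].

End Zariski.

Section PlaneCurves.

Variable K : fieldType.
Implicit Types (f g : {mpoly K[3]}) (L P : {mpoly K[3]} -> Prop).

(* An effective divisor of degree D on P^2 is a nonzero form of degree D up   *)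
(* to a nonzero scalar; sums of divisors are products of forms.               *)
Definition same_divisor f g : Prop := exists2 c : K, c != 0 & f = c *: g.

Definition divides g f : Prop := exists q : {mpoly K[3]}, f = q * g.

Definition irreducible_curve g : Prop :=
  [/\ g != 0, exists D : nat, g \is D.-homog, g \isn't a GRing.unit &
      forall a b : {mpoly K[3]}, g = a * b ->
        a \is a GRing.unit \/ b \is a GRing.unit].

(* Local equation of f = 0 in the affine chart x_i = 1, translated so that p  *)
(* (with p_i <> 0) becomes the origin of the affine plane.                    *)
Definition local_eq f (p : point K 2) (i : 'I_3) : {mpoly K[2]} :=
  f \mPo [tuple (if unlift i j is Some j'
                 then (hcoord p j / hcoord p i)%:MP + 'X_j' else 1) | j < 3].

Definition mult_ge (mu : nat) f (p : point K 2) : Prop :=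
  forall i : 'I_3, hcoord p i != 0 ->
  forall mon, mon \in msupp (local_eq f p i) -> (mu <= mdeg mon)%N.

Definition plane_system (N D : nat) (mu : 'I_N -> nat) (p : 'I_N -> point K 2) f
    : Prop :=
  [/\ f != 0, f \is D.-homog & forall i, mult_ge (mu i) f (p i)].

(* A linear system is identified with the predicate selecting the equations   *)
(* of its members; X is a basis of the underlying space of forms, so that the *)
(* system has projective dimension r.                                         *)
Definition linear_system_basis (D r : nat) (X : r.+1.-tuple (dhomog 3 K D)) L
    : Prop :=
  free X
  /\ forall f, L f <->
       f != 0 /\ exists2 h : dhomog 3 K D, h \in <<X>>%VS
                                         & f = (h : {mpoly K[3]}).

Definition has_dimension L (r : nat) : Prop :=
  exists (D : nat) (X : r.+1.-tuple (dhomog 3 K D)), linear_system_basis X L.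

(* phi and psi represent mutually inverse rational maps P^1 --> {f = 0} and   *)
(* {f = 0} --> P^1.                                                           *)
Definition rational_curve f : Prop :=
  irreducible_curve f /\
  exists (e e' : nat) (phi : 3.-tuple {mpoly K[2]}) (psi : 2.-tuple {mpoly K[3]}),
    [/\ (forall j, tnth phi j \is e.-homog) /\
        (forall j, tnth psi j \is e'.-homog),
        f \mPo phi = 0,
        (exists j, tnth psi j \mPo phi != 0) /\
        (forall i j, 'X_i * (tnth psi j \mPo phi)
                     = 'X_j * (tnth psi i \mPo phi)) &
        (exists j, ~ divides f (tnth phi j \mPo psi)) /\
        (forall i j, divides f ('X_i * (tnth phi j \mPo psi)
                                - 'X_j * (tnth phi i \mPo psi)))].

(* A linear system of projective dimension 1 whose general member, i.e. the   *)
(* member with general parameter t in P^1, is a rational curve.               *)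
Definition pencil_of_rational_curves L : Prop :=
  exists (D : nat) (X : 2.-tuple (dhomog 3 K D)),
    linear_system_basis X L /\
    for_general (fun t : 'I_1 -> point K 1 =>
      rational_curve (\sum_(j < 2) hcoord (t ord0) j *: (tnth X j : {mpoly K[3]}))).

Definition composed_with L P : Prop :=
  has_dimension P 1 /\
  forall f, L f -> exists s : seq {mpoly K[3]},
    (forall g, g \in s -> P g) /\ same_divisor f (\prod_(g <- s) g).

Definition no_foreign_components L P : Prop :=
  forall f g, L f -> irreducible_curve g -> divides g f ->
    exists2 h, P h & divides g h.

Definition consists_of_unique_divisor L (C : {mpoly K[3]}) : Prop :=
  forall f, L f <-> same_divisor f C.

Definition same_system L L' : Prop := forall f, L f <-> L' f.

Definition lines_through (p : point K 2) : {mpoly K[3]} -> Prop :=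
  plane_system 1 (fun _ : 'I_1 => 1%N) (fun _ => p).

End PlaneCurves.

Definition npoints (d m : nat) : nat := (m * (2 * d - m)).+1.

Definition xi_mult (d m : nat) (i : 'I_(npoints d m)) : nat :=
  if i == ord0 then (d - m)%N else 1%N.

Definition xi (K : fieldType) (d m : nat) (p : 'I_(npoints d m) -> point K 2)
    : {mpoly K[3]} -> Prop :=
  plane_system d (@xi_mult d m) p.

Definition multiple_xi (K : fieldType) (k d m : nat)
    (p : 'I_(npoints d m) -> point K 2) : {mpoly K[3]} -> Prop :=
  plane_system (k * d) (fun i => k * xi_mult i)%N p.
Arguments multiple_xi {K} k {d m} p.

Definition cubics_through (K : fieldType) (q : 'I_9 -> point K 2)
    : {mpoly K[3]} -> Prop :=
  plane_system 3 (fun _ : 'I_9 => 1%N) q.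

(* Main.v *)
(* Specialise p_0 to (0:0:1) and, with l = d - m, the other points to the      *)
(* points (i, m + j) of l lines y = i and the points (l + i, j) of m lines     *)
(* z = j.  Comparing the restrictions of a member of k xi_{d,m} to these lines *)
(* at the points where they cross, as in Carnot's theorem, shows that it       *)
(* contains all of them, and by induction that it is k times the grid.  Moving *)
(* the point (0, m) along z = m destroys this last member when d >= 4.  Having *)
(* no member, or only one, is the injectivity of a matrix of Taylor            *)
(* coefficients, hence passes to general points.  Forgetting p_0 reduces       *)
(* xi_{d,d} to xi_{d,d-1}.                                                     *)
(*   A curve of xi_{d,1} is a graph over the pencil of lines through p_0, with *)
(* equation B + zeta A = 0 for binary forms A, B in the equations of the       *)
(* lines; this parametrises it rationally.  The restriction of a member f of   *)
(* k xi_{d,1} to an irreducible member w of xi_{d,1} is determined up to a     *)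
(* scalar by its zeros at the base points.  Hence w divides f - c v^k, where v *)
(* is another member, and induction on k shows that f is a form in w and v.    *)
Require Import Defs.
From HB Require Import structures.
From mathcomp Require Import all_boot all_order all_algebra.
From mathcomp Require Import reals complex.
From mathcomp Require Import mpoly.
From mathcomp Require Import perm zify ring.
From Stdlib Require Import Classical_Prop.

Set Implicit Arguments.
Unset Strict Implicit.
Unset Printing Implicit Defensive.

Import GRing.Theory.
Local Open Scope ring_scope.

(** * Filtrations and orders of vanishing *)

(** By [mult_ge_shift], a multiplicity condition at a point is the vanishing of the low Taylor
    coefficients of the form at a coordinate vector of that point. The members of a system are thus
    the nonzero kernel vectors of a matrix, [interpolation], whose nonconstant entries are multiples
    of monomials in the coordinates of the points. If the matrix is injective for one configuration,
    a nonzero maximal minor is a multihomogeneous polynomial that keeps it injective on an open set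
    ([only_zero_near]). Uniqueness of a member is also an injectivity, once one monomial is
    forbidden. So one special configuration per claim is enough.

    For (a) and (c) with m < d the special configuration lies on a grid of l = d - m lines y = i and
    m lines z = j in the chart x = 1, with p_0 the common point of the lines y = i. A member
    restricted to any of these lines has as many prescribed zeros as its degree allows, hence is
    known up to a scalar. The scalars on the lines z = j agree, because these lines meet at
    infinity, and comparing two crossings on a line y = i forces all scalars to vanish
    ([grid_lines]). Peeling off one grid at a time shows that a member is k times the grid
    ([grid_system]). For d = 3 this is uniqueness, and the cubic exists because 10 > 9. For d >= 4
    the base point (0, m) is moved to (t, m) and a member over K[t] is expanded in t. In the
    decisive case an auxiliary curve of degree d through the other base points would have to avoid
    (0, m), while [grid_special] puts it through that point ([grid_deformation]). Emptiness over
    K[t] gives emptiness for some value of t ([only_zero_path]). For m = d no condition is left at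
    p_0, and forgetting it reduces xi_{d,d} to xi_{d,d-1} ([forget_xi]); this also settles xi_{2,2}
    and xi_{3,3}.

    For (b), forms of degree D with multiplicity D at p_0 are binary forms in two lines through p_0
    ([cone]), which settles xi_{d,0}. Multiplicity D - 1 adds one term linear in a third coordinate
    [zeta] ([near_cone]), so such a curve is a graph over the pencil of lines through p_0. The
    graphs of degree d through the base points form a two-dimensional space ([graph_pencil]), and
    those whose slope is nonzero at all base points are irreducible and rational
    ([member_irreducible], [member_rational]). Restricting a member of k xi_{d,1} to such a graph
    leaves one scalar, so that after subtraction of a power of another graph it becomes divisible by
    the first. Induction on k makes it a binary form of degree k in two graphs ([pair_power]). Over
    an algebraically closed field a binary form is a product of linear ones, and unique
    factorization puts every irreducible component inside one of these factors
    ([power_of_pencil]). *)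

Section Filtration.

Variable S : comNzRingType.

(** A decreasing multiplicative filtration by ideals. It covers order of vanishing in several
    variables, divisibility by powers of one polynomial, and weighted mixtures of these, so that one
    lemma, [low_mmap], carries multiplicities through every substitution below. *)
Definition filtration (I : nat -> S -> Prop) : Prop :=
  [/\ forall x, I 0%N x, forall n, I n 0,
      forall n x y, I n x -> I n y -> I n (x + y),
      forall m n x y, I m x -> I n y -> I (m + n)%N (x * y) &
      forall m n x, (m <= n)%N -> I n x -> I m x].

Variables (I : nat -> S -> Prop) (filI : filtration I).

Lemma filtration_sum (A : Type) (r : seq A) (P : pred A) (F : A -> S) n :
  (forall a, P a -> I n (F a)) -> I n (\sum_(a <- r | P a) F a).
Proof. by case: filI => _ I0 ID _ _ IF; apply: big_ind => //; apply: ID. Qed.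

Lemma filtrationMl n x y : I n y -> I n (x * y).
Proof. by case: filI => I0 _ _ IM _ Iy; apply: (IM 0%N n). Qed.

Lemma filtrationMr n x y : I n x -> I n (x * y).
Proof. by rewrite mulrC; apply: filtrationMl. Qed.

Lemma filtrationN n x : I n x -> I n (- x).
Proof. by rewrite -mulN1r; apply: filtrationMl. Qed.

Lemma filtrationB n x y : I n x -> I n y -> I n (x - y).
Proof. by case: (filI) => _ _ ID _ _ Ix /filtrationN; apply: ID. Qed.

Lemma filtrationX n x : I 1%N x -> I n (x ^+ n).
Proof.
by case: filI => I0 _ _ IM _ Ix; elim: n => // n; rewrite exprS; apply: (IM 1%N).
Qed.

Lemma filtration_prodX (J : finType) (e : J -> nat) (q : J -> S) :
  (forall j, I 1%N (q j)) -> I (\sum_j e j)%N (\prod_j q j ^+ e j).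
Proof.
case: (filI) => I0 _ _ IM _ Iq.
by apply: (big_rec2 (fun n x => I n x)) => // j n x _; apply/IM/filtrationX.
Qed.

End Filtration.

Section Low.

Variables (n : nat) (R : comNzRingType).
Implicit Types (f g : {mpoly R[n]}).

(** Membership in the [mu]-th power of the ideal of the origin. *)
Definition low (mu : nat) g : Prop :=
  forall m : 'X_{1..n}, (mdeg m < mu)%N -> g@_m = 0.

Lemma lowP mu g :
  low mu g <-> forall m, m \in msupp g -> (mu <= mdeg m)%N.
Proof.
split=> lg m; last by move=> lm; apply/eqP; rewrite mcoeff_eq0; apply: contraL lm;
  rewrite -leqNgt; apply: lg.
by rewrite mcoeff_msupp; apply: contraR; rewrite -ltnNge => /lg ->.
Qed.

Lemma low_filtration : filtration low.
Proof.
split=> //.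
- by move=> k m _; rewrite mcoeff0.
- by move=> k f g lf lg m lm; rewrite mcoeffD lf // lg // addr0.
- move=> a b f g lf lg m lm; rewrite mcoeffM big1 // => -[k1 k2] /= /eqP mE.
  have [k1a|k1a] := ltnP (mdeg k1) a; first by rewrite lf // mul0r.
  have [k2b|k2b] := ltnP (mdeg k2) b; first by rewrite lg // mulr0.
  by have := leq_add k1a k2b; rewrite -mdegD -mE leqNgt lm.
- by move=> a b g ab lg m lm; apply: lg; apply: leq_trans ab.
Qed.

Lemma lowX (j : 'I_n) : low 1 ('X_j : {mpoly R[n]}).
Proof. by apply/lowP => m; rewrite msuppX inE => /eqP ->; rewrite mdeg1. Qed.

(** Each variable lands in level 1, so a monomial of degree n lands in level n. *)
Lemma low_mmap (S : comNzRingType) (I : nat -> S -> Prop) (h : {rmorphism R -> S})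
    (q : 'I_n -> S) mu g :
  filtration I -> (forall j, I 1%N (q j)) -> low mu g -> I mu (mmap h q g).
Proof.
move=> filI Iq /lowP lg; rewrite /mmap big_seq; apply: filtration_sum => // m mg.
apply: filtrationMl => //; case: (filI) => _ _ _ _ /(_ mu (mdeg m)); apply.
  exact: lg.
by rewrite mdegE; apply: filtration_prodX.
Qed.

(** Allows an inverse modulo level [mu] to replace a true inverse in a substitution. *)
Lemma mmap_congr (S : comNzRingType) (I : nat -> S -> Prop)
    (h : {rmorphism R -> S}) (q q' : 'I_n -> S) mu g :
  filtration I -> (forall j, I mu (q j - q' j)) -> I mu (mmap h q g - mmap h q' g).
Proof.
move=> filI Iq; rewrite /mmap -sumrB; apply: filtration_sum => // m _.
rewrite -mulrBr; apply: filtrationMl => //; rewrite /mmap1.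
case: (filI) => _ I0 ID _ _.
apply: (big_rec2 (fun x y => I mu (x - y))); first by rewrite subrr.
move=> j x y _ Ixy.
have -> : q j ^+ m j * x - q' j ^+ m j * y
        = q j ^+ m j * (x - y) + (q j ^+ m j - q' j ^+ m j) * y.
  by rewrite mulrBr mulrBl addrA subrK.
apply: ID; [exact: filtrationMl | apply: filtrationMr => //].
by rewrite subrXX; apply: filtrationMr.
Qed.

Lemma rmorph_mmap (S T : comNzRingType) (phi : {rmorphism S -> T})
    (h : {rmorphism R -> S}) (q : 'I_n -> S) g :
  phi (mmap h q g) = mmap (phi \o h) (phi \o q) g.
Proof.
rewrite /mmap rmorph_sum; apply: eq_bigr => m _; rewrite rmorphM /mmap1 rmorph_prod.
by congr (_ * _); apply: eq_bigr => j _; rewrite rmorphXn.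
Qed.

Lemma eq_mmap (S : comNzRingType) (h h' : R -> S) (q q' : 'I_n -> S) g :
  h =1 h' -> q =1 q' -> mmap h q g = mmap h' q' g.
Proof.
move=> eh eq; apply: eq_bigr => m _; rewrite eh /mmap1; congr (_ * _).
by apply: eq_bigr => j _; rewrite eq.
Qed.

Lemma mmap_mmap (m : nat) (S : comNzRingType) (h' : {rmorphism R -> S}) (q' : 'I_m -> S)
    (q : 'I_n -> {mpoly R[m]}) g :
  mmap h' q' (mmap (@mpolyC m R) q g) = mmap h' (fun j => mmap h' q' (q j)) g.
Proof. by rewrite rmorph_mmap; apply: eq_mmap => // c /=; rewrite mmapC. Qed.

Lemma mmap_homog (S : comNzRingType) (h : {rmorphism R -> S}) (q : 'I_n -> S) c D g :
  g \is D.-homog -> mmap h (fun j => c * q j) g = c ^+ D * mmap h q g.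
Proof.
move=> /dhomogP gD; rewrite /mmap mulr_sumr [LHS]big_seq [RHS]big_seq.
apply: eq_bigr => m /gD mD; rewrite mulrCA; congr (_ * _).
rewrite /mmap1; have <- : mdeg m = D := mD.
rewrite mdegE -prodrXr -big_split; apply: eq_bigr => j _.
by rewrite exprMn.
Qed.

(** Taylor expansion at the vector [p] in all homogeneous coordinates at once, with no choice of
    chart. *)
Definition shift (p : 'I_n -> R) g : {mpoly R[n]} :=
  mmap (@mpolyC n R) (fun j => 'X_j + (p j)%:MP) g.

Lemma mmap_shift (S : comNzRingType) (h : {rmorphism R -> S}) (q : 'I_n -> S) p g :
  mmap h q (shift p g) = mmap h (fun j => q j + h (p j)) g.
Proof.
rewrite /shift mmap_mmap; apply: eq_mmap => // j.
by rewrite mmapD mmapX mmapC mmap1U.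
Qed.

Lemma mmap_shiftK (S : comNzRingType) (h : {rmorphism R -> S}) (q : 'I_n -> S) p g :
  mmap h q g = mmap h (fun j => q j - h (p j)) (shift p g).
Proof. by rewrite mmap_shift; apply: eq_mmap => // j; rewrite subrK. Qed.

End Low.

(** * Multiplicity of a plane curve in homogeneous coordinates *)

Section Multiplicity.

Variable K : fieldType.
Implicit Types (p : point K 2) (f : {mpoly K[3]}).

(** A truncated geometric series: X_i + c is a unit modulo terms of order [mu]. *)
Lemma low_inverse n (i : 'I_n) (c : K) mu : c != 0 ->
  exists W E : {mpoly K[n]}, ('X_i + c%:MP) * W = 1 - E /\ low mu E.
Proof.
move=> c0; have [I0 _ _ IM _] := low_filtration n K.
elim: mu => [|mu [W [E [UW lE]]]]; first by exists 0, 1; rewrite mulr0 subrr.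
exists (W + c^-1%:MP * E), (- (c^-1%:MP * 'X_i) * E); split.
  have cc : c%:MP * c^-1%:MP = 1 :> {mpoly K[n]} by rewrite -mpolyCM divff.
  rewrite mulrDr UW; have -> : ('X_i + c%:MP) * (c^-1%:MP * E)
      = c^-1%:MP * 'X_i * E + c%:MP * c^-1%:MP * E by ring.
  by rewrite cc; ring.
apply: (IM 1%N mu) => //; apply: (filtrationN (low_filtration _ _)).
exact/(filtrationMl (low_filtration _ _))/lowX.
Qed.

Lemma low_unit_cancel n (U W E g : {mpoly K[n]}) mu D :
  U * W = 1 - E -> low mu E -> low mu (W ^+ D * g) -> low mu g.
Proof.
move=> UW lE; have filL := low_filtration n K; have [_ _ ID _ _] := filL.
elim: D => [|D IH]; first by rewrite mul1r.
rewrite exprS => lW; apply: IH.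
have -> : W ^+ D * g = U * (W * W ^+ D * g) + E * (W ^+ D * g).
  by rewrite -[W * _ * g]mulrA mulrA UW mulrBl mul1r subrK.
by apply: ID; [apply: (filtrationMl filL) | apply: (filtrationMr filL)].
Qed.

(** Near a nonzero vector over [p], the cone over the curve is the product of the curve with a line,
    so both have the same multiplicity. This makes the conditions polynomial in the coordinates of
    the points and independent of the chart. *)
Lemma mult_ge_shift D mu f p :
  f \is D.-homog -> mult_ge mu f p <-> low mu (shift (hcoord p) f).
Proof.
move=> fD; split=> [mf | lf i pi0]; last first.
  apply/lowP; set g := local_eq f p i.
  have cD0 : hcoord p i ^+ D != 0 by rewrite expf_neq0.
  (* Setting X_i = 0 in the expansion at [p] and scaling the other variables by p_i gives the local
     equation up to the factor p_i^D. *)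
  have gE : (hcoord p i ^+ D)%:MP * g
      = mmap (@mpolyC 2 K) (fun j => if unlift i j is Some j'
          then (hcoord p i)%:MP * 'X_j' else 0) (shift (hcoord p) f).
    rewrite mmap_shift /g /local_eq /comp_mpoly rmorphXn -(mmap_homog _ _ _ fD).
    apply: eq_mmap => // j; rewrite tnth_mktuple; case: unliftP => [j' _|->].
      by rewrite mulrDr -mpolyCM mulrC divfK // addrC.
    by rewrite mulr1 add0r.
  suff lg : low mu ((hcoord p i ^+ D)%:MP * g).
    move=> m /lg; rewrite mcoeffCM => /eqP; rewrite mulf_eq0 (negPf cD0) /=.
    by move/eqP.
  rewrite gE; apply: low_mmap => //; first exact: low_filtration.
  move=> j; case: unliftP => [j' _|_].
    exact/(filtrationMl (low_filtration _ _))/lowX.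
  by case: (low_filtration 2 K).
have [i pi0] : exists i, hcoord p i != 0.
  apply/existsP; apply: contraNT (svalP p) => /existsPn p0.
  by apply/eqP/rowP => j; rewrite mxE; apply/eqP; have := p0 j; rewrite negbK.
have filL := low_filtration 3 K; have [_ I0 _ _ _] := filL.
have [W [E [UW lE]]] := low_inverse i mu pi0.
apply: (low_unit_cancel (D := D) UW lE).
(* With W inverse to X_i + p_i modulo order [mu], the quotients W (X_j + p_j) agree with a_j + Y_j
   up to multiples of E, and the Y_j have order 1. The expansion times W^D is thus the local
   equation at the Y_j, modulo order [mu]. *)
pose a j := hcoord p j / hcoord p i.
pose Y j := W * ('X_j - (a j)%:MP * 'X_i).
have -> : W ^+ D * shift (hcoord p) f
    = mmap (@mpolyC 3 K) (fun j => W * ('X_j + (hcoord p j)%:MP)) f.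
  by rewrite (mmap_homog _ _ _ fD).
have lY j : low 1 (Y j).
  apply: (filtrationMl filL); apply: (filtrationB filL); first exact: lowX.
  by apply: (filtrationMl filL); apply: lowX.
rewrite -[mmap _ _ _](subrK (mmap (@mpolyC 3 K) (fun j => (a j)%:MP + Y j) f)).
case: (filL) => _ _ ID _ _; apply: ID.
  apply: (mmap_congr _ _ filL) => j.
  have -> : W * ('X_j + (hcoord p j)%:MP) - ((a j)%:MP + Y j) = - ((a j)%:MP * E).
    have -> : hcoord p j = a j * hcoord p i by rewrite divfK.
    have -> : E = 1 - ('X_i + (hcoord p i)%:MP) * W by rewrite UW opprB addrC subrK.
    rewrite /Y mpolyCM; ring.
  by apply: (filtrationN filL); apply: (filtrationMl filL).
have -> : mmap (@mpolyC 3 K) (fun j => (a j)%:MP + Y j) f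
    = mmap (@mpolyC 3 K) (fun j' : 'I_2 => Y (lift i j')) (local_eq f p i).
  rewrite /local_eq /comp_mpoly mmap_mmap; apply: eq_mmap => // j.
  rewrite tnth_mktuple; case: unliftP => [j' ->|->].
    by rewrite mmapD mmapC mmapX mmap1U.
  by rewrite rmorph1 /Y /a divff // mpolyC1 mul1r subrr mulr0 addr0.
by apply: (low_mmap _ filL) => //; apply/lowP/mf.
Qed.

End Multiplicity.

(** * Homogeneous components as coefficients *)

Section Grading.

Variables (n : nat) (R : idomainType).
Implicit Types (f g : {mpoly R[n]}).

(** The polynomial f(T X_0, T X_1, ...) in T. Its coefficients are the homogeneous components of f,
    so that lowest and highest components can be multiplied as in one variable. *)
Definition grading f : {poly {mpoly R[n]}} :=
  mmap (polyC \o @mpolyC n R) (fun j => ('X_j)%:P * 'X) f.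

Lemma coef_grading f d : (grading f)`_d = pihomog mdeg d f.
Proof.
rewrite pihomogE /grading /mmap coef_sum [RHS]big_mkcond /=; apply: eq_bigr => m _.
have -> : mmap1 (fun j => ('X_j)%:P * 'X) m = ('X_[m])%:P * 'X^(mdeg m) :> {poly {mpoly R[n]}}.
  rewrite /mmap1 mdegE -prodrXr [in RHS]mpolyXE_id rmorph_prod -big_split.
  by apply: eq_bigr => j _; rewrite exprMn rmorphXn.
rewrite mulrA -rmorphM coefCM coefXn eq_sym mul_mpolyC.
by case: eqP => _; rewrite ?mulr1 ?mulr0.
Qed.

Lemma mcoeff_pihomog d f m :
  (pihomog mdeg d f)@_m = if mdeg m == d then f@_m else 0.
Proof.
rewrite pihomogE raddf_sum /=; have [mf|mf] := boolP (m \in msupp f); last first.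
  rewrite memN_msupp_eq0 // if_same big_seq_cond big1 // => m' /andP[m'f _].
  by rewrite mcoeffZ mcoeffX; case: eqP mf => [<-|]; rewrite ?m'f // mulr0.
rewrite big_mkcond /= (bigD1_seq m) ?msupp_uniq //= big1 ?addr0.
  by rewrite mcoeffZ mcoeffX eqxx mulr1.
by move=> m' /negPf m'm; case: ifP => // _; rewrite mcoeffZ mcoeffX m'm mulr0.
Qed.

Lemma grading_low mu f : low mu f <-> forall d, (d < mu)%N -> (grading f)`_d = 0.
Proof.
split=> [lf d dmu | gf m lm].
  by apply/mpolyP => m; rewrite coef_grading mcoeff_pihomog mcoeff0; case: eqP => // md;
    apply: lf; rewrite md.
have := gf _ lm; rewrite coef_grading => /(congr1 (mcoeff m)).
by rewrite mcoeff0 mcoeff_pihomog eqxx.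
Qed.

Lemma coef_mul_min (S : idomainType) (P Q : {poly S}) a b :
  P`_a != 0 -> Q`_b != 0 -> (forall i, (i < a)%N -> P`_i = 0) ->
  (forall i, (i < b)%N -> Q`_i = 0) -> (P * Q)`_(a + b) != 0.
Proof.
move=> Pa Qb P0 Q0; rewrite coefM (bigD1 (inord a)) //= inordK; last by rewrite ltnS leq_addr.
rewrite addKn big1 ?addr0 ?mulf_neq0 // => i ia.
have [lia|lia] := ltnP i a; first by rewrite P0 // mul0r.
rewrite [Q`__]Q0 ?mulr0 //.
have : (i : nat) != a by apply: contraNneq ia => iE; apply/eqP/val_inj; rewrite /= inordK ?ltnS ?leq_addr.
by have := ltn_ord i; move: lia => /=; lia.
Qed.

Lemma poly_min_coef (S : nzRingType) (P : {poly S}) : P != 0 ->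
  exists2 a, P`_a != 0 & forall i, (i < a)%N -> P`_i = 0.
Proof.
move=> P0; have exP : exists a, P`_a != 0 by exists (size P).-1; rewrite -lead_coefE lead_coef_eq0.
exists (ex_minn exP); case: ex_minnP => // a Pa amin i ia.
by apply/eqP; apply: contraLR ia => /amin; rewrite -leqNgt.
Qed.

Lemma gradingM f g : grading (f * g) = grading f * grading g.
Proof. by rewrite /grading rmorphM. Qed.

(** Over a domain the lowest components of two factors have a nonzero product, so orders of
    vanishing add up exactly. *)
Lemma low_div a b f g : low (a + b) (f * g) -> ~ low a.+1 f -> low b g.
Proof.
move=> /grading_low lfg nlf; have [->|g0] := eqVneq g 0; first by move=> m; rewrite mcoeff0.
have gf0 : grading f != 0.
  by apply: contra_not_neq nlf => f0; apply/grading_low => d _; rewrite f0 coef0.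
have [i fi0 imin] := poly_min_coef gf0.
have ia : (i <= a)%N.
  rewrite leqNgt; apply/negP => ai; apply: nlf; apply/grading_low => d da.
  by apply: imin; apply: leq_trans ai.
have [gg0|gg0] := eqVneq (grading g) 0.
  by apply/grading_low => d _; rewrite gg0 coef0.
have [j gj0 jmin] := poly_min_coef gg0.
apply/grading_low => d db; apply: (jmin); apply: leq_trans db _.
rewrite leqNgt; apply/negP => jb.
have := coef_mul_min fi0 gj0 imin jmin; rewrite -gradingM lfg ?eqxx //.
by rewrite -addnS leq_add.
Qed.

Lemma grading_homog f D : f \is D.-homog <-> grading f = f%:P * 'X^D.
Proof.
split=> [fD|fE].
  apply/polyP => d; rewrite coef_grading coefCM coefXn; case: eqP => [->|/eqP dD].
    by rewrite mulr1 pihomog_dE.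
  by rewrite mulr0 (@pihomog_ne0 _ _ _ D) // eq_sym.
rewrite homog_piE -coef_grading fE coefCM coefXn eqxx mulr1; exact: eqxx.
Qed.

Lemma grading_eq0 f : (grading f == 0) = (f == 0).
Proof.
apply/eqP/eqP => [f0|->]; last by rewrite /grading rmorph0.
by apply/mpolyP => m; rewrite mcoeff0; apply: (grading_low (mdeg m).+1 f).2 => // d _; rewrite f0 coef0.
Qed.

(** Lowest and highest degrees are both additive; since they agree for the product they agree for
    each factor. *)
Lemma homog_factor D f g : f * g != 0 -> f * g \is D.-homog ->
  exists a b, [/\ (a + b)%N = D, f \is (a).-homog & g \is (b).-homog].
Proof.
rewrite mulf_eq0 negb_or => /andP[f0 g0] /grading_homog.
rewrite gradingM => grM.
have gf0 : grading f != 0 by rewrite grading_eq0.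
have gg0 : grading g != 0 by rewrite grading_eq0.
have [i fi0 imin] := poly_min_coef gf0.
have [j gj0 jmin] := poly_min_coef gg0.
have fg0 : f * g != 0 by rewrite mulf_neq0.
have szf : (size (grading f) + size (grading g)).-1 = D.+1.
  by rewrite -(size_mul gf0 gg0) grM (size_Cmul _ fg0) size_polyXn.
have ijD : (i + j)%N = D.
  have := coef_mul_min fi0 gj0 imin jmin; rewrite grM coefCM coefXn.
  by case: ((i + j)%N =P D) => // _; rewrite mulr0 eqxx.
have lei : (i < size (grading f))%N by rewrite ltnNge; apply: contra fi0 => /leq_sizeP ->.
have lej : (j < size (grading g))%N by rewrite ltnNge; apply: contra gj0 => /leq_sizeP ->.
have onlyi (h : {mpoly R[n]}) l : (size (grading h) <= l.+1)%N ->
    (forall d, (d < l)%N -> (grading h)`_d = 0) -> h \is l.-homog.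
  move=> sh lh; apply/dhomogP => m mh; apply/eqP; rewrite eqn_leq; apply/andP; split.
    rewrite leqNgt; apply/negP => lm; move: mh; rewrite mcoeff_msupp => /eqP; apply.
    have := nth_default 0 (leq_trans sh lm); rewrite coef_grading.
    by move/(congr1 (mcoeff m)); rewrite mcoeff0 mcoeff_pihomog eqxx.
  by have /lowP := (grading_low l h).2 lh; apply.
exists i, j; split => //; apply: onlyi => //.
  by rewrite -ltnS; move: szf lei lej; rewrite -ijD; lia.
by rewrite -ltnS; move: szf lei lej; rewrite -ijD; lia.
Qed.

End Grading.

(** * General points *)

Section GeneralPoints.

Variables (K : fieldType) (N r : nat).
Implicit Types (F G : {mpoly K[N * r.+1]}) (p : 'I_N -> point K r).

Definition homogeneous_of (e : 'I_N -> nat) F : Prop :=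
  forall mon, mon \in msupp F ->
    forall i : 'I_N, (\sum_(j < r.+1) mon (mxvec_index i j))%N = e i.

Lemma homogeneous_of0 e : homogeneous_of e 0.
Proof. by move=> m; rewrite msupp0. Qed.

Lemma homogeneous_ofD e F G :
  homogeneous_of e F -> homogeneous_of e G -> homogeneous_of e (F + G).
Proof. by move=> hF hG m /msuppD_le; rewrite mem_cat => /orP[/hF | /hG]. Qed.

Lemma homogeneous_ofZ e c F : homogeneous_of e F -> homogeneous_of e (c *: F).
Proof. by move=> hF m /msuppZ_le /hF. Qed.

Lemma homogeneous_of_sum e (A : Type) (s : seq A) (P : pred A) (F : A -> {mpoly K[N * r.+1]}) :
  (forall a, P a -> homogeneous_of e (F a)) -> homogeneous_of e (\sum_(a <- s | P a) F a).
Proof.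
by move=> hF; apply: big_ind => //; [apply: homogeneous_of0 | apply: homogeneous_ofD].
Qed.

Lemma homogeneous_ofC c : homogeneous_of (fun=> 0%N) c%:MP.
Proof.
move=> m; rewrite msuppC; case: ifP => // _; rewrite inE => /eqP -> i.
by rewrite big1 // => j _; rewrite mnm0E.
Qed.

Lemma homogeneous_ofM e1 e2 F G : homogeneous_of e1 F -> homogeneous_of e2 G ->
  homogeneous_of (fun i => e1 i + e2 i)%N (F * G).
Proof.
move=> hF hG m /msuppM_le /allpairsP[[m1 m2] /= [m1F m2G ->]] i.
by rewrite -(hF _ m1F i) -(hG _ m2G i) -big_split; apply: eq_bigr => j _; rewrite mnmDE.
Qed.

Lemma homogeneous_of_prod (A : Type) (s : seq A) (e : A -> 'I_N -> nat)
    (F : A -> {mpoly K[N * r.+1]}) : (forall a, homogeneous_of (e a) (F a)) ->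
  homogeneous_of (fun i => \sum_(a <- s) e a i)%N (\prod_(a <- s) F a).
Proof.
move=> hF; elim: s => [|a s IH].
  by move=> m mF i; rewrite big_nil; move: m mF i; rewrite big_nil; apply: homogeneous_ofC.
move=> m; rewrite big_cons => mF i; rewrite big_cons.
exact: (homogeneous_ofM (hF a) IH).
Qed.

Lemma homogeneous_ofX i j n :
  homogeneous_of (fun i' => n * (i' == i))%N ('X_(mxvec_index i j) ^+ n).
Proof.
move=> m; rewrite mpolyXn msuppX inE => /eqP -> i'.
under eq_bigr => j' _ do rewrite mulmnE mnm1E mulnC.
rewrite -big_distrr /=; congr (_ * _)%N.
have idx (j' : 'I_r.+1) :
    (mxvec_index i j == mxvec_index i' j') = (i' == i) && (j' == j).
  apply/eqP/andP => [ij | [/eqP -> /eqP ->] //].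
  have := mxvecE (delta_mx i j : 'M[K]_(N, r.+1)) i j; rewrite ij mxvecE !mxE !eqxx.
  by case: (i' == i); case: (j' == j) => //= /esym/eqP; rewrite oner_eq0.
under eq_bigr => j' _ do rewrite idx.
case: (i' == i) => /=; last by rewrite big1.
by rewrite (bigD1 j) //= eqxx big1 // => j' /negPf ->.
Qed.

(** Every term of the Leibniz formula takes one entry from each row, so a common multidegree along
    each row is enough. *)
Lemma homogeneous_of_det n (A : 'M[{mpoly K[N * r.+1]}]_n) (e : 'I_n -> 'I_N -> nat) :
  (forall i j, homogeneous_of (e i) (A i j)) ->
  homogeneous_of (fun l => \sum_(i < n) e i l)%N (\det A).
Proof.
move=> hA; apply: homogeneous_of_sum => s _.
have hP : homogeneous_of (fun l => \sum_(i < n) e i l)%N (\prod_i A i (s i)).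
  exact: homogeneous_of_prod.
by rewrite mulr_sign; case: ifP => // _; rewrite -scaleN1r; apply: homogeneous_ofZ.
Qed.

Lemma eval_atM p F G : eval_at (F * G) p = eval_at F p * eval_at G p.
Proof. by rewrite /eval_at rmorphM. Qed.

Lemma eval_atX p i j : eval_at 'X_(mxvec_index i j) p = hcoord (p i) j.
Proof. by rewrite /eval_at mevalXU mxvecE mxE. Qed.

(* Unlike [for_general], this is stable under conjunction without appealing   *)
(* to the irreducibility of a product of projective spaces.                   *)
Definition general_near p0 (Q : ('I_N -> point K r) -> Prop) : Prop :=
  exists F, [/\ multihomogeneous F, eval_at F p0 != 0 &
                forall p, eval_at F p != 0 -> Q p].

Lemma for_general_near p0 Q : general_near p0 Q -> for_general Q.
Proof.
case=> F [hF Fp0 FQ]; exists (fun p => eval_at F p != 0); split => //; last by exists p0.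
by exists (eq F); split=> [_ <- // | p]; split=> [|[_ <-]] //; exists F.
Qed.

Lemma for_general_imp (Q1 Q2 : ('I_N -> point K r) -> Prop) :
  (forall p, Q1 p -> Q2 p) -> for_general Q1 -> for_general Q2.
Proof. by move=> Q12 [U [Uo Up UQ]]; exists U; split=> // p /UQ/Q12. Qed.

Lemma general_near_and p0 Q1 Q2 : general_near p0 Q1 -> general_near p0 Q2 ->
  general_near p0 (fun p => Q1 p /\ Q2 p).
Proof.
case=> F [[e he] F0 FQ] [G [[e' he'] G0 GQ]]; exists (F * G); split.
- by exists (fun i => e i + e' i)%N; apply: homogeneous_ofM.
- by rewrite eval_atM mulf_neq0.
by move=> p; rewrite eval_atM mulf_eq0 negb_or => /andP[/FQ ? /GQ].
Qed.

Lemma general_near_imp p0 (Q1 Q2 : ('I_N -> point K r) -> Prop) :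
  (forall p, Q1 p -> Q2 p) -> general_near p0 Q1 -> general_near p0 Q2.
Proof. by move=> Q12 [F [hF F0 FQ]]; exists F; split => // p /FQ/Q12. Qed.

Lemma general_near_forall p0 n (Q : 'I_n -> ('I_N -> point K r) -> Prop) :
  (forall i, general_near p0 (Q i)) -> general_near p0 (fun p => forall i, Q i p).
Proof.
elim: n Q => [|n IH] Q hQ.
  exists 1; split; [exists (fun=> 0%N); exact: homogeneous_ofC | | by move=> p _ []].
  by rewrite /eval_at rmorph1 oner_neq0.
apply: general_near_imp (general_near_and (hQ ord0) (IH (fun i => Q (lift ord0 i)) _)) => //.
by move=> p [Q0 Qn] i; case: (unliftP ord0 i) => [j ->|->].
Qed.

End GeneralPoints.

Lemma injective_minor (K : fieldType) (m n : nat) (A : 'M[K]_(m, n)) :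
  (forall v : 'cV_n, A *m v = 0 -> v = 0) ->
  exists g : 'I_n -> 'I_m, \det (rowsub g A) != 0.
Proof.
move=> injA; suff rkA : row_full A.
  by exists (fullrankfun rkA); rewrite -unitfE -unitmxE fullrowsub_unit.
rewrite -cokermx_eq0; apply/eqP/matrixP => i j; rewrite mxE.
have /injA/colP/(_ i) : A *m col j (cokermx A) = 0 by rewrite colE mulmxA mulmx_coker mul0mx.
by rewrite !mxE.
Qed.

Lemma det_injective (K : fieldType) (m n : nat) (A : 'M[K]_(m, n)) (g : 'I_n -> 'I_m) v :
  \det (rowsub g A) != 0 -> A *m v = 0 -> v = 0 :> 'cV_n.
Proof.
move=> gA Av; have : rowsub g A *m v = 0.
  by rewrite mul_rowsub_mx Av; apply/matrixP => i j; rewrite !mxE.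
rewrite -unitfE -unitmxE in gA.
by move/(congr1 (mulmx (invmx (rowsub g A)))); rewrite mulKmx // mulmx0.
Qed.

Lemma fraction_num_den (R : idomainType) (x : {fraction R}) :
  exists n d : R, d != 0 /\ x * tofrac d = tofrac n.
Proof.
exists \n_(repr x), \d_(repr x); split; first exact: denom_ratioP.
rewrite -[X in X * _](reprK x) !piE; apply/eqmodP => /=.
rewrite FracField.equivfE /FracField.mulf !numden_Ratio ?mulf_neq0 ?oner_eq0 ?denom_ratioP //.
by rewrite !mulr1 mulrC.
Qed.

(** Over the fraction field a matrix either has full column rank or kills a nonzero vector; clearing
    denominators brings that vector back to [R]. *)
Lemma minor_or_kernel (R : idomainType) (m n : nat) (A : 'M[R]_(m, n)) :
  (exists g : 'I_n -> 'I_m, \det (rowsub g A) != 0) \/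
  (exists2 v : 'cV[R]_n, v != 0 & A *m v = 0).
Proof.
pose B := map_mx (@tofrac R) A.
have [|rkB] := boolP (cokermx B == 0).
  rewrite cokermx_eq0 => rkB; left; exists (fullrankfun rkB).
  have : \det (rowsub (fullrankfun rkB) B) != 0.
    by rewrite -unitfE -unitmxE fullrowsub_unit.
  apply: contraNneq => dA0.
  have -> : rowsub (fullrankfun rkB) B
      = map_mx (@tofrac R) (rowsub (fullrankfun rkB) A).
    by apply/matrixP => i j; rewrite !mxE.
  by rewrite det_map_mx dA0 rmorph0.
right; have [j wj0] : exists j, col j (cokermx B) != 0.
  apply/existsP; apply: contraNT rkB => /existsPn c0; apply/eqP/matrixP => i j.
  by have /eqP/colP/(_ i) := negbNE (c0 j); rewrite !mxE.
set w := col j (cokermx B) in wj0.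
have Bw : B *m w = 0 by rewrite /w colE mulmxA mulmx_coker mul0mx.
clearbody w.
have /fin_all_exists[num /fin_all_exists[den nd]] := fun i => fraction_num_den (w i 0).
(* The kernel vector [w] multiplied by the product D of all its denominators. *)
pose v : 'cV_n := \col_i (num i * \prod_(l | l != i) den l).
pose D := \prod_l den l.
have vw : map_mx (@tofrac R) v = tofrac D *: w.
  apply/colP => i; rewrite mxE [v i 0]mxE [RHS]mxE tofracM -(nd i).2 -mulrA -tofracM mulrC.
  by congr (tofrac _ * _); rewrite /D [RHS](bigD1 i).
have D0 : D != 0 by apply/prodf_neq0 => i _; case: (nd i).
exists v.
  apply: contra wj0 => /eqP v0; move: vw; rewrite v0 map_mx0 => /esym/eqP.
  by rewrite scaler_eq0 tofrac_eq0 (negPf D0).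
apply/matrixP => i l; rewrite [RHS]mxE; apply/eqP; rewrite -tofrac_eq0; apply/eqP.
have /matrixP/(_ i l) : map_mx (@tofrac R) (A *m v) = 0.
  by rewrite map_mxM vw -scalemxAr -/B Bw scaler0.
by rewrite mxE [RHS]mxE.
Qed.

Lemma nonroot (K : numFieldType) (P : {poly K}) : P != 0 -> exists t, P.[t] != 0.
Proof.
move=> P0; pose s := [seq i%:R : K | i <- iota 0 (size P)].
have [rs|/allPn[t _ rt]] := boolP (all (root P) s); last by exists t.
have us : uniq s.
  by rewrite map_inj_uniq ?iota_uniq // => a b /eqP; rewrite Num.Theory.eqr_nat => /eqP.
by have := max_poly_roots P0 rs us; rewrite seq.size_map size_iota ltnn.
Qed.

(** * Taylor coefficients of monomials *)

Section Taylor.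

Variables (n : nat) (R : comNzRingType).
Implicit Types (q : 'I_n -> R) (a b : 'X_{1..n}).

(** The Hasse derivative of order a of the monomial X^b at q. Where b_j < a_j the subtraction
    truncates, but the binomial coefficient is 0. *)
Definition taylor_coef q a b : R :=
  \prod_j (q j ^+ (b j - a j) *+ 'C(b j, a j)).

Lemma mcoeff_shiftX q a b : (shift q 'X_[b])@_a = taylor_coef q a b.
Proof.
pose M := (mdeg a + mdeg b).+1.
have ltM (m : 'X_{1..n}) j : (mdeg m <= mdeg a + mdeg b)%N -> (m j < M)%N.
  by rewrite ltnS; apply: leq_trans; rewrite mdegE (bigD1 j) //= leq_addr.
have aM j : (a j < M)%N by apply: ltM; rewrite leq_addr.
have bM j : (b j < M)%N by apply: ltM; rewrite leq_addl.
pose c j l : R := q j ^+ (b j - l) *+ 'C(b j, l).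
have expand j : ('X_j + (q j)%:MP_[n]) ^+ b j = \sum_(l < M) c j l *: 'X_j ^+ l.
  rewrite addrC exprDn (big_ord_widen M (fun l => (q j)%:MP_[n] ^+ (b j - l) * 'X_j ^+ l *+ 'C(b j, l))) //.
  rewrite big_mkcond; apply: eq_bigr => l _; rewrite ltnS /c; case: leqP => lb.
    by rewrite -rmorphXn mul_mpolyC -scalerMnl.
  by rewrite bin_small // mulr0n scale0r.
rewrite /shift mmapX /mmap1 (eq_bigr _ (fun j _ => expand j)) bigA_distr_bigA /=.
have termE (f : {ffun 'I_n -> 'I_M}) :
    (\prod_(j < n) (c j (f j) *: 'X_j ^+ f j))@_a
      = (\prod_j c j (f j)) * ([multinom (f j : nat) | j < n] == a)%:R.
  rewrite scaler_prod mcoeffZ -mcoeffX [in RHS]mpolyXE_id; congr (_ * _@_a).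
  by apply: eq_bigr => j _; rewrite mnmE.
pose f0 := [ffun j => Ordinal (aM j)].
have -> : (\sum_(f : {ffun 'I_n -> 'I_M}) \prod_(j < n) (c j (f j) *: 'X_j ^+ f j))@_a
    = \sum_(f : {ffun 'I_n -> 'I_M}) (\prod_(j < n) (c j (f j) *: 'X_j ^+ f j))@_a.
  exact: (raddf_sum (mcoeff a)).
rewrite (bigD1 f0) //= [X in _ + X]big1 => [|f ff0]; rewrite termE.
  rewrite addr0 (_ : _ == a) ?mulr1.
    by apply: eq_bigr => j _; rewrite /c ffunE.
  by apply/eqP/mnmP => j; rewrite mnmE ffunE.
case: eqP => [fa|]; last by rewrite mulr0.
case/eqP: ff0; apply/ffunP => j; rewrite ffunE; apply: val_inj.
by rewrite /= -fa mnmE.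
Qed.

Lemma mcoeff_shift q f a D : f \is D.-homog ->
  (shift q f)@_a = \sum_(b : 'X_{1..n < D.+1}) f@_b * taylor_coef q a b.
Proof.
move=> fD; have szf : (msize f <= D.+1)%N.
  by rewrite msizeE; apply/bigmax_leqP_seq => m /(dhomog_mf fD) mD _; rewrite ltnS mD.
rewrite {1}(mpolywE szf) /shift rmorph_sum (raddf_sum (mcoeff a)) /=; apply: eq_bigr => b _.
by rewrite mmapZ mul_mpolyC mcoeffZ mcoeff_shiftX.
Qed.

Lemma taylor_coef_eq0 q a b : (mdeg b < mdeg a)%N -> taylor_coef q a b = 0.
Proof.
move=> ba; have [j bj] : exists j, (b j < a j)%N.
  apply/existsP; apply: contraTT ba => /existsPn ba.
  by rewrite -leqNgt !mdegE; apply: leq_sum => j _; rewrite leqNgt ba.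
by rewrite /taylor_coef (bigD1 j) //= bin_small // mulr0n mul0r.
Qed.

End Taylor.

Lemma rmorph_taylor_coef n (R S : comNzRingType) (h : {rmorphism R -> S})
    (q : 'I_n -> R) a b : h (taylor_coef q a b) = taylor_coef (h \o q) a b.
Proof.
by rewrite rmorph_prod; apply: eq_bigr => j _; rewrite rmorphMn rmorphXn.
Qed.

(** * Linear systems as kernels of matrices *)

Section Interpolation.

Variables (N D : nat) (mu : 'I_N -> nat) (kill : pred 'X_{1..3}).

Let cond : Type := ('I_N * 'X_{1..3 < D.+1} + 'X_{1..3 < D.+1})%type.

(** Columns are the monomials of degree at most D. Rows [inl] are the Taylor conditions at the
    points; rows [inr] remove the monomials of degree other than D and those in [kill]. The guard on
    the degree of b makes all entries of a row [inl (i, a)] homogeneous of degree D - |a| in the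
    coordinates of the i-th point. *)
Definition interpolation (R : comNzRingType) (q : 'I_N -> 'I_3 -> R) (x : cond)
    (b : 'X_{1..3 < D.+1}) : R :=
  match x with
  | inl (i, a) => if (mdeg a < mu i)%N && (mdeg b == D) then taylor_coef (q i) a b else 0
  | inr c => if ((mdeg c != D) || kill c) && (c == b) then 1 else 0
  end.

Lemma rmorph_interpolation (R S : comNzRingType) (h : {rmorphism R -> S}) q x b :
  h (interpolation q x b) = interpolation (fun i => h \o q i) x b.
Proof.
by case: x => [[i a]|c] /=; case: ifP => _; rewrite ?rmorph0 ?rmorph1 ?rmorph_taylor_coef.
Qed.

Lemma eq_interpolation (R : comNzRingType) (q q' : 'I_N -> 'I_3 -> R) x b :
  (forall i j, q i j = q' i j) -> interpolation q x b = interpolation q' x b.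
Proof.
move=> qq'; case: x => [[i a]|c] //=; case: ifP => // _.
by apply: eq_bigr => j _; rewrite qq'.
Qed.

Definition in_system (R : comNzRingType) (q : 'I_N -> 'I_3 -> R) (f : {mpoly R[3]}) : Prop :=
  [/\ f \is D.-homog, forall b, kill b -> f@_b = 0 & forall i, low (mu i) (shift (q i) f)].

Lemma in_system_interpolation (R : comNzRingType) (q : 'I_N -> 'I_3 -> R) f :
  in_system q f -> forall x, \sum_b interpolation q x b * f@_(val b) = 0.
Proof.
case=> fD fkill flow [[i a]|c] /=; last first.
  rewrite (bigD1 c) //= eqxx andbT big1 ?addr0 => [|b bc].
    case: ifP => [/orP[cD|/fkill ->]|_]; rewrite ?mul0r ?mulr0 //.
    by rewrite mul1r (dhomog_nemf_coeff fD).
  by rewrite [c == b]eq_sym (negPf bc) andbF mul0r.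
have [lta|_] := ltnP (mdeg a) (mu i); last by rewrite big1 // => b _; rewrite mul0r.
have := flow i _ lta; rewrite (mcoeff_shift _ _ fD) => sum0.
rewrite -[RHS]sum0; apply: eq_bigr => b _; rewrite mulrC /=.
by case: eqP => // /eqP bD; rewrite (dhomog_nemf_coeff fD bD) !mul0r.
Qed.

Lemma interpolation_in_system (R : comNzRingType) (q : 'I_N -> 'I_3 -> R)
    (v : 'X_{1..3 < D.+1} -> R) :
  (forall x, \sum_b interpolation q x b * v b = 0) ->
  in_system q (\sum_b v b *: 'X_[val b]).
Proof.
move=> hv; set f := \sum_b _.
have fE (b : 'X_{1..3 < D.+1}) : f@_b = v b.
  rewrite /f raddf_sum /= (bigD1 b) //= mcoeffZ mcoeffX eqxx mulr1 big1 ?addr0 // => c cb.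
  by rewrite mcoeffZ mcoeffX -[_ == _ :> multinom _]/(c == b) (negPf cb) mulr0.
have f0 (b : 'X_{1..3}) : ~~ (mdeg b < D.+1)%N -> f@_b = 0.
  move=> bD; rewrite /f raddf_sum /= big1 // => c _.
  rewrite mcoeffZ mcoeffX; case: eqP => [cb|]; last by rewrite mulr0.
  by have := bmdeg c; rewrite cb (negPf bD).
have vkill (c : 'X_{1..3 < D.+1}) : (mdeg c != D) || kill c -> v c = 0.
  move=> hc; have := hv (inr c); rewrite /= hc (bigD1 c) //= eqxx mul1r big1 ?addr0 //.
  by move=> b bc; rewrite [c == b]eq_sym (negPf bc) mul0r.
have fD : f \is D.-homog.
  apply/dhomogP => b bf; apply/eqP; move: bf; apply: contraTT => bD.
  rewrite -mcoeff_eq0; apply/eqP; have [ltb|] := boolP (mdeg b < D.+1)%N; last exact: f0.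
  by rewrite (fE (BMultinom ltb)) vkill //= bD.
split=> // [b kb|i a lta].
  have [ltb|] := boolP (mdeg b < D.+1)%N; last exact: f0.
  by rewrite (fE (BMultinom ltb)) vkill //= kb orbT.
rewrite (mcoeff_shift _ _ fD); have [aD|aD] := boolP (mdeg a < D.+1)%N; last first.
  rewrite big1 // => b _; rewrite taylor_coef_eq0 ?mulr0 //.
  by apply: leq_trans (bmdeg b) _; rewrite leqNgt.
rewrite -[RHS](hv (inl (i, BMultinom aD))); apply: eq_bigr => b _; rewrite /= lta fE mulrC /=.
by case: eqP => // /eqP bD; rewrite vkill ?bD // mulr0 mul0r.
Qed.

Definition only_zero (K : fieldType) (p : 'I_N -> point K 2) : Prop :=
  forall f, in_system (fun i => hcoord (p i)) f -> f = 0.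

Lemma homogeneous_taylor_coef (K : fieldType) i a b :
  homogeneous_of (fun i' => (mdeg b - mdeg a) * (i' == i))%N
    (taylor_coef (fun j : 'I_3 => 'X_(mxvec_index i j) : {mpoly K[N * 3]}) a b).
Proof.
have [ba|ab] := boolP [exists j, (b j < a j)%N].
  case/existsP: ba => j bj; rewrite /taylor_coef (bigD1 j) //= bin_small // mulr0n mul0r.
  exact: homogeneous_of0.
have hX (j : 'I_3) : homogeneous_of (fun i' => (b j - a j) * (i' == i))%N
    ('X_(mxvec_index i j) ^+ (b j - a j) *+ 'C(b j, a j) : {mpoly K[N * 3]}).
  by rewrite -scaler_nat; apply: homogeneous_ofZ; apply: homogeneous_ofX.
move=> m mF i'; rewrite (homogeneous_of_prod hX mF) -big_distrl /= sumnB -?mdegE //.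
by move=> j _; move/existsPn/(_ j): ab; rewrite -leqNgt.
Qed.

Lemma homogeneous_interpolation (K : fieldType) (x : cond) : exists e, forall b,
  homogeneous_of e
    (interpolation (fun i (j : 'I_3) => 'X_(mxvec_index i j) : {mpoly K[N * 3]}) x b).
Proof.
case: x => [[i a]|c] /=.
  exists (fun i' => (D - mdeg a) * (i' == i))%N => b.
  case: ifP => [/andP[_ /eqP bD]|_]; last exact: homogeneous_of0.
  by have := @homogeneous_taylor_coef K i a b; rewrite bD; apply.
exists (fun=> 0%N) => b; case: ifP => _; [exact: homogeneous_ofC | exact: homogeneous_of0].
Qed.

Let interpolation_mx (R : comNzRingType) (q : 'I_N -> 'I_3 -> R) :=
  \matrix_(i < #|{: cond}|, j < #|{: 'X_{1..3 < D.+1}}|)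
     interpolation q (enum_val i) (enum_val j).

Lemma mul_interpolation_mx (R : comNzRingType) (q : 'I_N -> 'I_3 -> R)
    (v : 'cV_#|{: 'X_{1..3 < D.+1}}|) :
  interpolation_mx q *m v = 0 <->
  forall x, \sum_b interpolation q x b * v (enum_rank b) 0 = 0.
Proof.
split=> [/colP qv x | qv].
  have := qv (enum_rank x); rewrite !mxE => sum0.
  rewrite -[RHS]sum0 (reindex _ (onW_bij _ (enum_val_bij _))) /=.
  by apply: eq_bigr => j _; rewrite mxE enum_rankK enum_valK.
apply/matrixP => i j; rewrite ord1 mxE [RHS]mxE -[RHS](qv (enum_val i)).
rewrite [RHS](reindex _ (onW_bij _ (enum_val_bij _))) /=.
by apply: eq_bigr => l _; rewrite mxE enum_valK.
Qed.

Lemma only_zero_injective (K : fieldType) (p : 'I_N -> point K 2) :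
  only_zero p <->
  forall v : 'cV_#|{: 'X_{1..3 < D.+1}}|,
    interpolation_mx (fun i => hcoord (p i)) *m v = 0 -> v = 0.
Proof.
split=> [p0 v /mul_interpolation_mx/interpolation_in_system/p0 | inj f fsys].
  move=> v0; apply/colP => j; rewrite mxE.
  have := congr1 (mcoeff (val (enum_val j))) v0; rewrite mcoeff0 raddf_sum /=.
  rewrite (bigD1 (enum_val j)) //= mcoeffZ mcoeffX eqxx mulr1 enum_valK big1 ?addr0 //.
  move=> b bj; rewrite mcoeffZ mcoeffX.
  by rewrite -[_ == _ :> multinom _]/(b == enum_val j) (negPf bj) mulr0.
have /inj v0 : interpolation_mx (fun i => hcoord (p i))
    *m (\col_j f@_(val (enum_val j))) = 0.
  apply/mul_interpolation_mx => x; rewrite -[RHS](in_system_interpolation fsys x).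
  by apply: eq_bigr => b _; rewrite mxE enum_rankK.
case: fsys => fD _ _; apply/mpolyP => b; rewrite mcoeff0.
have [bD|bD] := eqVneq (mdeg b) D; last by rewrite (dhomog_nemf_coeff fD bD).
have ltb : (mdeg b < D.+1)%N by rewrite bD.
by have /colP/(_ (enum_rank (BMultinom ltb))) := v0; rewrite !mxE enum_rankK.
Qed.

(** A maximal minor that is nonzero at [p0] is a multihomogeneous polynomial in the coordinates, and
    the matrix stays injective wherever this minor is nonzero. *)
Lemma only_zero_near (K : fieldType) (p0 : 'I_N -> point K 2) :
  only_zero p0 -> general_near p0 (@only_zero K).
Proof.
move/only_zero_injective/injective_minor => [g gp0].
pose X i (j : 'I_3) : {mpoly K[N * 3]} := 'X_(mxvec_index i j).
have evalX p : \det (rowsub g (interpolation_mx (fun i => hcoord (p i))))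
    = eval_at (\det (rowsub g (interpolation_mx X))) p.
  rewrite /eval_at -det_map_mx; congr (\det _); apply/matrixP => i j.
  rewrite !mxE rmorph_interpolation; apply: eq_interpolation => i' j' /=.
  exact/esym/eval_atX.
exists (\det (rowsub g (interpolation_mx X))); split.
- have /fin_all_exists[e he] i := homogeneous_interpolation K (enum_val (g i)).
  exists (fun l => \sum_i e i l)%N; apply: homogeneous_of_det => i j.
  by rewrite !mxE; apply: he.
- by rewrite -evalX.
by move=> p; rewrite -evalX => gp; apply/only_zero_injective => v; apply: det_injective gp.
Qed.

(** If points moving polynomially in t carry no form over K[t], some maximal minor is a nonzero
    polynomial in t, and a value of t that is not a root gives a configuration over K. *)
Lemma only_zero_path (K : numFieldType) (q : 'I_N -> 'I_3 -> {poly K})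
    (p : K -> 'I_N -> point K 2) :
  (forall t i j, hcoord (p t i) j = (q i j).[t]) ->
  (forall f, in_system q f -> f = 0) -> exists t, only_zero (p t).
Proof.
move=> pq q0; have [[g gq]|[v v0 /mul_interpolation_mx/interpolation_in_system/q0 f0]] :=
  minor_or_kernel (interpolation_mx q); last first.
  case/eqP: v0; apply/colP => j; rewrite mxE.
  have := congr1 (mcoeff (val (enum_val j))) f0; rewrite mcoeff0 (raddf_sum (mcoeff _)) /=.
  rewrite (bigD1 (enum_val j)) //= mcoeffZ mcoeffX eqxx mulr1 enum_valK big1 ?addr0 //.
  move=> b bj; rewrite mcoeffZ mcoeffX.
  by rewrite -[_ == _ :> multinom _]/(b == enum_val j) (negPf bj) mulr0.
have [t gt] := nonroot gq; exists t; apply/only_zero_injective => w; apply: (@det_injective _ _ _ _ g).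
apply: contraNneq gt => <-; rewrite -horner_evalE -det_map_mx; apply/eqP; congr (\det _).
apply/matrixP => i j; rewrite !mxE rmorph_interpolation.
by apply: eq_interpolation => i' j' /=; rewrite pq.
Qed.

End Interpolation.

(** * Curves through the grid *)

Section Univariate.

Variable K : numFieldType.
Implicit Types (P Q : {poly K}) (s : seq K).

Definition roots_at (a n : nat) : {poly K} := \prod_(i <- iota a n) ('X - i%:R%:P).

Lemma roots_at_monic a n : roots_at a n \is monic.
Proof. exact: monic_prod_XsubC. Qed.

Lemma size_roots_at a n : size (roots_at a n) = n.+1.
Proof. by rewrite size_prod_XsubC size_iota. Qed.

Lemma root_roots_at a n i : root (roots_at a n) i%:R = (a <= i < a + n)%N.
Proof.
rewrite /roots_at -(big_map (fun i => i%:R) xpredT (fun z => 'X - z%:P)) root_prod_XsubC.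
by rewrite mem_map ?mem_iota // => x y /eqP; rewrite Num.Theory.eqr_nat => /eqP.
Qed.

Lemma roots_at_dvd a n k P :
  (forall i, (a <= i < a + n)%N -> ('X - i%:R%:P) ^+ k %| P) -> roots_at a n ^+ k %| P.
Proof.
rewrite /roots_at; elim: n a => [|n IH] a hP; first by rewrite big_nil expr1n dvd1p.
rewrite /= big_cons exprMn Gauss_dvdp; last first.
  by rewrite coprimep_expl // coprimep_expr // coprimep_sym coprimep_XsubC
    root_roots_at ltnn.
rewrite hP; last by lia.
by apply: IH => i hi; apply: hP; lia.
Qed.

Lemma monic_multiple P Q : Q \is monic -> (size P <= size Q)%N -> Q %| P ->
  P = P`_(size Q).-1 *: Q.
Proof.
move=> mQ sPQ QP; pose c : {poly K} := P %/ Q.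
have PE : P = c * Q by rewrite divpK.
clearbody c; have [c0|c0] := eqVneq c 0.
  by rewrite PE c0 mul0r coef0 scale0r.
have sc : (size c <= 1)%N.
  have Q0 : (0 < size Q)%N by rewrite lt0n size_poly_eq0 monic_neq0.
  by move: sPQ; rewrite PE size_Mmonic //; lia.
have [c1 cE] : exists c1, c = c1%:P by exists c`_0; apply: size1_polyC.
rewrite PE cE mul_polyC coefZ -lead_coefE (monicP mQ) mulr1 //.
Qed.

Lemma roots_at_multiple a n k P : (size P <= (n * k).+1)%N ->
  (forall i, (a <= i < a + n)%N -> ('X - i%:R%:P) ^+ k %| P) ->
  P = P`_(n * k) *: roots_at a n ^+ k.
Proof.
move=> sP /roots_at_dvd; have mQ := monic_exp k (roots_at_monic a n).
have sQ : (size (roots_at a n ^+ k)).-1 = (n * k)%N by rewrite size_exp size_roots_at.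
have sQ' : size (roots_at a n ^+ k) = (n * k).+1.
  by rewrite -sQ prednK // lt0n size_poly_eq0 monic_neq0.
by move/(monic_multiple mQ); rewrite sQ sQ'; apply.
Qed.

Lemma horner_roots_at_nat a n x :
  (roots_at a n).[x%:R] = \prod_(i <- iota a n) (x%:R - i%:R).
Proof. by rewrite horner_prod; apply: eq_bigr => i _; rewrite !hornerE. Qed.

Lemma horner_roots_at_sub a n x : (forall i, (a <= i < a + n)%N -> (i < x)%N) ->
  (roots_at a n).[x%:R] = (\prod_(i <- iota a n) (x - i))%N%:R.
Proof.
move=> ax; rewrite horner_roots_at_nat natr_prod; apply: eq_big_seq => i.
by rewrite mem_iota => /ax /ltnW ix; rewrite natrB.
Qed.

Lemma horner_roots_at_opp a n x : (x <= a)%N ->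
  (roots_at a n).[x%:R] = (-1) ^+ n * (\prod_(i <- iota a n) (i - x))%N%:R.
Proof.
rewrite horner_roots_at_nat; elim: n a => [|n IH] a xa; first by rewrite !big_nil mulr1.
rewrite /= !big_cons IH ?leqW // natrM natrB // exprS; ring.
Qed.

Lemma roots_at_simple a n i : (a <= i < a + n)%N ->
  exists2 Q, roots_at a n = ('X - i%:R%:P) * Q & Q.[i%:R] != 0.
Proof.
move=> ai; exists (\prod_(i' <- iota a n | i' != i) ('X - i'%:R%:P)).
  by rewrite /roots_at (bigD1_seq i) ?mem_iota ?iota_uniq.
rewrite horner_prod prodf_seq_neq0; apply/allP => i' _; apply/implyP => ii'.
by rewrite !hornerE subr_eq0 Num.Theory.eqr_nat eq_sym.
Qed.

Lemma prod_iota_ltn (F G : nat -> nat) a n : (0 < n)%N ->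
  (forall i, (a <= i < a + n)%N -> (0 < F i < G i)%N) ->
  (\prod_(i <- iota a n) F i < \prod_(i <- iota a n) G i)%N.
Proof.
elim: n a => // n IH a _ FG; rewrite /= !big_cons.
have /andP[Fa FGa] := FG a ltac:(lia).
have [->|n0] := posnP n; first by rewrite !big_nil !muln1.
by apply: ltn_mul => //; apply: IH => // i hi; apply: FG; lia.
Qed.

End Univariate.

Section AffinePlane.

Variable K : numFieldType.
Implicit Types (G H : {poly {poly K}}) (c : K).

(* [G`_i`_j] is the coefficient of y^i z^j. *)
Definition trapezoid (A B : nat) G : Prop :=
  forall i j, ((A <= j) || (B <= i + j))%N -> G`_i`_j = 0.

Definition at_y c G : {poly K} := G.[c%:P].
Definition at_z c G : {poly K} := map_poly (horner_eval c) G.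

Lemma at_yM c G H : at_y c (G * H) = at_y c G * at_y c H.
Proof. exact: hornerM. Qed.

Lemma at_zM c G H : at_z c (G * H) = at_z c G * at_z c H.
Proof. exact: rmorphM. Qed.

Lemma at_yX c G n : at_y c (G ^+ n) = at_y c G ^+ n.
Proof. exact: horner_exp. Qed.

Lemma at_zX c G n : at_z c (G ^+ n) = at_z c G ^+ n.
Proof. exact: rmorphXn. Qed.

Lemma at_z_at_y b c G : (at_z c G).[b] = (at_y b G).[c].
Proof.
rewrite /at_z /at_y -[(G.[_]).[c]]/(horner_eval c _) -horner_map /=.
by rewrite /horner_eval hornerC.
Qed.

Lemma coef_at_z c G i : (at_z c G)`_i = (G`_i).[c].
Proof. by rewrite coef_map. Qed.

Lemma coef_mulXsubC (R : nzRingType) (a : R) (P : {poly R}) i :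
  (('X - a%:P) * P)`_i.+1 = P`_i - a * P`_i.+1.
Proof. by rewrite mulrBl coefB coefXM coefCM. Qed.

(* Descending induction on the coefficients of the quotient. *)
Lemma coef_div_XsubC (R : nzRingType) (Z : nat -> R -> Prop) (a : R) (P : {poly R}) :
  (forall i, Z i 0) -> (forall i x y, Z i x -> Z i.+1 y -> Z i (x + a * y)) ->
  (forall i, Z i (('X - a%:P) * P)`_i.+1) -> forall i, Z i P`_i.
Proof.
move=> Z0 Za ZP i; have [n le_n] : exists n, (size P <= i + n)%N.
  by exists (size P); rewrite leq_addl.
elim: n i le_n => [|n IH] i le_n; first by rewrite nth_default // -(addn0 i).
have -> : P`_i = (('X - a%:P) * P)`_i.+1 + a * P`_i.+1 by rewrite coef_mulXsubC subrK.
by apply: Za => //; apply: IH; rewrite addSnnS.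
Qed.

Lemma trapezoid_div_y A B c G :
  trapezoid A B (('X - c%:P%:P) * G) -> trapezoid A B.-1 G.
Proof.
move=> hG i j.
pose Z (i : nat) (x : {poly K}) := ((A <= j) || (B.-1 <= i + j))%N -> x`_j = 0.
apply: (@coef_div_XsubC _ Z (c%:P) G); rewrite /Z.
- by move=> i' _; rewrite coef0.
- move=> i' x y x0 y0 hi'; rewrite coefD coefCM x0 ?y0 ?mulr0 ?addr0 //; lia.
by move=> i' hi'; apply: hG; lia.
Qed.

Lemma trapezoid_div_z A B c G :
  trapezoid A B (('X - c%:P)%:P * G) -> trapezoid A.-1 B.-1 G.
Proof.
move=> hG i j.
pose Z (j : nat) (x : K) := ((A.-1 <= j) || (B.-1 <= i + j))%N -> x = 0.
apply: (@coef_div_XsubC _ Z c G`_i); rewrite /Z //.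
- by move=> j' x y x0 y0 hj'; rewrite x0 ?y0 ?mulr0 ?addr0 //; lia.
by move=> j' hj'; rewrite -coefCM; apply: hG; lia.
Qed.

Lemma trapezoid_eq0 A B G : (A == 0)%N || (B == 0)%N -> trapezoid A B G -> G = 0.
Proof.
move=> AB hG; apply/polyP => i; apply/polyP => j; rewrite !coef0 hG //.
by case/orP: AB => /eqP ->; rewrite ?orbT.
Qed.

Lemma trapezoid_size_y A B c G : trapezoid A B G -> (size (at_y c G) <= A)%N.
Proof.
move=> hG; apply/leq_sizeP => j Aj; rewrite /at_y horner_coef coef_sum big1 // => i _.
by rewrite -rmorphXn coefMC hG ?mul0r // Aj.
Qed.

Lemma trapezoid_size_z A B c G : trapezoid A B G -> (size (at_z c G) <= B)%N.
Proof.
move=> hG; apply/leq_sizeP => i Bi; rewrite coef_at_z; have -> : G`_i = 0.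
  by apply/polyP => j; rewrite coef0 hG //; lia.
by rewrite horner0.
Qed.

(* The restrictions to the lines z = c share their point at infinity. *)
Lemma trapezoid_coef_z A B c G : trapezoid A B G -> (at_z c G)`_B.-1 = G`_B.-1`_0.
Proof.
move=> hG; rewrite coef_at_z; have GE : G`_B.-1 = (G`_B.-1`_0)%:P.
  by apply/polyP => -[|j]; rewrite coefC //= hG //; lia.
by rewrite {1}GE hornerC.
Qed.

Lemma trapezoid11 G : trapezoid 1 1 G -> G = (G`_0`_0)%:P%:P.
Proof.
by move=> hG; apply/polyP => -[|i]; rewrite coefC /=; apply/polyP => -[|j];
  rewrite ?coefC ?coef0 //= hG //; lia.
Qed.

Lemma at_y_div c G : at_y c G = 0 -> exists H, G = ('X - c%:P%:P) * H.
Proof. by move/eqP/factor_theorem => [H ->]; exists H; rewrite mulrC. Qed.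

Lemma at_y_div_roots a n G :
  (forall i, (a <= i < a + n)%N -> at_y i%:R G = 0) ->
  exists H, G = map_poly polyC (roots_at K a n) * H.
Proof.
elim: n a G => [|n IH] a G hG.
  by exists G; rewrite /roots_at big_nil rmorph1 mul1r.
have [|H GE] := @at_y_div a%:R G; first by apply: hG; lia.
have [i hi|H' HE] := IH a.+1 H.
  have : at_y i%:R G = 0 by apply: hG; lia.
  rewrite GE at_yM => /eqP; rewrite mulf_eq0 => /orP[|/eqP //].
  rewrite /at_y !hornerE -rmorphB polyC_eq0 subr_eq0 Num.Theory.eqr_nat; lia.
exists H'; rewrite GE HE mulrA /roots_at /= big_cons rmorphM /= rmorphB /= map_polyX.
by rewrite map_polyC.
Qed.

Lemma at_z_div_roots a n G :
  (forall i, (a <= i < a + n)%N -> at_z i%:R G = 0) ->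
  exists H, G = (roots_at K a n)%:P * H.
Proof.
move=> hG; exists (map_poly (fun P => P %/ roots_at K a n) G).
apply/polyP => i; rewrite coefCM coef_map_id0 ?div0p // mulrC divpK //.
rewrite -[roots_at K a n]expr1; apply: roots_at_dvd => j hj; rewrite expr1 dvdp_XsubCl.
by rewrite rootE -coef_at_z hG // coef0.
Qed.

Lemma at_y_map c (P : {poly K}) : at_y c (map_poly polyC P) = (P.[c])%:P.
Proof. exact: horner_map. Qed.

Lemma at_z_map c (P : {poly K}) : at_z c (map_poly polyC P) = P.
Proof. by apply/polyP => i; rewrite coef_at_z coef_map hornerC. Qed.

Lemma at_yC c (P : {poly K}) : at_y c P%:P = P.
Proof. exact: hornerC. Qed.

Lemma at_zC c (P : {poly K}) : at_z c P%:P = (P.[c])%:P.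
Proof. exact: map_polyC. Qed.

End AffinePlane.

(** Up to the common sign, both sides are powers of products of positive integers, and each factor
    at 1 is one less than the factor at 0. This inequality violates the relation that the crossings
    with z = 0 and z = 1 would impose. *)
Lemma grid_carnot (K : numFieldType) m n : (1 < m)%N -> (0 < n)%N ->
  (roots_at K m m).[0%:R] ^+ n != (roots_at K m m).[1%:R] ^+ n.
Proof.
move=> m_gt1 n0; rewrite !horner_roots_at_opp; [|lia|lia]; rewrite !exprMn.
rewrite (inj_eq (mulfI _)) ?expf_neq0 ?oppr_eq0 ?oner_eq0 // -!natrX Num.Theory.eqr_nat.
by rewrite eqn_exp2r // gtn_eqF // prod_iota_ltn // => [|i hi]; lia.
Qed.

(** The consequence of multiplicity k at (a, b) that the grid argument uses: after n copies of the
    line y = a, or of z = b, are split off, the restriction of the rest to that line vanishes to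
    order k - n at the point. *)
Definition affine_mult (K : numFieldType) (k : nat) (F : {poly {poly K}}) (a b : K) : Prop :=
  (forall n G, F = ('X - a%:P%:P) ^+ n * G -> ('X - b%:P) ^+ (k - n) %| at_y a G) /\
  (forall n G, F = ('X - b%:P)%:P ^+ n * G -> ('X - a%:P) ^+ (k - n) %| at_z b G).

Section Grid.

Variables (K : numFieldType) (l m : nat).
Implicit Types (F G H : {poly {poly K}}).

Let d := (l + m)%N.

(* The curve made of the lines y = 0, ..., l - 1 and z = 0, ..., m - 1.  The   *)
(* base points are (i, m + j) on the former and (l + i, j) on the latter.      *)
Let B := roots_at K 0 l.
Let C := roots_at K 0 m.
Definition grid : {poly {poly K}} := map_poly polyC B * C%:P.

Lemma trapezoid_div_grid a b G :
  trapezoid a b (grid * G) -> trapezoid (a - m) (b - d) G.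
Proof.
have divy s a' b' H : trapezoid a' b' (map_poly polyC (\prod_(i <- s) ('X - (i : nat)%:R%:P)) * H) ->
    trapezoid a' (b' - size s) H.
  elim: s a' b' H => [|x s IH] a' b' H; first by rewrite big_nil rmorph1 mul1r subn0.
  rewrite big_cons rmorphM /= rmorphB /= map_polyX map_polyC /= -mulrA.
  by move/trapezoid_div_y/IH; rewrite -subn1 -subnDA.
have divz s a' b' H : trapezoid a' b' ((\prod_(i <- s) ('X - (i : nat)%:R%:P))%:P * H) ->
    trapezoid (a' - size s) (b' - size s) H.
  elim: s a' b' H => [|x s IH] a' b' H; first by rewrite big_nil mul1r !subn0.
  rewrite big_cons rmorphM /= -mulrA.
  by move/trapezoid_div_z/IH; rewrite -!subn1 -!subnDA.
by rewrite /grid -mulrA => /divy/divz; rewrite !size_iota -subnDA.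
Qed.

Lemma trapezoid_div_gridX n a b G :
  trapezoid a b (grid ^+ n * G) -> trapezoid (a - n * m) (b - n * d) G.
Proof.
elim: n a b G => [|n IH] a b G; first by rewrite mul1r !subn0.
rewrite exprS -mulrA => /trapezoid_div_grid/IH.
by rewrite -!subnDA !mulSn.
Qed.

Lemma at_y_grid (i : nat) : (i < l)%N -> at_y i%:R grid = 0.
Proof.
move=> il; rewrite /grid at_yM at_y_map (rootP _) ?mul0r //.
by rewrite root_roots_at.
Qed.

Lemma grid_div G : (forall i, (i < l)%N -> at_y i%:R G = 0) ->
  (forall j, (j < m)%N -> at_z j%:R G = 0) -> exists H, G = grid * H.
Proof.
move=> Gy Gz; have [//|H GE] := @at_y_div_roots _ 0 l G.
have [j hj|H' HE] := @at_z_div_roots _ 0 m H; last by exists H'; rewrite GE HE mulrA.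
move: (Gz j hj); rewrite GE at_zM at_z_map => /eqP.
by rewrite mulf_eq0 (negPf (monic_neq0 (roots_at_monic _ _ _))) => /eqP.
Qed.

Lemma XsubC_dvd_cancel (a c : K) (e r : nat) (P Q : {poly K}) : c != 0 -> ~~ root Q a ->
  ('X - a%:P) ^+ r %| (c *: Q) ^+ e * P -> ('X - a%:P) ^+ r %| P.
Proof.
move=> c0 Qa; rewrite Gauss_dvdpr // coprimep_expl // coprimep_expr // coprimep_sym.
by rewrite coprimep_XsubC rootZ.
Qed.

(** Among the lines of the grid only y = i passes through (i, j), so n grids account for
    multiplicity n there and the other lines can be cancelled. *)
Lemma grid_order_y k n F G i j : affine_mult k F i%:R j%:R -> F = grid ^+ n * G ->
  (i < l)%N -> (m <= j)%N -> ('X - j%:R%:P) ^+ (k - n) %| at_y i%:R G.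
Proof.
move=> [hF _] FE il mj; have [|Q BE Qi] := @roots_at_simple K 0 l i; first by lia.
have := hF n ((map_poly polyC Q * C%:P) ^+ n * G).
rewrite FE /grid /B BE rmorphM /= rmorphB /= map_polyX map_polyC /= -[_ * _ * C%:P]mulrA exprMn -mulrA.
move/(_ erefl); rewrite at_yM at_yX at_yM at_y_map at_yC mul_polyC.
by apply: XsubC_dvd_cancel => //; rewrite root_roots_at; lia.
Qed.

Lemma grid_order_z k n F G i j : affine_mult k F i%:R j%:R -> F = grid ^+ n * G ->
  (l <= i)%N -> (j < m)%N -> ('X - i%:R%:P) ^+ (k - n) %| at_z j%:R G.
Proof.
move=> [_ hF] FE li jm; have [|Q CE Qj] := @roots_at_simple K 0 m j; first by lia.
have := hF n ((Q%:P * map_poly polyC B) ^+ n * G).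
rewrite FE /grid /C CE rmorphM /= [map_poly polyC B * _]mulrC -[_ * _ * map_poly _ _]mulrA exprMn -mulrA.
move/(_ erefl); rewrite at_zM at_zX at_zM at_z_map at_zC mul_polyC.
by apply: XsubC_dvd_cancel => //; rewrite root_roots_at; lia.
Qed.

Hypotheses (l_gt0 : (0 < l)%N) (m_gt1 : (1 < m)%N).

(** On each line the zeros at the base points exhaust the degree, so the restrictions are [gam]
    times a known polynomial on every z = j and [del] times one on y = i. Equating the values at
    crossings makes all these scalars zero. *)
Lemma grid_lines n G : (0 < n)%N -> trapezoid (n * m).+1 (n * d).+1 G ->
  (forall i j, (i < l)%N -> (m <= j < m + m)%N -> ('X - j%:R%:P) ^+ n %| at_y i%:R G) ->
  (forall i j, (l <= i < l + d)%N -> (j < m)%N -> ('X - i%:R%:P) ^+ n %| at_z j%:R G) ->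
  exists H, G = grid * H.
Proof.
move=> n0 hG hy hz; rewrite mulnC [(n * d)%N]mulnC in hG.
pose gam := G`_(d * n)`_0.
have Gz j : (j < m)%N -> at_z j%:R G = gam *: roots_at K l d ^+ n.
  move=> jm; have := trapezoid_coef_z j%:R hG; rewrite /= -/gam => <-.
  by apply: roots_at_multiple; [apply: trapezoid_size_z hG | move=> i hi; apply: hz].
have Gy i : (i < l)%N -> exists del, at_y i%:R G = del *: roots_at K m m ^+ n.
  move=> il; exists (at_y i%:R G)`_(m * n).
  by apply: roots_at_multiple; [apply: trapezoid_size_y hG | move=> j hj; apply: hy].
have [del0 Gy0] := Gy 0%N l_gt0.
have cross i j del : (i < l)%N -> (j < m)%N -> at_y i%:R G = del *: roots_at K m m ^+ n ->
    del * (roots_at K m m).[j%:R] ^+ n = gam * (roots_at K l d).[i%:R] ^+ n.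
  move=> il jm Gi; rewrite -!horner_exp -!hornerZ -Gi -(Gz j jm); exact/esym/at_z_at_y.
(* The crossings of y = 0 with z = 0 and z = 1 have the same right-hand side in [cross]. *)
have del00 : del0 = 0.
  have := cross 0%N 0%N del0 l_gt0 (ltnW m_gt1) Gy0.
  rewrite -(cross 0%N 1%N del0 l_gt0 m_gt1 Gy0) => /eqP; rewrite -subr_eq0 -mulrBr mulf_eq0.
  by rewrite subr_eq0 (negPf (grid_carnot K m_gt1 n0)) orbF => /eqP.
have gam0 : gam = 0.
  have /eqP := cross 0%N 0%N del0 l_gt0 (ltnW m_gt1) Gy0.
  rewrite del00 mul0r eq_sym mulf_eq0 expf_eq0 n0 /= => /orP[/eqP //|].
  by rewrite -rootE root_roots_at; lia.
apply: grid_div => [i il | j jm]; last by rewrite Gz // gam0 scale0r.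
have [del Gi] := Gy i il; rewrite Gi.
have /eqP := cross i 0%N del il (ltnW m_gt1) Gi.
rewrite gam0 mul0r mulf_eq0 expf_eq0 n0 /= => /orP[/eqP ->|]; first by rewrite scale0r.
by rewrite -rootE root_roots_at; lia.
Qed.

Definition grid_point (i j : nat) : bool :=
  ((i < l) && (m <= j < m + m) || (l <= i < l + d) && (j < m))%N.

(** Each division by the grid lowers the degree and the multiplicities as k -> k - 1 does, so
    [grid_lines] applies k times and leaves a constant. *)
Lemma grid_system k F : trapezoid (k * m).+1 (k * d).+1 F ->
  (forall i j, grid_point i j -> affine_mult k F i%:R j%:R) ->
  exists c : K, F = c%:P%:P * grid ^+ k.
Proof.
move=> hF multF; have powF n : (n <= k)%N -> exists G, F = grid ^+ n * G.
  elim: n => [|n IH] nk; first by exists F; rewrite mul1r.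
  have [G FE] := IH (ltnW nk).
  have [|||i j hi hj|H GE] := @grid_lines (k - n) G.
  - by rewrite subn_gt0.
  - move: hF; rewrite {1}FE => /trapezoid_div_gridX.
    by rewrite !subSn ?leq_mul2r ?(ltnW nk) ?orbT // -!mulnBl.
  - move=> i j hi hj; apply: grid_order_y FE _ _ => //; last by lia.
    by apply: multF; rewrite /grid_point; lia.
  - apply: grid_order_z FE _ _ => //; last by lia.
    by apply: multF; rewrite /grid_point; lia.
  by exists H; rewrite FE GE mulrA -exprSr.
have [G FE] := powF k (leqnn k); exists G`_0`_0.
rewrite [LHS]FE mulrC -trapezoid11 //.
by move: hF; rewrite FE => /trapezoid_div_gridX; rewrite !subSn // !subnn.
Qed.

End Grid.

Lemma last_success (P : nat -> Prop) n : P 0%N -> ~ P n -> exists s, P s /\ ~ P s.+1.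
Proof.
move=> P0 Pn; apply: NNPP => hP; apply: Pn; elim: n => // n Pn.
by apply: NNPP => PSn; apply: hP; exists n.
Qed.

(** * Moving one base point of the grid *)

Section GridDeformation.

Variables (K : numFieldType) (l m : nat).
Hypotheses (l_gt0 : (0 < l)%N) (m_gt1 : (1 < m)%N) (lm_gt3 : (3 < l + m)%N).
Implicit Types (F G H : {poly {poly K}}).

Let d := (l + m)%N.
Let f : {poly {poly K}} := grid K l m.

Definition fixed_point (i j : nat) : bool :=
  grid_point l m i j && ((i != 0) || (j != m))%N.

(* This is where d >= 4 is used: two roots of e + a C on the line y = 0 give   *)
(* a = 0 unless m = 2, and then there is a second line y = 1.                  *)
Lemma grid_special G : trapezoid m.+1 d.+1 G ->
  (forall i j, fixed_point i j -> (at_y i%:R G).[j%:R] = 0) -> (at_y 0%:R G).[m%:R] = 0.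
Proof.
move=> hG G0; pose gam := G`_d`_0.
have root_y i j : (i < l)%N -> (m <= j < m + m)%N -> (i != 0)%N || (j != m)%N ->
    (at_y i%:R G).[j%:R] = 0.
  by move=> il jm ij; apply: G0; rewrite /fixed_point /grid_point il jm ij.
have Gz j : (j < m)%N -> at_z j%:R G = gam *: roots_at K l d.
  move=> jm; have := trapezoid_coef_z j%:R hG; rewrite /= -/gam => <-.
  rewrite -[roots_at _ _ _]expr1 -{1}[d]muln1; apply: roots_at_multiple.
    by rewrite muln1; apply: trapezoid_size_z hG.
  move=> i hi; rewrite expr1 dvdp_XsubCl; apply/rootP; rewrite at_z_at_y; apply: G0.
  by rewrite /fixed_point /grid_point; lia.
have cross i j : (j < m)%N -> (at_y i%:R G).[j%:R] = gam * (roots_at K l d).[i%:R].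
  by move=> jm; rewrite -at_z_at_y Gz // hornerZ.
pose e := gam * (roots_at K l d).[0%:R].
(* By [cross], the restriction to y = 0 takes the same value e at the m crossings z = 0, ..., m - 1,
   and its degree is at most m. *)
have [a G0E] : exists a, at_y 0%:R G = e%:P + a *: roots_at K 0 m.
  pose P := at_y 0%:R G - e%:P; exists P`_(m * 1).
  have <- : P = P`_(m * 1) *: roots_at K 0 m.
    rewrite -[in RHS](expr1 (roots_at K 0 m)); apply: roots_at_multiple.
      rewrite muln1 (leq_trans (size_polyD _ _)) // geq_max (trapezoid_size_y _ hG).
      by rewrite size_polyN (leq_trans (size_polyC_leq1 _)).
    by move=> j hj; rewrite expr1 dvdp_XsubCl rootE hornerD hornerN hornerC cross // subrr.
  by rewrite addrC subrK.
have e_zero j : (m < j < m + m)%N -> e + a * (roots_at K 0 m).[j%:R] = 0.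
  move=> hj; rewrite -hornerZ -(hornerC e j%:R) -hornerD -G0E; apply: root_y; lia.
have C0 j : (m <= j)%N -> (roots_at K 0 m).[j%:R] != 0.
  by move=> mj; rewrite -rootE root_roots_at; lia.
suff [e0 a0] : e = 0 /\ a = 0 by rewrite G0E e0 a0 scale0r addr0 horner0.
have [m2|m_neq2] := eqVneq m 2.
  (* For m = 2 the degree bound gives l >= 2, and on the line y = 1 all base points are fixed, so
     the argument of [grid_lines] works there and yields gam = 0. *)
  have [del G1E] : exists del, at_y 1%:R G = del *: roots_at K m m.
    exists (at_y 1%:R G)`_(m * 1); rewrite -[roots_at _ _ _]expr1.
    apply: roots_at_multiple; first by rewrite muln1; apply: trapezoid_size_y hG.
    by move=> j hj; rewrite expr1 dvdp_XsubCl; apply/rootP/root_y => //; lia.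
  have := cross 1%N 0%N (ltnW m_gt1); rewrite -(cross 1%N 1%N m_gt1) G1E !hornerZ.
  move/eqP; rewrite -subr_eq0 -mulrBr mulf_eq0 subr_eq0.
  have := @grid_carnot K m 1 m_gt1 isT; rewrite !expr1 => /negPf ->; rewrite orbF => /eqP del0.
  have := cross 1%N 0%N (ltnW m_gt1); rewrite G1E del0 scale0r horner0 => /esym/eqP.
  rewrite mulf_eq0 -rootE root_roots_at => /orP[/eqP gam0|]; last by lia.
  have e0 : e = 0 by rewrite /e gam0 mul0r.
  split=> //; have := e_zero m.+1; rewrite e0 add0r => /(_ ltac:(lia))/eqP.
  by rewrite mulf_eq0 (negPf (C0 _ _)) // orbF => /eqP.
(* For m >= 3 the fixed points (0, m + 1) and (0, m + 2) are available, and [roots_at K 0 m] takes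
   different values at them. *)
have a0 : a = 0.
  have /addrI/eqP : e + a * (roots_at K 0 m).[m.+1%:R] = e + a * (roots_at K 0 m).[m.+2%:R].
    by rewrite !e_zero //; lia.
  rewrite -subr_eq0 -mulrBr mulf_eq0 => /orP[/eqP //|]; rewrite subr_eq0.
  rewrite !horner_roots_at_sub; [|by lia|by lia].
  by rewrite Num.Theory.eqr_nat ltn_eqF // prod_iota_ltn // => [|i hi]; lia.
by split=> //; have := e_zero m.+1 ltac:(lia); rewrite a0 mul0r addr0.
Qed.

(* F_j is the coefficient of t^j of a curve with base points of which only     *)
(* (0, m) moves, as (t, m).  If F is nonzero then, for a suitable s, each      *)
(* F_(s-n) with n <= s is divisible by the n-th power of the grid f = y h, and *)
(* a last quotient G_(n1) with n1 <= k is not divisible by f.  If n1 < k this  *)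
(* contradicts [grid_lines].  If n1 = k the condition of order k - 1 at the    *)
(* moving point reads k h(0, m)^k G_k = 0, since G_(k-1) passes through (0, m) *)
(* by [grid_special].                                                          *)
Lemma grid_deformation k (F : nat -> {poly {poly K}}) : (0 < k)%N ->
  (forall j, trapezoid (k * m).+1 (k * d).+1 (F j)) ->
  (forall j a b, fixed_point a b -> affine_mult k (F j) a%:R b%:R) ->
  (forall s i, (i < k)%N ->
     ('X - m%:R%:P) ^+ (k - i) %| \sum_(n < s.+1) (F (s - n)%N)`_n *+ 'C(n, i)) ->
  forall j, F j = 0.
Proof.
move=> k0 hF multF special j0; apply: NNPP => Fj0.
(* More than k copies of the grid exceed the degree bounds. *)
have pow_le n G : G <> 0 -> (exists j, F j = f ^+ n * G) -> (n <= k)%N.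
  move=> G0 [j FE]; rewrite leqNgt; apply/negP => kn; apply: G0.
  move: (hF j); rewrite FE => /trapezoid_div_gridX; apply: trapezoid_eq0.
  by rewrite [X in (X == 0)%N](_ : _ = 0)%N //; nia.
(* The largest s with this property is chosen; the nonzero F_(j0) bounds it. *)
pose Pr s := forall j, exists G, F j = f ^+ (s - j) * G.
have [||s [Prs PrS]] := @last_success Pr (j0 + k.+1)%N.
- by move=> j; exists (F j); rewrite sub0n mul1r.
- move=> /(_ j0)[G]; rewrite addKn => FE.
  have /pow_le/(_ (ex_intro _ j0 FE)) : G <> 0 by move=> G0; apply: Fj0; rewrite FE G0 mulr0.
  by rewrite ltnn.
have /fin_all_exists[g gE] (n : 'I_s.+1) : exists G, F (s - n)%N = f ^+ n * G.
  by have [G ->] := Prs (s - n)%N; exists G; rewrite subKn // -ltnS.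
pose G n := g (inord n).
have FE n : (n <= s)%N -> F (s - n)%N = f ^+ n * G n.
  by move=> ns; have := gE (inord n); rewrite inordK.
pose Q n := forall n', (n <= n' <= s)%N -> exists H, G n' = f * H.
have [||t [Qt QtS]] := @last_success (fun t => Q (s.+1 - t)%N) s.+1.
- by move=> n'; lia.
- rewrite subnn => Q0; apply: PrS => j; have [js|sj] := leqP j s; last first.
    by exists (F j); rewrite (_ : s.+1 - j = 0)%N ?mul1r //; lia.
  have [H GE] := Q0 (s - j)%N ltac:(lia); exists H.
  by rewrite -[X in F X](subKn js) FE ?leq_subr // GE mulrA -exprSr subSn.
(* The largest index whose quotient G_(n1) is not divisible by the grid; it exists because otherwise
   s could be increased. *)
pose n1 := (s - t)%N.
have ts : (t <= s)%N.
  rewrite leqNgt; apply/negP => st; apply: QtS.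
  by have -> : (s.+1 - t.+1 = s.+1 - t)%N by lia.
have n1s : (n1 <= s)%N := leq_subr _ _.
have Gn1 : ~ exists H, G n1 = f * H.
  move=> GH; apply: QtS => n' hn'; have [<- //|n'n1] := eqVneq n1 n'.
  by apply: Qt; move: hn' n'n1; rewrite /n1; lia.
have Ggt n : (n1 < n <= s)%N -> exists H, G n = f * H.
  by move=> hn; apply: Qt; move: hn; rewrite /n1; lia.
have n1k : (n1 <= k)%N.
  apply: (pow_le n1 (G n1)); last by exists (s - n1)%N; apply: FE.
  by move=> Gn10; apply: Gn1; exists 0; rewrite Gn10 mulr0.
have hG n : (n <= s)%N -> (n <= k)%N -> trapezoid ((k - n) * m).+1 ((k - n) * d).+1 (G n).
  move=> ns nk; have := hF (s - n)%N; rewrite FE // => /trapezoid_div_gridX.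
  by rewrite !subSn ?leq_mul2r ?nk ?orbT // -!mulnBl.
have [Q0 BE Q00] : exists2 Q, roots_at K 0 l = 'X * Q & ~~ root Q 0.
  have [|Q0 BE Q00] := @roots_at_simple K 0 l 0%N; first by lia.
  by exists Q0; rewrite // BE polyC0 subr0.
pose C := roots_at K 0 m.
pose h : {poly {poly K}} := map_poly polyC Q0 * C%:P.
have fE : f = 'X * h by rewrite /f /grid BE rmorphM /= map_polyX mulrA.
(* Since f = y h, the coefficient of y^n in f^n G_n is h^n G_n restricted to y = 0. *)
have FcoefE n : (n <= s)%N ->
    (F (s - n)%N)`_n = (Q0.[0%:R] *: C) ^+ n * at_y 0%:R (G n).
  move=> ns; rewrite FE // fE exprMn -mulrA coefXnM ltnn subnn.
  by rewrite -horner_coef0 -polyC0 -/(at_y 0 _) at_yM at_yX at_yM at_y_map at_yC mul_polyC.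
have Ggt0 n : (n1 < n <= s)%N -> at_y 0%:R (G n) = 0.
  by move=> /Ggt[H ->]; rewrite at_yM (@at_y_grid K l m 0 l_gt0) mul0r.
have special' i : (i < k)%N ->
    ('X - m%:R%:P) ^+ (k - i) %| \sum_(n < n1.+1) (F (s - n)%N)`_n *+ 'C(n, i).
  move=> ik; have -> : \sum_(n < n1.+1) (F (s - n)%N)`_n *+ 'C(n, i)
      = \sum_(n < s.+1) (F (s - n)%N)`_n *+ 'C(n, i); last exact: special.
  rewrite (big_ord_widen s.+1 (fun n => (F (s - n)%N)`_n *+ 'C(n, i))) // big_mkcond /=.
  apply: eq_bigr => n _; case: ifP => // hn; have ns : (n <= s)%N by rewrite -ltnS.
  by rewrite FcoefE // Ggt0 ?mulr0 ?mul0rn // ns andbT ltnNge -ltnS hn.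
have rootC : ~~ root C m%:R by rewrite root_roots_at; lia.
have fixed_order n i j : (n <= s)%N -> fixed_point i j ->
    ((i < l)%N -> (m <= j)%N -> ('X - j%:R%:P) ^+ (k - n) %| at_y i%:R (G n)) /\
    ((l <= i)%N -> (j < m)%N -> ('X - i%:R%:P) ^+ (k - n) %| at_z j%:R (G n)).
  move=> ns ij; have mF := multF (s - n)%N i j ij; split=> ? ?.
    by apply: (grid_order_y mF (FE n ns)).
  by apply: (grid_order_z mF (FE n ns)).
have [n1_lt|n1_ge] := ltnP n1 k.
  apply: Gn1; apply: (grid_lines l_gt0 m_gt1 _ (hG _ n1s n1k)); first by lia.
    move=> i j il hj; have [ij|] := boolP ((i != 0) || (j != m))%N.
      by apply: (fixed_order n1 i j n1s _).1 => //; rewrite /fixed_point /grid_point; lia.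
    rewrite negb_or !negbK => /andP[/eqP -> /eqP ->].
    (* In the condition of index i = n1 the binomials remove n < n1, and the terms n > n1 vanish on
       y = 0. What is left is the missing order k - n1 of G_(n1) at (0, m). *)
    have := special' n1 n1_lt; rewrite big_ord_recr /= binn mulr1n big1 => [|n _]; last first.
      by rewrite bin_small.
    by rewrite add0r FcoefE //; apply: XsubC_dvd_cancel.
  move=> i j hi jm; apply: (fixed_order n1 i j n1s _).2 => //; last by lia.
  by rewrite /fixed_point /grid_point; lia.
have n1E : n1 = k by apply/eqP; rewrite eqn_leq n1k.
have ks : (k <= s)%N by rewrite -n1E.
have := hG k ks (leqnn k); rewrite subnn => /trapezoid11; set gam := _`_0 => GkE.
have gam0 : gam != 0.
  by apply/eqP => gam0; apply: Gn1; exists 0; rewrite n1E GkE gam0 mulr0.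
have k1s : (k.-1 <= s)%N by lia.
pose b := G k.-1.
have b_special : (at_y 0%:R b).[m%:R] = 0.
  apply: grid_special.
    by have := hG k.-1 k1s (leq_pred k); rewrite (_ : k - k.-1 = 1)%N ?mul1n //; lia.
  move=> i j ij; have [oy oz] := fixed_order k.-1 i j k1s ij.
  rewrite (_ : k - k.-1 = 1)%N ?expr1 in oy oz; last by lia.
  have /andP[/orP[/andP[il hj]|/andP[hi jm]] _] := ij.
    by apply/rootP; rewrite -dvdp_XsubCl; apply: oy => //; lia.
  by rewrite -at_z_at_y; apply/rootP; rewrite -dvdp_XsubCl; apply: oz => //; lia.
(* Only n = k - 1, with coefficient 1, and n = k, with coefficient k, contribute here. *)
have := special' k.-1 ltac:(lia); rewrite (_ : k - k.-1 = 1)%N ?expr1; last by lia.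
rewrite n1E -(prednK k0) big_ord_recr big_ord_recr /= big1 => [|n _]; last by rewrite bin_small.
rewrite add0r binn binSn mulr1n dvdp_XsubCl => /rootP/eqP.
rewrite prednK // !FcoefE // GkE at_yC hornerD hornerMn !hornerM b_special mulr0 add0r.
rewrite hornerC horner_exp hornerZ Num.Theory.mulrn_eq0 mulf_eq0 (negPf gam0) orbF.
rewrite expf_eq0 mulf_eq0 -!rootE (negPf Q00) (negPf rootC) andbF orbF.
by move=> /eqP kE; move: k0; rewrite kE.
Qed.

End GridDeformation.

(** * Unique factorization *)

Section Factorial.

Definition rdvd (R : comNzRingType) (p x : R) : Prop := exists q, x = q * p.

Definition prime_element (R : comUnitRingType) (p : R) : Prop :=
  [/\ p != 0, p \isn't a GRing.unit &
      forall a b, rdvd p (a * b) -> rdvd p a \/ rdvd p b].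

(** A unit times n primes. The count n drives the inductions that cancel primes one at a time. *)
Definition factors (R : comUnitRingType) (x : R) (n : nat) : Prop :=
  exists u s, [/\ u \is a GRing.unit, forall p, p \in s -> prime_element p,
                  size s = n & x = u * \prod_(p <- s) p].

Definition factorial_ring (R : comUnitRingType) : Prop :=
  forall x : R, x != 0 -> exists n, factors x n.

Lemma rdvdD (R : comNzRingType) (p x y : R) : rdvd p x -> rdvd p y -> rdvd p (x + y).
Proof. by case=> a -> [b ->]; exists (a + b); rewrite mulrDl. Qed.

Lemma rdvdN (R : comNzRingType) (p x : R) : rdvd p x -> rdvd p (- x).
Proof. by case=> a ->; exists (- a); rewrite mulNr. Qed.

Lemma rdvdMl (R : comNzRingType) (p x y : R) : rdvd p y -> rdvd p (x * y).
Proof. by case=> a ->; exists (x * a); rewrite mulrA. Qed.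

Lemma rdvdMr (R : comNzRingType) (p x y : R) : rdvd p x -> rdvd p (x * y).
Proof. by rewrite mulrC; apply: rdvdMl. Qed.

Lemma rdvd_sum (R : comNzRingType) (p : R) (I : Type) (r : seq I) (P : pred I) F :
  (forall i, P i -> rdvd p (F i)) -> rdvd p (\sum_(i <- r | P i) F i).
Proof.
by move=> pF; apply: big_ind => //; [exists 0; rewrite mul0r | apply: rdvdD].
Qed.

Lemma factors_unit (R : comUnitRingType) (u : R) : u \is a GRing.unit -> factors u 0.
Proof. by move=> uu; exists u, [::]; rewrite big_nil mulr1. Qed.

Lemma factors_prime (R : comUnitRingType) (p : R) : prime_element p -> factors p 1.
Proof.
move=> pp; exists 1, [:: p]; split; rewrite ?unitr1 ?big_seq1 ?mul1r // => q.
by rewrite inE => /eqP ->.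
Qed.

Lemma factorsM (R : comUnitRingType) (x y : R) a b :
  factors x a -> factors y b -> factors (x * y) (a + b).
Proof.
case=> u [s [uu ps <- ->]] [v [t [uv pt <- ->]]]; exists (u * v), (s ++ t); split.
- by rewrite unitrM uu.
- by move=> p; rewrite mem_cat => /orP[/ps|/pt].
- by rewrite size_cat.
by rewrite big_cat mulrACA.
Qed.

Lemma prime_not_rdvd_unit (R : comUnitRingType) (p u : R) :
  prime_element p -> u \is a GRing.unit -> ~ rdvd p u.
Proof. by case=> _ /negP np _ uu [q uE]; apply: np; move: uu; rewrite uE unitrM => /andP[]. Qed.

Lemma prime_rdvd_prime (R : idomainType) (p q : R) : prime_element p -> prime_element q ->
  rdvd p q -> exists2 u, u \is a GRing.unit & q = u * p.
Proof.
move=> [p0 /negP np pp] [q0 nq pq] [c qE]; exists c => //.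
have /pq[] : rdvd q (c * p) by exists 1; rewrite mul1r.
  case=> c' cE; case: np; have /(mulIf q0) E : 1 * q = c' * p * q.
    by rewrite mul1r {1}qE cE mulrAC.
  by apply/unitrP; exists c'; rewrite [p * _]mulrC -E.
case=> e pE; have /(mulIf q0) E : 1 * q = c * e * q by rewrite mul1r {1}qE {1}pE mulrA.
by apply/unitrP; exists e; rewrite [e * _]mulrC -E.
Qed.

Lemma factors_div_prime (R : idomainType) (p x : R) n :
  prime_element p -> factors (p * x) n -> exists2 m, n = m.+1 & factors x m.
Proof.
move=> pp [u [s [uu]]]; have [p0 _ primep] := pp.
elim: s n u uu x => [|q s IH] n u uu x qs.
  rewrite big_nil mulr1 => _ pxu; case: (prime_not_rdvd_unit pp uu).
  by exists x; rewrite -pxu mulrC.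
have pq : prime_element q by apply: qs; rewrite mem_head.
have ps r : r \in s -> prime_element r by move=> rs; apply: qs; rewrite in_cons rs orbT.
rewrite big_cons => nE pxE; have [||[y yE]] := primep q (u * \prod_(r <- s) r).
- by exists x; rewrite [RHS]mulrC pxE; ring.
- case/(prime_rdvd_prime pp pq) => v uv qE; exists (size s); first by rewrite -nE.
  exists (u * v), s; split=> //; first by rewrite unitrM uu.
  by apply: (mulfI p0); rewrite pxE qE; ring.
have [|m' mE [v [t [uv pt tm yt]]]] := IH _ u uu y ps erefl; first by rewrite yE mulrC.
exists m'.+1; first by rewrite -nE /= mE.
exists v, (q :: t); split=> //=; last 1 first.
  by apply: (mulfI p0); rewrite pxE big_cons mulrCA yE yt; ring.
- by move=> r; rewrite in_cons => /orP[/eqP ->|/pt].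
- by rewrite tm.
Qed.

Lemma rdvd_polyC (R : comNzRingType) (p : R) (a : {poly R}) :
  rdvd p%:P a <-> forall i, rdvd p a`_i.
Proof.
split=> [[q ->] i|pa]; first by rewrite coefMC; exists q`_i.
have /fin_all_exists[q qE] (i : 'I_(size a)) : exists q, a`_i = q * p := pa i.
exists (\poly_(i < size a) if insub i is Some i' then q i' else 0).
apply/polyP => i; rewrite coefMC coef_poly; case: ltnP => ia; last first.
  by rewrite nth_default // mul0r.
by rewrite insubT -qE.
Qed.

(** If p divides neither factor, the first coefficients not divisible by p, of indices i and j,
    contribute to the coefficient of index i + j of the product its only term not divisible by p. *)
Lemma prime_polyC (R : idomainType) (p : R) : prime_element p -> prime_element p%:P.
Proof.
case=> p0 np pp; split; first by rewrite polyC_eq0.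
  apply: contra np => /unitrP[q [qp _]]; apply/unitrP; exists q`_0.
  have := congr1 (coefp 0) qp; rewrite /= coefMC coefC eqxx => E.
  by rewrite [p * _]mulrC E.
move=> a b /rdvd_polyC pab.
have minimal (c : {poly R}) : ~ rdvd p%:P c ->
    exists i, (forall j, (j < i)%N -> rdvd p c`_j) /\ ~ rdvd p c`_i.
  move=> npc; have [||i [Pi PSi]] :=
    @last_success (fun i => forall j, (j < i)%N -> rdvd p c`_j) (size c) => //.
    move=> Pc; apply: npc; apply/rdvd_polyC => j; have [/Pc //|cj] := ltnP j (size c).
    by rewrite nth_default //; exists 0; rewrite mul0r.
  exists i; split=> // pci; apply: PSi => j; rewrite ltnS leq_eqVlt.
  by case/orP=> [/eqP -> //|/Pi].
apply: NNPP => /not_or_and[/minimal[i [ai nai]] /minimal[j [bj nbj]]].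
suff /pp[] : rdvd p (a`_i * b`_j) by [].
have := pab (i + j)%N; rewrite coefM (bigD1 (inord i)) //= inordK ?ltnS ?leq_addr // addKn.
move=> pS; rewrite -[_ * _](addrK (\sum_(k < (i + j).+1 | k != inord i) a`_k * b`_(i + j - k))).
apply: rdvdD => //; apply/rdvdN/rdvd_sum => k ki.
have {}ki : (k : nat) != i.
  by apply: contraNneq ki => kE; apply/eqP/val_inj; rewrite /= inordK ?ltnS ?leq_addr.
have [lt_ki|le_ik] := ltnP k i; first by apply: rdvdMr; apply: ai.
by apply: rdvdMl; apply: bj; have := ltn_ord k; lia.
Qed.

Lemma factors_polyC (R : idomainType) (x : R) n : factors x n -> factors x%:P n.
Proof.
case=> u [s [uu ps <- ->]]; exists u%:P, [seq p%:P | p <- s]; split.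
- exact: rmorph_unit.
- by move=> p /mapP[q /ps/prime_polyC pq ->].
- by rewrite size_map.
by rewrite rmorphM rmorph_prod big_map.
Qed.

Section Gauss.

Variable R : idomainType.
Implicit Types (f g h : {poly R}).

Definition primitive f : Prop := forall p : R, prime_element p -> ~ rdvd p%:P f.

Lemma gauss_cancel c n f b : factors c n -> primitive f -> rdvd f (c%:P * b) -> rdvd f b.
Proof.
move=> cn pf; elim: n c cn b => [|n IH] c [u [s [uu ps sn cE]]] b.
  move: cE; rewrite (size0nil sn) big_nil mulr1 => ->.
  case=> q qE; exists ((u^-1)%:P * q); rewrite -mulrA -qE mulrA -polyCM mulVr //.
  by rewrite mul1r.
case: s ps sn cE => [|p s] //= ps [sn] cE [q qE].
have pp : prime_element p by apply: ps; rewrite mem_head.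
have [p0 _ primep] := prime_polyC pp.
have : rdvd p%:P (q * f).
  rewrite -qE cE big_cons; exists ((u * \prod_(r <- s) r)%:P * b).
  rewrite !polyCM; ring.
case/primep=> [[q1 q1E]|/pf]; last by move/(_ pp).
apply: (IH (u * \prod_(r <- s) r)).
  by exists u, s; split=> // r rs; apply: ps; rewrite in_cons rs orbT.
exists q1; apply: (mulfI p0); have -> : p%:P * (q1 * f) = q * f by rewrite q1E; ring.
by rewrite -qE cE big_cons !polyCM; ring.
Qed.

(** Each prime of c stays prime as a constant polynomial, so it divides g or h and can be cancelled
    there without a change of degree. *)
Lemma gauss_factor c n f g h : factors c n -> c%:P * f = g * h ->
  exists g' h', [/\ f = g' * h', size g' = size g & size h' = size h].
Proof.
elim: n c g h => [|n IH] c g h [u [s [uu ps sn cE]]] cf.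
  exists ((u^-1)%:P * g), h; split=> //.
    rewrite -mulrA -cf cE (size0nil sn) big_nil mulr1 mulrA -polyCM mulVr // mul1r //.
  by rewrite mul_polyC size_scale // invr_eq0; apply: contraTneq uu => ->; rewrite unitr0.
case: s ps sn cE => [|p s] //= ps [sn] cE.
have pp : prime_element p by apply: ps; rewrite mem_head.
have [p0 _ primep] := prime_polyC pp; have p0' : p != 0 by rewrite -polyC_eq0.
have size_mulp (q : {poly R}) : size (q * p%:P) = size q.
  by rewrite mulrC mul_polyC size_scale.
have c'n : factors (u * \prod_(r <- s) r) n.
  by exists u, s; split=> // r rs; apply: ps; rewrite in_cons rs orbT.
have : rdvd p%:P (g * h).
  rewrite -cf cE big_cons; exists ((u * \prod_(r <- s) r)%:P * f).
  by rewrite !polyCM; ring.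
case/primep=> [[g1 g1E]|[h1 h1E]].
  have [|g' [h' [fE sg sh]]] := IH _ g1 h c'n.
    apply: (mulfI p0); have -> : p%:P * (g1 * h) = g * h by rewrite g1E; ring.
    by rewrite -cf cE big_cons !polyCM; ring.
  by exists g', h'; rewrite sg g1E size_mulp.
have [|g' [h' [fE sg sh]]] := IH _ g h1 c'n.
  apply: (mulfI p0); have -> : p%:P * (g * h1) = g * h by rewrite h1E; ring.
  by rewrite -cf cE big_cons !polyCM; ring.
by exists g', h'; rewrite sh h1E size_mulp.
Qed.

Hypothesis ufdR : factorial_ring R.

(** If f divides a b, the greatest common divisor of f and a, computed by pseudo-division, becomes
    by [gauss_factor] a factor of f of the same degree. So it is f up to constants, and f divides a,
    or it is constant, and f divides b. Primitivity clears the constants. *)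
Lemma prime_of_indecomposable f : (1 < size f)%N -> primitive f ->
  (forall g h, f = g * h -> (size g <= 1)%N \/ (size h <= 1)%N) -> prime_element f.
Proof.
move=> sf pf indec; have f0 : f != 0 by rewrite -size_poly_gt0 ltnW.
have pseudo (a : {poly R}) : f %| a -> rdvd f a.
  case/Pdiv.Idomain.dvdpP=> -[c q] /= c0 cq; have [n cn] := ufdR c0.
  by apply: (gauss_cancel cn pf); rewrite mul_polyC cq; exists q.
split=> //.
  apply: contraL sf => uf; rewrite -leqNgt; by move: uf; rewrite poly_unitE => /andP[/eqP ->].
move=> a b [q qE]; pose g := gcdp f a.
have g0 : g != 0 by rewrite gcdp_eq0 negb_and f0.
have : g %| f by rewrite dvdp_gcdl.
case/Pdiv.Idomain.dvdpP=> -[c e] /= c0; rewrite -mul_polyC => ce.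
have [n cn] := ufdR c0; have [g' [h' [fE sg sh]]] := gauss_factor cn ce.
have [sg'|sh'] := indec _ _ fE.
  left; apply: pseudo; apply: dvdp_trans (dvdp_gcdr f a).
  have g'0 : g' != 0 by apply: contraNneq f0 => g'0; rewrite fE g'0 mul0r.
  have h'0 : h' != 0 by apply: contraNneq f0 => h'0; rewrite fE h'0 mulr0.
  have fg : size g = size f.
    by rewrite fE size_mul // sh; move: sg' g'0; rewrite -size_poly_gt0; lia.
  have := dvdp_size_eqp (dvdp_gcdl f a); rewrite -/g fg eqxx => /esym gf.
  by rewrite (eqp_dvdr _ gf) dvdpp.
right; apply: pseudo; rewrite -(@Gauss_dvdpr _ _ a) ?qE ?dvdp_mull //.
by rewrite /coprimep -/g eqn_leq -sh sh' sh size_poly_gt0 g0.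
Qed.

Lemma factorial_poly : factorial_ring {poly R}.
Proof.
move=> f f0; have [n le_n] : exists n, (size f <= n)%N by exists (size f).
elim: n f f0 le_n => [|n IH] f f0 sf.
  by move: f0; rewrite -size_poly_gt0 ltnNge sf.
have [|d] := ufdR (_ : lead_coef f != 0); first by rewrite lead_coef_eq0.
(* Splitting off a constant prime keeps the size, so within each size the induction is on the number
   of primes in the leading coefficient. *)
elim/ltn_ind: d f f0 sf => d IHd f f0 sf dl.
have [[p [pp [f1 fE]]]|npf] := classic (exists p : R, prime_element p /\ rdvd p%:P f).
  have f10 : f1 != 0 by apply: contraNneq f0 => f10; rewrite fE f10 mul0r.
  have [p0 _ _] := pp.
  have [|e dE el] := @factors_div_prime _ p (lead_coef f1) d pp.
    by rewrite mulrC -(lead_coefC p) -lead_coefM -fE.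
  have ed : (e < d)%N by rewrite dE.
  have sf1 : (size f1 <= n.+1)%N by move: sf; rewrite fE mulrC mul_polyC size_scale.
  have [r fr] := IHd e ed f1 f10 sf1 el.
  by exists (r + 1)%N; rewrite fE; apply/factorsM/factors_polyC/factors_prime.
have [f1|sf1] := leqP (size f) 1.
  have := f0; rewrite (size1_polyC f1) polyC_eq0 => /ufdR[r fr].
  by exists r; apply: factors_polyC.
have [[g [h [fE sg sh]]]|indec] := classic (exists g h, [/\ f = g * h, (1 < size g)%N & (1 < size h)%N]).
  have g0 : g != 0 by rewrite -size_poly_gt0 ltnW.
  have h0 : h != 0 by rewrite -size_poly_gt0 ltnW.
  move: sf; rewrite fE size_mul // => sf.
  have [|a ga] := IH g g0; first by lia.
  have [|b hb] := IH h h0; first by lia.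
  by exists (a + b)%N; apply: factorsM.
exists 1%N; apply/factors_prime/prime_of_indecomposable => // [p pp pf|g h fE].
  by apply: npf; exists p.
have [sg|sg] := leqP (size g) 1; first by left.
have [sh|sh] := leqP (size h) 1; first by right.
by case: indec; exists g, h.
Qed.

End Gauss.

Lemma factorial_transport (R S : comUnitRingType) (phi : {rmorphism R -> S})
    (psi : {rmorphism S -> R}) : cancel phi psi -> cancel psi phi ->
  factorial_ring S -> factorial_ring R.
Proof.
move=> phiK psiK ufdS x x0.
have unit_psi u : u \is a GRing.unit -> psi u \is a GRing.unit by exact: rmorph_unit.
have [|n [u [s [uu ps sn xE]]]] := ufdS (phi x).
  by apply: contraNneq x0 => xE; rewrite -(phiK x) xE rmorph0.
exists n, (psi u), [seq psi p | p <- s]; split.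
- exact: unit_psi.
- move=> p /mapP[q /ps[q0 nq pq] ->]; split.
  + by apply: contraNneq q0 => qE; rewrite -(psiK q) qE rmorph0.
  + by apply: contra nq => /(rmorph_unit phi); rewrite psiK.
  move=> a b [c cE]; have [|[e eE]|[e eE]] := pq (phi a) (phi b).
  + by exists (phi c); rewrite -rmorphM cE rmorphM psiK.
  + by left; exists (psi e); rewrite -rmorphM -eE phiK.
  by right; exists (psi e); rewrite -rmorphM -eE phiK.
- by rewrite size_map.
by rewrite big_map -rmorph_prod -rmorphM -xE phiK.
Qed.

Lemma irreducible_prime (R : comUnitRingType) (g : R) : factorial_ring R ->
  g != 0 -> g \isn't a GRing.unit ->
  (forall a b, g = a * b -> a \is a GRing.unit \/ b \is a GRing.unit) -> prime_element g.
Proof.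
move=> ufdR g0 ng irr; have [n [u [s [uu ps sn gE]]]] := ufdR g g0.
case: s ps sn gE => [|p s] ps _ gE.
  by case/negP: ng; rewrite gE big_nil mulr1.
have pp : prime_element p by apply: ps; rewrite mem_head.
rewrite big_cons mulrCA in gE; have [p0 np primep] := pp.
have [/(negP np) //|uv] := irr _ _ gE; set v := (X in p * X) in gE uv.
split=> // a b [c cE]; have [|[e eE]|[e eE]] := primep a b.
- by exists (c * v); rewrite cE gE; ring.
- by left; exists (e * v^-1); rewrite eE gE [p * v]mulrC mulrA divrK.
by right; exists (e * v^-1); rewrite eE gE [p * v]mulrC mulrA divrK.
Qed.

End Factorial.

Section MpolyFactorial.

Lemma mmap_id n (R : comNzRingType) (g : {mpoly R[n]}) :
  mmap (@mpolyC n R) (fun i => 'X_i) g = g.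
Proof.
rewrite [RHS]mpolyE; apply: eq_bigr => m _.
by rewrite mul_mpolyC /mmap1 -mpolyXE_id.
Qed.

Lemma muniX n (R : comNzRingType) (i : 'I_n.+1) :
  muni ('X_i : {mpoly R[n.+1]}) =
    match split (cast_ord (esym (addn1 n)) i) with inl j => ('X_j)%:P | inr _ => 'X end.
Proof. by rewrite /muni mmapX mmap1U. Qed.

(** [muni] identifies polynomials in n + 1 variables with polynomials in the last variable over
    those in n; [psi] is its inverse. *)
Lemma factorial_mpoly (K : fieldType) n : factorial_ring {mpoly K[n]}.
Proof.
elim: n => [|n IH].
  move=> x x0; exists 0%N; apply: factors_unit.
  move: x0; rewrite (nvar0_mpolyC x) mpolyC_eq0 => c0.
  by apply: rmorph_unit; rewrite unitfE.
pose psi : {rmorphism {poly {mpoly K[n]}} -> {mpoly K[n.+1]}} :=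
  horner_eval ('X_ord_max : {mpoly K[n.+1]}) \o map_poly (@mwiden n K).
have psiC c : psi c%:P = mwiden c by rewrite /psi /= map_polyC /horner_eval hornerC.
have psiX : psi 'X = 'X_ord_max by rewrite /psi /= map_polyX /horner_eval hornerX.
have muniW (c : {mpoly K[n]}) : muni (mwiden c) = c%:P.
  rewrite /mwiden (rmorph_mmap (@muni n K)) -[in RHS](mmap_id c) (rmorph_mmap polyC); apply: eq_mmap => [a|i] /=.
    by rewrite muniC.
  rewrite muniX; case: splitP => [j ij|j]; last by rewrite ord1 /= addn0 => ni; have := ltn_ord i; lia.
  by congr (('X_ _)%:P); apply: val_inj.
have psi_muniX (i : 'I_n.+1) : psi (muni 'X_i) = 'X_i.
  rewrite muniX; case: splitP => [j ij|j ij].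
    by rewrite psiC mwidenX mnmwiden1; congr ('X_ _); apply: val_inj; rewrite /= -ij.
  by rewrite psiX; congr ('X_ _); apply: val_inj; move: ij => /= ->; rewrite ord1 addn0.
have muni_max : muni ('X_ord_max : {mpoly K[n.+1]}) = 'X.
  by rewrite muniX; case: splitP => [j /= jn|//]; have := ltn_ord j; rewrite -jn ltnn.
have psiK (q : {poly {mpoly K[n]}}) : muni (psi q) = q.
  elim/poly_ind: q => [|q c IHq]; first by rewrite (rmorph0 psi) muni0.
  by rewrite (rmorphD psi) (rmorphM psi) psiC psiX muniD muniM IHq muniW muni_max.
have muniK (g : {mpoly K[n.+1]}) : psi (muni g) = g.
  rewrite /muni (rmorph_mmap psi) -[RHS]mmap_id; apply: eq_mmap => [a|i].
    by rewrite -[LHS]/(psi a%:MP%:P) psiC mwidenC.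
  by rewrite -[RHS]psi_muniX muniX.
exact: factorial_transport muniK psiK (factorial_poly IH).
Qed.

End MpolyFactorial.

(** * Affine coordinates and the grid points *)

Section Filtrations.

Lemma dvdp_filtration (K : fieldType) (u : {poly K}) :
  filtration (fun n x => u ^+ n %| x).
Proof.
split=> [x|n|n x y|a b x y|a b x ab].
- exact: dvd1p.
- exact: dvdp0.
- exact: dvdp_add.
- by rewrite exprD; apply: dvdp_mul.
by apply: dvdp_trans; apply: dvdp_exp2l.
Qed.

Definition coef_filtration (S : nzRingType) (I : nat -> S -> Prop) (n : nat)
  (x : {poly S}) : Prop := forall e, I n x`_e.

(** The extension of [I] to polynomials in which the new variable has weight 1. *)
Definition weighted_filtration (S : nzRingType) (I : nat -> S -> Prop) (n : nat)
  (x : {poly S}) : Prop := forall e, I (n - e)%N x`_e.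

Lemma coef_filtrationP (S : comNzRingType) (I : nat -> S -> Prop) :
  filtration I -> filtration (coef_filtration I).
Proof.
move=> filI; have [I0 In0 ID IM Ile] := filI.
split=> [x e|n e|n x y hx hy e|a b x y hx hy e|a b x ab hx e].
- exact: I0.
- by rewrite coef0.
- by rewrite coefD; apply: ID.
- by rewrite coefM; apply: filtration_sum => // i _; apply: IM.
exact: Ile (hx e).
Qed.

Lemma weighted_filtrationP (S : comNzRingType) (I : nat -> S -> Prop) :
  filtration I -> filtration (weighted_filtration I).
Proof.
move=> filI; have [I0 In0 ID IM Ile] := filI.
split=> [x e|n e|n x y hx hy e|a b x y hx hy e|a b x ab hx e].
- by rewrite sub0n; apply: I0.
- by rewrite coef0.
- by rewrite coefD; apply: ID.
- rewrite coefM; apply: filtration_sum => // i _; apply: Ile (IM _ _ _ _ (hx i) (hy (e - i)%N)).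
  by have := ltn_ord i; lia.
by apply: Ile (hx e); apply: leq_sub2r.
Qed.

End Filtrations.

Section Dehomogenization.

Variable K : numFieldType.
Implicit Types (f : {mpoly K[3]}).

Definition coords (R : Type) (x y z : R) (j : 'I_3) : R := nth x [:: x; y; z] j.

Lemma ord3P (P : 'I_3 -> Prop) : P (inord 0) -> P (inord 1) -> P (inord 2) -> forall j, P j.
Proof.
by move=> P0 P1 P2 j; rewrite -[j]inord_val; case: j => -[|[|[|]]].
Qed.

Lemma eq_coords (R : Type) (g : 'I_3 -> R) x y z :
  g (inord 0) = x -> g (inord 1) = y -> g (inord 2) = z -> g =1 coords x y z.
Proof. by move=> g0 g1 g2; apply: ord3P; rewrite /coords inordK. Qed.

Lemma prod_ord3 (R : comNzRingType) (g : 'I_3 -> R) :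
  \prod_j g j = g (inord 0) * g (inord 1) * g (inord 2).
Proof.
rewrite !big_ord_recl big_ord0 mulr1 mulrA; congr (g _ * g _ * g _);
  by apply: val_inj; rewrite /= inordK.
Qed.

Lemma sum_ord3 (g : 'I_3 -> nat) :
  (\sum_j g j = g (inord 0) + g (inord 1) + g (inord 2))%N.
Proof.
rewrite !big_ord_recl big_ord0 addn0 addnA; congr (g _ + g _ + g _)%N;
  by apply: val_inj; rewrite /= inordK.
Qed.

(* The affine chart x = 1, with y as the outer and z as the inner variable.   *)
Definition affine f : {poly {poly K}} :=
  mmap (polyC \o polyC) (coords 1 'X ('X)%:P) f.

Lemma coef_affine f i j : (affine f)`_i`_j =
  \sum_(b <- msupp f) f@_b * ((b (inord 1) == i) && (b (inord 2) == j))%:R.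
Proof.
rewrite /affine /mmap !coef_sum; apply: eq_bigr => b _.
rewrite /= !coefCM /mmap1 prod_ord3 /coords !inordK //= expr1n mul1r.
rewrite -rmorphXn coefMC coefXn; congr (_ * _).
case: (i =P b (inord 1)) => [->|/eqP ne]; rewrite ?mul1r ?mul0r ?coef0 ?eqxx.
  by rewrite coefXn eq_sym.
by rewrite eq_sym (negPf ne).
Qed.

Lemma affine_trapezoid D e f : f \is D.-homog ->
  (forall b, b \in msupp f -> (b (inord 2) <= e)%N) -> trapezoid e.+1 D.+1 (affine f).
Proof.
move=> fD fe i j hij; rewrite coef_affine big_seq big1 // => b bf.
have := fe b bf; have := dhomog_mf fD bf; rewrite /= mdegE sum_ord3 => bD be.
case: eqP => [bi|_]; case: eqP => [bj|_] /=; rewrite ?mulr0 //.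
by move: hij; lia.
Qed.

Lemma homog_mnm_eq D f (b c : 'X_{1..3}) : f \is D.-homog -> b \in msupp f -> mdeg c = D ->
  b (inord 1) = c (inord 1) -> b (inord 2) = c (inord 2) -> b = c.
Proof.
move=> fD bf cD b1 b2; apply/mnmP; apply: ord3P => //.
by have := dhomog_mf fD bf; rewrite -cD !mdegE !sum_ord3 /= mdegE sum_ord3; lia.
Qed.

Lemma coef_affine_homog D f c : f \is D.-homog -> mdeg c = D ->
  (affine f)`_(c (inord 1))`_(c (inord 2)) = f@_c.
Proof.
move=> fD cD; rewrite coef_affine; have [cf|cf] := boolP (c \in msupp f); last first.
  rewrite (memN_msupp_eq0 cf) big_seq big1 // => b bf.
  case: eqP => [b1|]; case: eqP => [b2|]; rewrite ?mulr0 //=.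
  by case/negP: cf; rewrite -(homog_mnm_eq fD bf cD b1 b2).
rewrite (bigD1_seq c) ?msupp_uniq //= !eqxx mulr1 big_seq_cond big1 ?addr0 //.
move=> b /andP[bf bc]; case: eqP => [b1|]; case: eqP => [b2|]; rewrite ?mulr0 //=.
by case/eqP: bc; apply: homog_mnm_eq fD bf cD b1 b2.
Qed.

Lemma affine_inj D f : f \is D.-homog -> affine f = 0 -> f = 0.
Proof.
move=> fD f0; apply/mpolyP => c; rewrite mcoeff0.
have [cD|cD] := eqVneq (mdeg c) D; last by rewrite (dhomog_nemf_coeff fD).
by rewrite -(coef_affine_homog fD cD) f0 !coef0.
Qed.

(** After y is replaced by y + a, multiplicity k says that the coefficient of y^n is divisible by (z
    - b)^(k - n). If F = (y - a)^n G, this coefficient is G(a, z). The second half exchanges y and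
    z. *)
Lemma affine_mult_shift k f (a b : K) :
  low k (shift (coords 1 a b) f) -> affine_mult k (affine f) a b.
Proof.
move=> flow; split=> n G FE.
  have /(_ n) : weighted_filtration (fun n x => ('X - b%:P) ^+ n %| x) k
      (affine f \Po ('X + a%:P%:P)).
    rewrite /affine (rmorph_mmap (comp_poly ('X + a%:P%:P))) (mmap_shiftK _ _ (coords 1 a b)).
    apply: low_mmap flow; first exact/weighted_filtrationP/dvdp_filtration.
    apply: ord3P => e; rewrite /= /coords !inordK //=.
    - by rewrite !polyC1 subrr coef0 dvdp0.
    - rewrite comp_polyX comp_polyC addrK coefX.
      by case: e => [|[|e]]; rewrite ?dvdp0 // subnn expr0 dvd1p.
    rewrite !comp_polyC -rmorphB coefC.
    by case: e => [|e]; rewrite ?subn0 ?expr1 ?dvdpp ?dvdp0.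
  rewrite FE rmorphM rmorphXn /= rmorphB /= comp_polyX comp_polyC addrK coefXnM ltnn subnn.
  by rewrite -horner_coef0 horner_comp !hornerE.
have /(_ n) : weighted_filtration (fun n x => ('X - a%:P) ^+ n %| x) k
    (swapXY (affine f) \Po ('X + b%:P%:P)).
  pose phi : {rmorphism {poly {poly K}} -> {poly {poly K}}} :=
    comp_poly ('X + b%:P%:P) \o @swapXY K.
  rewrite -[_ \Po _]/(phi (affine f)) /affine (rmorph_mmap phi) (mmap_shiftK _ _ (coords 1 a b)).
  apply: low_mmap flow; first exact/weighted_filtrationP/dvdp_filtration.
  have phiC c : phi c%:P%:P = c%:P%:P by rewrite /phi /= swapXY_polyC map_polyC /= comp_polyC.
  apply: ord3P => e; rewrite /= /coords !inordK //=; rewrite ?phiC.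
  - by rewrite !polyC1 subrr coef0 dvdp0.
  - rewrite swapXY_X comp_polyC swapXY_polyC map_polyC /= comp_polyC -rmorphB coefC.
    by case: e => [|e]; rewrite ?subn0 ?expr1 ?dvdpp ?dvdp0.
  rewrite !swapXY_polyC !map_polyC /= map_polyX comp_polyX comp_polyC addrK coefX.
  by case: e => [|[|e]]; rewrite ?dvdp0 // subnn expr0 dvd1p.
rewrite FE !rmorphM !rmorphXn /= swapXY_polyC rmorphB /= map_polyX map_polyC /=.
rewrite rmorphB /= comp_polyX comp_polyC addrK coefXnM ltnn subnn.
by rewrite -horner_coef0 horner_comp !hornerE /at_z -horner_swapXY.
Qed.

(** At the last coordinate vertex the Taylor coefficient indexed by b with its last exponent erased
    is the coefficient f_b itself. *)
Lemma mult_last_exponent n (R : comNzRingType) D mu (f : {mpoly R[n.+1]}) b :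
  f \is D.-homog -> low mu (shift (fun j => (j == ord_max)%:R) f) ->
  b \in msupp f -> (b ord_max + mu <= D)%N.
Proof.
move=> fD flow bf; have bD := dhomog_mf fD bf; rewrite leqNgt; apply/negP => Dmu.
pose a : 'X_{1..n.+1} := [multinom if j == ord_max then 0%N else b j | j < n.+1].
have degE (c : 'X_{1..n.+1}) : mdeg c = (\sum_(j | j != ord_max) c j + c ord_max)%N.
  by rewrite mdegE (bigD1 ord_max) //= addnC.
have adeg : (mdeg a + b ord_max = D)%N.
  have <- : mdeg b = D := bD; rewrite !degE mnmE eqxx addn0; congr (_ + _)%N.
  by apply: eq_bigr => j /negPf jm; rewrite mnmE jm.
have := flow a ltac:(lia); rewrite (mcoeff_shift _ _ fD).
have ltb : (mdeg b < D.+1)%N by rewrite ltnS -bD.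
rewrite (bigD1 (BMultinom ltb)) //= big1 => [|c cb].
  rewrite addr0 /taylor_coef big1 ?mulr1 => [|j _].
    by apply/eqP; rewrite -mcoeff_msupp.
  rewrite mnmE; case: eqP => [->|_]; first by rewrite expr1n bin0.
  by rewrite subnn expr0 binn.
have [cD|cD] := eqVneq (mdeg c) D; last by rewrite (dhomog_nemf_coeff fD cD) mul0r.
have [j jm cj] : exists2 j : 'I_n.+1, j != ord_max & c j != b j.
  apply/exists_inP; apply: contraNT cb; rewrite negb_exists_in => /forall_inP cb.
  have {}cb j : j != ord_max -> c j = b j by move/cb; rewrite negbK => /eqP.
  apply/eqP/val_inj/mnmP => j; have [->|/cb //] := eqVneq j ord_max.
  have : mdeg c = mdeg b by rewrite cD -bD.
  rewrite !degE; have -> : (\sum_(j' | j' != ord_max) c j' = \sum_(j' | j' != ord_max) b j')%N.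
    by apply: eq_bigr => j' /cb.
  exact: addnI.
rewrite /taylor_coef (bigD1 j) //= mnmE (negPf jm).
have [cb'|bc|bc] := ltngtP (c j) (b j).
- by rewrite bin_small // mulr0n mul0r mulr0.
- by rewrite -(subnSK bc) exprS !mul0r mul0rn mul0r mulr0.
by rewrite bc eqxx in cj.
Qed.

End Dehomogenization.

Lemma coef_X1_exp (R : nzRingType) n i : (('X + 1 : {poly R}) ^+ n)`_i = 'C(n, i)%:R.
Proof.
rewrite exprD1n coef_sum; under eq_bigr => j _ do rewrite coefMn coefXn.
have [i_n|n_i] := ltnP i n.+1.
  rewrite (bigD1 (Ordinal i_n)) //= eqxx big1 ?addr0 // => j.
  by rewrite -val_eqE /= eq_sym => /negPf ->; rewrite mul0rn.
rewrite bin_small // big1 // => j _; case: eqP => [ij|_]; last by rewrite mul0rn.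
by have := ltn_ord j; rewrite -ij ltnNge n_i.
Qed.

(** * Forms with coefficients in K[t] *)

Section Slices.

Variables (K : numFieldType) (D : nat) (F : {mpoly {poly K}[3]}).
Hypothesis FD : F \is D.-homog.

Definition slice (j : nat) : {mpoly K[3]} :=
  \sum_(b : 'X_{1..3 < D.+1}) (F@_b)`_j *: 'X_[val b].

Lemma mcoeff_slice j b : (slice j)@_b = (F@_b)`_j.
Proof.
rewrite /slice (raddf_sum (mcoeff b)) /=; have [ltb|bD] := boolP (mdeg b < D.+1)%N.
  rewrite (bigD1 (BMultinom ltb)) //= mcoeffZ mcoeffX eqxx mulr1 big1 ?addr0 // => c cb.
  by rewrite mcoeffZ mcoeffX -[_ == b]/(c == BMultinom ltb) (negPf cb) mulr0.
rewrite (dhomog_nemf_coeff FD) ?coef0; last by apply: contraNneq bD => ->; rewrite ltnS.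
rewrite big1 // => c _; rewrite mcoeffZ mcoeffX; case: eqP => [cb|]; last by rewrite mulr0.
by have := bmdeg c; rewrite cb (negPf bD).
Qed.

Lemma slice_homog j : slice j \is D.-homog.
Proof.
apply/dhomogP => b; rewrite mcoeff_msupp mcoeff_slice => Fb; apply/eqP.
by apply: contraNT Fb => bD; rewrite (dhomog_nemf_coeff FD bD) coef0.
Qed.

Lemma slice_eq0 : (forall j, slice j = 0) -> F = 0.
Proof.
by move=> F0; apply/mpolyP => b; apply/polyP => j; rewrite mcoeff0 coef0 -mcoeff_slice F0 mcoeff0.
Qed.

Lemma low_slice mu (p : 'I_3 -> K) j :
  low mu (shift (polyC \o p) F) -> low mu (shift p (slice j)).
Proof.
move=> Flow a amu; rewrite (mcoeff_shift _ _ (slice_homog j)).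
have := congr1 (coefp j) (Flow a amu); rewrite (mcoeff_shift _ _ FD) /= coef0 coef_sum => E.
rewrite -[RHS]E; apply: eq_bigr => b _.
by rewrite -rmorph_taylor_coef coefMC mcoeff_slice.
Qed.

(* A base point moving along z = c as (t, c). *)
Lemma moving_point k (c : K) : low k (shift (coords 1 'X c%:P) F) -> forall s i, (i < k)%N ->
  ('X - c%:P) ^+ (k - i) %| \sum_(n < s.+1) (affine (slice (s - n)%N))`_n *+ 'C(n, i).
Proof.
move=> Flow s i ik; pose S := {poly {poly K}}.
pose h : {rmorphism {poly K} -> {poly S}} := map_poly (polyC \o polyC : K -> S).
(* Substitute y = (1 + w) t, with t the outer and w the middle variable. At the moving point y - t =
   w t has weight 1 in w, and the coefficient of t^s w^i collects the terms y^n of the slices s - n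
   with weight ['C(n, i)]. *)
pose v : 'I_3 -> {poly S} := coords 1 (('X + 1)%:P * 'X) ('X)%:P%:P.
have : coef_filtration (weighted_filtration (fun n x => ('X - c%:P) ^+ n %| x)) k (mmap h v F).
  rewrite (mmap_shiftK _ _ (coords 1 'X c%:P)); apply: low_mmap Flow.
    exact/coef_filtrationP/weighted_filtrationP/dvdp_filtration.
  apply: ord3P => e e'; rewrite /= /v /coords !inordK //=.
  - by rewrite map_polyC /= !polyC1 subrr !coef0 dvdp0.
  - rewrite map_polyX rmorphD mulrDl mul1r addrK coefCM coefX.
    case: eqP => _; rewrite ?mulr0 ?coef0 ?dvdp0 // mulr1 coefX.
    by case: eqP => [->|_]; rewrite ?dvdp0 // subnn expr0 dvd1p.
  rewrite map_polyC /= -!rmorphB !coefC; case: eqP => _; rewrite ?coef0 ?dvdp0 //.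
  by rewrite coefC; case: eqP => [->|_]; rewrite ?dvdp0 // subn0 expr1 dvdpp.
move/(_ s i); congr (is_true (_ %| _)).
have szF : (msize F <= D.+1)%N.
  by rewrite msizeE; apply/bigmax_leqP_seq => b /(dhomog_mf FD) bD _; rewrite ltnS bD.
have coef_mmap (b : 'X_{1..3}) : (mmap h v (F@_b *: 'X_[b]))`_s`_i =
    if (b (inord 1) <= s)%N
    then (F@_b)`_(s - b (inord 1)) *: 'X^(b (inord 2)) *+ 'C(b (inord 1), i) else 0.
  rewrite mmapZ mmapX /mmap1 prod_ord3 /v /coords !inordK //= expr1n mul1r exprMn.
  set b1 := b (inord 1); set b2 := b (inord 2).
  have -> : h F@_b * (('X + 1)%:P ^+ b1 * 'X^b1 * ('X)%:P%:P ^+ b2)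
      = (('X + 1) ^+ b1 * ('X^b2)%:P)%:P * (h F@_b * 'X^b1).
    by rewrite polyCM !rmorphXn; ring.
  rewrite coefCM coefMXn ltnNge; case: leqP => // b1s; last by rewrite mulr0 coef0.
  by rewrite coef_map /= mulrAC !coefMC coef_X1_exp -mulrA mul_polyC mulr_natl.
have coef_affineX j n : (affine (slice j))`_n = \sum_(b : 'X_{1..3 < D.+1})
    if b (inord 1) == n then (F@_b)`_j *: 'X^(b (inord 2)) else 0.
  rewrite /slice /affine rmorph_sum coef_sum /=; apply: eq_bigr => b _.
  rewrite mmapZ mmapX /mmap1 prod_ord3 /coords !inordK //= expr1n mul1r -rmorphXn coefCM coefMC.
  by rewrite coefXn eq_sym; case: eqP; rewrite ?mul1r ?mul0r ?mulr0 ?mul_polyC.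
rewrite {1}(mpolywE szF) rmorph_sum !coef_sum /=.
under eq_bigr => b _ do rewrite coef_mmap.
under [RHS]eq_bigr => n _ do rewrite coef_affineX -sumrMnl.
rewrite exchange_big /=; apply: eq_bigr => b _.
have [bs|sb] := leqP (b (inord 1)) s.
  have bs' : (b (inord 1) < s.+1)%N by rewrite ltnS.
  rewrite (bigD1 (Ordinal bs')) //= eqxx big1 ?addr0 // => n.
  by rewrite -val_eqE /= eq_sym => /negPf ->; rewrite mul0rn.
rewrite big1 // => n _; case: eqP => [bn|_]; last by rewrite mul0rn.
by have := ltn_ord n; rewrite -bn ltnS leqNgt sb.
Qed.

End Slices.

Section Points.

Variable K : numFieldType.

Lemma coords_neq0 (x y z : K) : (x != 0) || (z != 0) -> \row_j coords x y z j != 0.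
Proof.
move=> xz; apply: contraTneq xz => /rowP r0.
have := r0 (inord 0); have := r0 (inord 2); rewrite !mxE /coords !inordK //= => -> ->.
by rewrite eqxx.
Qed.

Lemma affine_point_neq0 (y z : K) : \row_j coords 1 y z j != 0.
Proof. by apply: coords_neq0; rewrite oner_eq0. Qed.

Lemma vertex_neq0 : \row_j coords 0 0 1 j != 0 :> 'rV[K]_3.
Proof. by apply: coords_neq0; rewrite oner_eq0 orbT. Qed.

Definition affine_point (y z : K) : point K 2 := exist (fun v => is_true (v != 0)) _ (affine_point_neq0 y z).

Definition vertex : point K 2 := exist (fun v => is_true (v != 0)) _ vertex_neq0.

Lemma hcoord_affine_point y z j : hcoord (affine_point y z) j = coords 1 y z j.
Proof. by rewrite /hcoord mxE. Qed.

Lemma hcoord_vertex j : hcoord vertex j = coords 0 0 1 j.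
Proof. by rewrite /hcoord mxE. Qed.

End Points.

Section GridPoints.

Variables (K : numFieldType) (l m : nat).
Hypotheses (l_gt0 : (0 < l)%N) (m_gt1 : (1 < m)%N).

Let d := (l + m)%N.

(* The base points p_1, p_2, ... run through the grid row by row, so that p_1 *)
(* is (0, m).                                                                 *)
Definition grid_y (r : nat) : nat := (r %/ m)%N.
Definition grid_z (r : nat) : nat := (if r %/ m < l then m + r %% m else r %% m)%N.

Lemma grid_point_rank i j : grid_point l m i j ->
  exists r : nat, [/\ (r.+1 < npoints d m)%N, grid_y r = i & grid_z r = j].
Proof.
have m0 : (0 < m)%N := ltnW m_gt1.
rewrite /grid_point /npoints /grid_y /grid_z => hij.
have [il|li] := ltnP i l.
  exists (i * m + (j - m))%N.
  have jm : (j - m < m)%N by lia.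
  by rewrite divnMDl // divn_small // addn0 il modnMDl modn_small //; split=> //; nia.
exists (i * m + j)%N.
have jm : (j < m)%N by lia.
rewrite divnMDl // divn_small // addn0 [(i < l)%N]ltnNge li modnMDl modn_small //=.
by split=> //; rewrite /d in hij *; nia.
Qed.

(** The point p_1 = (0, m) is moved to (t, m). The ring is left open so that t may be a scalar or
    the variable of K[t]. *)
Definition grid_coords (R : nzRingType) (t : R) (i : 'I_(npoints d m)) : 'I_3 -> R :=
  if i == ord0 then coords 0 0 1
  else coords 1 (if i == 1%N :> nat then t else (grid_y i.-1)%:R) (grid_z i.-1)%:R.

Definition grid_points (t : K) (i : 'I_(npoints d m)) : point K 2 :=
  if i == ord0 then vertex K
  else affine_point (if i == 1%N :> nat then t else (grid_y i.-1)%:R) (grid_z i.-1)%:R.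

Lemma hcoord_grid_points t i j : hcoord (grid_points t i) j = grid_coords t i j.
Proof.
rewrite /grid_points /grid_coords; case: eqP => _; first exact: hcoord_vertex.
exact: hcoord_affine_point.
Qed.

Lemma eq_shift n (R : comNzRingType) (q q' : 'I_n -> R) g : q =1 q' -> shift q g = shift q' g.
Proof. by move=> qq'; apply: eq_mmap => // j; rewrite qq'. Qed.

Lemma grid_trapezoid k (f : {mpoly K[3]}) : f \is (k * d).-homog -> low (k * (d - m)) (shift (coords 0 0 1) f) ->
  trapezoid (k * m).+1 (k * d).+1 (affine f).
Proof.
move=> fD flow; apply: affine_trapezoid => // b bf.
have := @mult_last_exponent 2 K _ (k * (d - m)) _ _ fD _ bf.
have -> : ord_max = inord 2 :> 'I_3 by apply: val_inj; rewrite /= inordK.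
rewrite (_ : shift _ f = shift (coords 0 0 1) f); last first.
  by apply/eq_shift/eq_coords; rewrite -val_eqE /= !inordK.
by move/(_ flow); rewrite /d addnK; nia.
Qed.

Let xi_cond k := (fun i : 'I_(npoints d m) => k * xi_mult i)%N.

(** The forbidden monomial y^(kl) z^(km) has coefficient 1 in the k-th power of the grid, so
    forbidding it makes the scalar of [grid_system] zero. *)
Lemma grid_unique k : only_zero (k * d) (xi_cond k)
  (pred1 [multinom nth 0 [:: 0; k * l; k * m] j | j < 3]%N) (grid_points 0).
Proof.
move=> f [fD fkill flow].
have lowi i : low (k * xi_mult i) (shift (grid_coords 0 i) f).
  by rewrite -(eq_shift _ (hcoord_grid_points 0 i)); apply: flow.
have [||c fE] := @grid_system K l m l_gt0 m_gt1 k (affine f).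
- by apply: grid_trapezoid => //; have := lowi ord0; rewrite /xi_mult /grid_coords eqxx.
- move=> i j ij; have [r [rN ri rj]] := grid_point_rank ij.
  have := lowi (Ordinal rN); rewrite /xi_mult /grid_coords -val_eqE /= muln1.
  case: r ri rj rN => [|r] ri rj rN /=; rewrite ?ri ?rj => /affine_mult_shift //.
  by rewrite -ri /grid_y div0n.
pose b := [multinom nth 0 [:: 0; k * l; k * m] j | j < 3]%N.
have bD : mdeg b = (k * d)%N by rewrite mdegE sum_ord3 !mnmE !inordK //= /d; lia.
have lead_exp n : (roots_at K 0 n ^+ k)`_(k * n) = 1.
  have := monicP (monic_exp k (roots_at_monic K 0 n)).
  by rewrite lead_coefE size_exp size_roots_at mulnC.
have := coef_affine_homog fD bD; rewrite (fkill b (eqxx _)) !mnmE !inordK //= fE.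
rewrite /grid exprMn -!rmorphXn /= coefCM coefMC coef_map /= lead_exp.
rewrite polyC1 mul1r coefCM lead_exp mulr1 => c0.
by apply: (affine_inj fD); rewrite fE c0 !polyC0 mul0r.
Qed.

(** A form over K[t] through the moving configuration has slices that satisfy [grid_deformation], so
    it vanishes, and [only_zero_path] specializes t. *)
Lemma grid_empty k : (0 < k)%N -> (3 < d)%N ->
  exists t, only_zero (k * d) (xi_cond k) pred0 (grid_points t).
Proof.
move=> k0 d3; apply: (@only_zero_path _ _ _ _ K (grid_coords 'X) grid_points).
  move=> t i j; rewrite hcoord_grid_points /grid_coords; case: ifP => _.
    by move: j; apply: ord3P; rewrite /coords !inordK //= ?horner0 ?hornerC.
  move: j; apply: ord3P; rewrite /coords !inordK //= ?hornerC //.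
    by case: ifP => _; rewrite ?hornerX // -polyC_natr hornerC.
  by rewrite -polyC_natr hornerC.
move=> F [FD _ Flow]; apply: (slice_eq0 FD) => j.
apply: (affine_inj (slice_homog FD j)); move: j.
apply: (@grid_deformation K l m l_gt0 m_gt1 d3 k) => // [j|j a b ab|s i ik].
- apply: grid_trapezoid; first exact: slice_homog.
  apply: (low_slice FD); have := Flow ord0; rewrite /xi_cond /xi_mult /grid_coords eqxx.
  rewrite (@eq_shift _ _ (coords 0 0 1) (polyC \o coords 0 0 1)) //.
  by apply: ord3P; rewrite /= /coords !inordK.
- apply: affine_mult_shift; apply: (low_slice FD).
  have /andP[/grid_point_rank[r [rN ra rb]] nr] := ab.
  have r0 : r != 0%N by apply: contraTneq nr => r0; rewrite -ra -rb r0 /grid_y /grid_z div0n mod0n l_gt0 addn0 !eqxx.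
  have := Flow (Ordinal rN); rewrite /xi_cond /xi_mult /grid_coords -val_eqE /= muln1 eqSS (negPf r0).
  rewrite ra rb (@eq_shift _ _ (coords 1 a%:R b%:R) (polyC \o coords 1 a%:R b%:R)) //.
  by apply: ord3P; rewrite /= /coords !inordK //= polyC_natr.
apply: moving_point ik => //.
have N1 : (1 < npoints d m)%N by rewrite /npoints /d; nia.
have := Flow (Ordinal N1); rewrite /xi_cond /xi_mult /grid_coords -val_eqE /= muln1.
by rewrite /grid_z div0n mod0n l_gt0 addn0 -polyC_natr.
Qed.

End GridPoints.

(** * Powers of a pencil *)

Section BinaryForm.

Variables (K : fieldType) (n : nat) (u v : {mpoly K[n]}).

(** The homogenization of P to degree k, evaluated at (u, v); coefficients of P above k are
    discarded. *)
Definition binary_form (k : nat) (P : {poly K}) : {mpoly K[n]} :=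
  \sum_(i < k.+1) P`_i *: (u ^+ i * v ^+ (k - i)).

Lemma binary_formD k P Q : binary_form k (P + Q) = binary_form k P + binary_form k Q.
Proof. by rewrite /binary_form -big_split; apply: eq_bigr => i _; rewrite coefD scalerDl. Qed.

Lemma binary_formB k P Q : binary_form k (P - Q) = binary_form k P - binary_form k Q.
Proof. by rewrite /binary_form -sumrB; apply: eq_bigr => i _; rewrite coefB scalerBl. Qed.

Lemma binary_formZ k c P : binary_form k (c *: P) = c *: binary_form k P.
Proof. by rewrite /binary_form scaler_sumr; apply: eq_bigr => i _; rewrite coefZ scalerA. Qed.

Lemma binary_formMX k P : binary_form k.+1 ('X * P) = u * binary_form k P.
Proof.
rewrite /binary_form big_ord_recl coefXM scale0r add0r mulr_sumr; apply: eq_bigr => i _.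
by rewrite coefXM /= -scalerAr mulrA exprS.
Qed.

Lemma binary_formS k (P : {poly K}) : (size P <= k.+1)%N -> binary_form k.+1 P = v * binary_form k P.
Proof.
move=> sP; rewrite /binary_form big_ord_recr /= nth_default // scale0r addr0 mulr_sumr.
apply: eq_bigr => i _; rewrite -scalerAr mulrCA -exprS subSn // -ltnS.
exact: ltn_ord.
Qed.

Lemma binary_form_roots k (r : seq K) : (size r <= k)%N ->
  binary_form k (\prod_(z <- r) ('X - z%:P)) = \prod_(z <- r) (u - z *: v) * v ^+ (k - size r).
Proof.
elim: r k => [|z r IH] k /=.
  rewrite !big_nil mul1r subn0 => _; elim: k => [|k IHk].
    by rewrite /binary_form big_ord1 coefC scale1r mul1r.
  by rewrite binary_formS ?size_poly1 // IHk exprS.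
case: k => // k rk; rewrite !big_cons mulrBl binary_formB binary_formMX mul_polyC binary_formZ.
rewrite binary_formS ?size_prod_XsubC // IH // subSS scalerAl -mulrBl.
by rewrite mulrA.
Qed.

Lemma binary_formX l k (P : {poly K}) : (size P <= l.+1)%N ->
  binary_form (k + l) P = v ^+ k * binary_form l P.
Proof.
move=> sP; elim: k => [|k IH]; first by rewrite mul1r.
by rewrite addSn binary_formS ?IH ?exprS ?mulrA // (leq_trans sP) // ltnS leq_addl.
Qed.

Lemma binary_form0 k : binary_form k 0 = 0.
Proof. by rewrite /binary_form big1 // => i _; rewrite coef0 scale0r. Qed.

Lemma binary_form1 k : binary_form k 1 = v ^+ k.
Proof.
by rewrite -[k in LHS]addn0 binary_formX ?size_poly1 // /binary_form big_ord1 coefC scale1r !mulr1.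
Qed.

Lemma binary_formXn k i : (i <= k)%N -> binary_form k 'X^i = u ^+ i * v ^+ (k - i).
Proof.
move=> ik; rewrite /binary_form (bigD1 (Ordinal (ik : (i < k.+1)%N))) //= coefXn eqxx scale1r.
rewrite big1 ?addr0 // => j ji; rewrite coefXn.
by move: ji; rewrite -(inj_eq val_inj) /= => /negPf ->; rewrite scale0r.
Qed.

Lemma binary_formM k l (P Q : {poly K}) : (size P <= k.+1)%N -> (size Q <= l.+1)%N ->
  binary_form (k + l) (P * Q) = binary_form k P * binary_form l Q.
Proof.
move=> sP sQ; elim/poly_ind: P k sP => [|P c IH] k sP.
  by rewrite mul0r !binary_form0 mul0r.
have cE j : binary_form j (c%:P) = c *: v ^+ j by rewrite -alg_polyC binary_formZ binary_form1.
have [P0|Pn] := eqVneq P 0.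
  rewrite P0 mul0r add0r mul_polyC binary_formZ binary_formX // cE.
  by rewrite scalerAl.
case: k sP => [|k]; first by rewrite size_MXaddC (negPf Pn) /= ltnS leqn0 size_poly_eq0 (negPf Pn).
rewrite size_MXaddC (negPf Pn) /= ltnS => sP.
rewrite mulrDl !binary_formD [P * 'X]mulrC -mulrA addSn !binary_formMX IH // cE.
by rewrite mul_polyC binary_formZ -addSn binary_formX // mulrDl mulrA scalerAl.
Qed.

Lemma mmap_binary_form (S : comNzRingType) (h : {rmorphism K -> S}) (q : 'I_n -> S) (s y : S) k (P : {poly K}) :
  (size P <= k.+1)%N -> mmap h q u = s * y -> mmap h q v = s ->
  mmap h q (binary_form k P) = s ^+ k * (map_poly h P).[y].
Proof.
move=> sP hu hv; rewrite (horner_coef_wide (n := k.+1)); last by rewrite (leq_trans (size_poly _ _)).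
rewrite (rmorph_sum (mmap h q)) /= mulr_sumr; apply: eq_bigr => i _.
rewrite mmapZ rmorphM !rmorphXn /= hu hv coef_map /= exprMn.
have -> : s ^+ k = s ^+ i * s ^+ (k - i) by rewrite -exprD subnKC // -ltnS.
by ring.
Qed.

End BinaryForm.

Lemma binary_form_scale (K : fieldType) (n : nat) (s u v : {mpoly K[n]}) k P :
  binary_form (s * u) (s * v) k P = s ^+ k * binary_form u v k P.
Proof.
rewrite /binary_form mulr_sumr; apply: eq_bigr => i _.
by rewrite !exprMn -scalerAr mulrACA -exprD subnKC // -ltnS.
Qed.

Lemma comp_binary_form (K : fieldType) (n l : nat) (q : n.-tuple {mpoly K[l]}) u v k P :
  binary_form u v k P \mPo q = binary_form (u \mPo q) (v \mPo q) k P.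
Proof.
rewrite /binary_form raddf_sum; apply: eq_bigr => i _ /=.
by rewrite comp_mpolyZ rmorphM !rmorphXn.
Qed.

Section BinaryForms.

Variables (K : closedFieldType) (e : nat) (u v : {mpoly K[3]}).
Hypotheses (ue : u \is e.-homog) (ve : v \is e.-homog).
Hypothesis uv_free : forall a b : K, a *: u + b *: v = 0 -> a = 0 /\ b = 0.
Local Notation binary_form := (binary_form u v).

Definition in_pencil (f : {mpoly K[3]}) : Prop :=
  f != 0 /\ exists a b : K, f = a *: u + b *: v.

Definition in_power (k : nat) (f : {mpoly K[3]}) : Prop :=
  f != 0 /\ exists P : {poly K}, f = binary_form k P.

Lemma v_neq0 : v != 0.
Proof.
apply/eqP => v0; have [|_ /eqP] := uv_free (a := 0) (b := 1); last by rewrite oner_eq0.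
by rewrite v0 scaler0 scale0r addr0.
Qed.

Lemma in_pencil_v : in_pencil v.
Proof. by split; [exact: v_neq0 | exists 0, 1; rewrite scale0r scale1r add0r]. Qed.

Lemma in_pencil_uv z : in_pencil (u - z *: v).
Proof.
split; last by exists 1, (- z); rewrite scale1r scaleNr.
apply/eqP => uz; have [|/eqP] := uv_free (a := 1) (b := - z); last by rewrite oner_eq0.
by rewrite scale1r scaleNr.
Qed.

(** Each root z of P gives a factor u - z v, and the missing degree, a root at infinity, gives
    factors v. *)
Lemma binary_form_split k (P : {poly K}) : P != 0 -> (size P <= k.+1)%N -> exists s : seq {mpoly K[3]},
  (forall g, g \in s -> in_pencil g) /\ binary_form k P = lead_coef P *: \prod_(g <- s) g.
Proof.
move=> P0 sP; have [r PE] := closed_field_poly_normal P.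
have rk : (size r <= k)%N.
  by move: sP; rewrite PE size_scale ?lead_coef_eq0 // size_prod_XsubC.
exists ([seq u - z *: v | z <- r] ++ nseq (k - size r) v); split.
  move=> g; rewrite mem_cat => /orP[/mapP[z _ ->]|]; first exact: in_pencil_uv.
  by rewrite mem_nseq => /andP[_ /eqP ->]; apply: in_pencil_v.
by rewrite {1}PE binary_formZ binary_form_roots // big_cat big_map big_nseq iter_mulr_1.
Qed.

Lemma binary_form_eq0 k (P : {poly K}) : (size P <= k.+1)%N -> binary_form k P = 0 -> P = 0.
Proof.
move=> sP P0; apply/eqP; apply: contraT => Pn; have [s [hs sE]] := binary_form_split Pn sP.
move: P0; rewrite sE => /eqP; rewrite scaler_eq0 lead_coef_eq0 (negPf Pn) /=.
by rewrite prodf_seq_eq0 => /hasP[g /hs[/negPf g0 _]]; rewrite /= g0.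
Qed.

Lemma binary_form_trunc k (P : {poly K}) : exists2 Q : {poly K}, (size Q <= k.+1)%N & binary_form k P = binary_form k Q.
Proof.
exists (\poly_(i < k.+1) P`_i); first exact: size_poly.
by apply: eq_bigr => i _; rewrite coef_poly ltn_ord.
Qed.

Lemma power_homog k i : (i < k.+1)%N -> u ^+ i * v ^+ (k - i) \is (e * k).-homog.
Proof.
move=> ik; have -> : (e * k = e * i + e * (k - i))%N by rewrite -mulnDr subnKC.
by apply: dhomogM; apply: dhomogMn.
Qed.

Lemma power_basis k (L : {mpoly K[3]} -> Prop) (X : k.+1.-tuple (dhomog 3 K (e * k))) :
  (forall i : 'I_k.+1, (tnth X i : {mpoly K[3]}) = u ^+ i * v ^+ (k - i)) ->
  (forall f, L f <-> in_power k f) -> linear_system_basis X L.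
Proof.
move=> XE LE.
have sumX (c : 'I_k.+1 -> K) : (\sum_i c i *: tnth X i : dhomog 3 K (e * k)) =
    binary_form k (\poly_(i < k.+1) c (inord i)) :> {mpoly K[3]}.
  rewrite [LHS]linear_sum /=; apply: eq_bigr => i _.
  rewrite -[LHS]/(c i *: (tnth X i : {mpoly K[3]})).
  by rewrite XE coef_poly ltn_ord inord_val.
split.
  apply/freeP => c; under eq_bigr => i _ do rewrite -tnth_nth.
  move/(congr1 (fun h : dhomog 3 K (e * k) => h : {mpoly K[3]})); rewrite sumX => c0 i.
  have /(congr1 (coefp i)) := binary_form_eq0 (size_poly _ _) c0.
  by rewrite /= coef_poly ltn_ord coef0 inord_val.
move=> f; split=> [/LE[f0 [P fE]]|[f0 [h hX fE]]].
  split=> //; exists (\sum_(i < k.+1) P`_i *: tnth X i).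
    by apply: memv_suml => i _; apply/memvZ/memv_span/mem_tnth.
  rewrite sumX fE; apply: eq_bigr => i _.
  by rewrite coef_poly ltn_ord inordK.
apply/LE; split=> //; exists (\poly_(i < k.+1) (coord X (inord i) h)).
rewrite fE -(sumX (fun i => coord X i h)) {1}(coord_span hX); congr (mpoly_of_dhomog _); apply: eq_bigr => i _.
by rewrite -tnth_nth.
Qed.

Lemma in_power1 f : in_power 1 f <-> in_pencil f.
Proof.
split=> -[f0]; [case=> P fE | case=> a [b fE]]; rewrite fE in f0 *.
  split=> //; exists P`_1, P`_0; rewrite /binary_form big_ord_recl big_ord1 /=.
  by rewrite !expr1 !expr0 mulr1 mul1r addrC.
split=> //; exists (a *: 'X + b%:P); rewrite /binary_form big_ord_recl big_ord1 /=.
rewrite !expr1 !expr0 mulr1 mul1r !coefD !coefZ !coefX !coefC /=.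
by rewrite mulr0 mulr1 add0r addr0 addrC.
Qed.

Lemma power_has_dimension k (L : {mpoly K[3]} -> Prop) :
  (forall f, L f <-> in_power k f) -> has_dimension L k.
Proof.
move=> LE; exists (e * k)%N, [tuple DHomog (power_homog (ltn_ord i)) | i < k.+1].
by apply: power_basis => // i; rewrite tnth_mktuple.
Qed.

(** Members of L split into members of P by [binary_form_split]. An irreducible component is prime
    by unique factorization, so it divides one of these factors. *)
Lemma power_of_pencil k (L P : {mpoly K[3]} -> Prop) :
  (forall f, P f <-> in_pencil f) -> (forall f, L f <-> in_power k f) ->
  [/\ composed_with L P, has_dimension L k & no_foreign_components L P].
Proof.
move=> PE LE; have splitL f : L f -> exists s : seq {mpoly K[3]},
    (forall g, g \in s -> P g) /\ same_divisor f (\prod_(g <- s) g).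
  move=> /LE[f0 [Q0 fE]]; have [Q sQ Q0E] := binary_form_trunc k Q0.
  have Q_neq0 : Q != 0.
    apply: contraNneq f0 => Q0'; rewrite fE Q0E Q0' /binary_form big1 // => i _.
    by rewrite coef0 scale0r.
  have [s [hs sE]] := binary_form_split Q_neq0 sQ; exists s; split=> [g /hs/PE //|].
  by exists (lead_coef Q); rewrite ?lead_coef_eq0 // fE Q0E.
split=> //.
- by split=> //; apply: power_has_dimension => f; split=> [/PE/in_power1 | /in_power1/PE].
- exact: power_has_dimension.
move=> f g /splitL[s [hs [c c0 fE]]] [g0 _ ng girr] gf.
have [_ _ gprime] := irreducible_prime (@factorial_mpoly K 3) g0 ng girr.
have : rdvd g (\prod_(h <- s) h).
  by case: gf => q qE; exists (c^-1 *: q); rewrite -scalerAl -qE fE scalerA mulVf // scale1r.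
elim: s {fE} hs => [|h s IH] hs.
  by rewrite big_nil => -[q qE]; case/negP: ng; apply/unitrP; exists q; rewrite [g * q]mulrC -qE.
rewrite big_cons => /gprime[gh|/IH]; first by exists h => //; apply: hs; rewrite mem_head.
by apply=> h' h's; apply: hs; rewrite in_cons h's orbT.
Qed.

End BinaryForms.

(** * The pencil of graphs *)

Lemma wide_kernel (K : fieldType) (m n : nat) (A : 'M[K]_(m, n)) : (m < n)%N ->
  exists2 v : 'cV[K]_n, v != 0 & A *m v = 0.
Proof.
move=> mn; have : cokermx A != 0.
  by rewrite cokermx_eq0 /row_full ltn_eqF // (leq_ltn_trans (rank_leq_row A)).
case/matrix0Pn=> i [j ij]; exists (col j (cokermx A)).
  by apply: contraNneq ij => /colP/(_ i)/eqP; rewrite !mxE.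
by rewrite colE mulmxA mulmx_coker mul0mx.
Qed.

Definition pair_functional (K : fieldType) (lam : {poly K} -> {poly K} -> K) : Prop :=
  forall a b P Q P' Q',
    lam (a *: P + b *: P') (a *: Q + b *: Q') = a * lam P Q + b * lam P' Q'.

Section GraphPencil.

Variables (K : numFieldType) (N d : nat) (y z : 'I_N -> K).
Hypotheses (Nd : N.+1 = d.*2) (y_inj : injective y).

(** The curve P + zeta Q = 0, of degree D with multiplicity at least D - 1 at the pole, seen as the
    graph zeta = - P / Q through the points (y_i, z_i). *)
Definition on_graph (D : nat) (P Q : {poly K}) : Prop :=
  [/\ (size P <= D.+1)%N, (size Q <= D)%N & forall i, P.[y i] + z i * Q.[y i] = 0].

Hypothesis no_smaller : forall P Q, on_graph d.-1 P Q -> P = 0 /\ Q = 0.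

Lemma d_gt0 : (0 < d)%N.
Proof. by move: Nd; case: d. Qed.

Lemma on_graphD D a b P Q P' Q' : on_graph D P Q -> on_graph D P' Q' ->
  on_graph D (a *: P + b *: P') (a *: Q + b *: Q').
Proof.
have szD n (R R' : {poly K}) : (size R <= n)%N -> (size R' <= n)%N -> (size (a *: R + b *: R')%R <= n)%N.
  move=> Rn Rn'; rewrite (leq_trans (size_polyD _ _)) // geq_max.
  by rewrite !(leq_trans (size_scale_leq _ _)).
move=> [sP sQ PQ] [sP' sQ' PQ']; split; try exact: szD.
move=> i; rewrite !hornerD !hornerZ.
have -> : a * P.[y i] + b * P'.[y i] + z i * (a * Q.[y i] + b * Q'.[y i])
   = a * (P.[y i] + z i * Q.[y i]) + b * (P'.[y i] + z i * Q'.[y i]) by ring.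
by rewrite PQ PQ' !mulr0 addr0.
Qed.

(** If Q vanishes at y_i then so does P, and the curve contains the line through the pole over y_i.
    Removing it from both curves leaves degree d - 1 and only the i-th condition unmet; a
    combination that meets it is zero by [no_smaller]. *)
Lemma on_graph_vertical P Q P' Q' i : on_graph d P Q -> on_graph d P' Q' ->
  Q.[y i] = 0 -> Q'.[y i] = 0 -> exists a b : K, [/\ (a != 0) || (b != 0),
    a *: P + b *: P' = 0 & a *: Q + b *: Q' = 0].
Proof.
move=> PQ PQ' Qi Qi'.
have divide R S : on_graph d R S -> S.[y i] = 0 -> exists R1 S1,
    [/\ R = R1 * ('X - (y i)%:P), S = S1 * ('X - (y i)%:P), (size R1 <= d)%N,
        (size S1 <= d.-1)%N & forall j, j != i -> R1.[y j] + z j * S1.[y j] = 0].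
  case=> sR sS RS Si; have Ri : R.[y i] = 0 by have := RS i; rewrite Si mulr0 addr0.
  have /factor_theorem[R1 RE] : root R (y i) by apply/rootP.
  have /factor_theorem[S1 SE] : root S (y i) by apply/rootP.
  exists R1, S1; split=> //.
  - have [->|R10] := eqVneq R1 0; first by rewrite size_poly0.
    by move: sR; rewrite RE size_Mmonic ?monicXsubC // size_XsubC addn2.
  - have [->|S10] := eqVneq S1 0; first by rewrite size_poly0.
    by move: sS; rewrite SE size_Mmonic ?monicXsubC // size_XsubC addn2 /= => sS1; rewrite -ltnS (prednK d_gt0).
  move=> j ji; have := RS j; rewrite RE SE !hornerM mulrA -mulrDl => /eqP.
  rewrite mulf_eq0 !hornerE subr_eq0 (inj_eq y_inj) (negPf ji) orbF => /eqP //.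
have [P1 [Q1 [PE QE sP1 sQ1 PQ1]]] := divide _ _ PQ Qi.
have [P2 [Q2 [PE' QE' sP2 sQ2 PQ2]]] := divide _ _ PQ' Qi'.
pose e1 := P1.[y i] + z i * Q1.[y i]; pose e2 := P2.[y i] + z i * Q2.[y i].
(* The pair (e2, - e1) solves a e1 + b e2 = 0; it is replaced by (1, 0) when it is zero. *)
pose a := if (e1 == 0) && (e2 == 0) then 1 else e2.
pose b := if (e1 == 0) && (e2 == 0) then 0 else - e1.
have ab : (a != 0) || (b != 0).
  rewrite /a /b; case: ifP => [_|]; first by rewrite oner_eq0.
  by rewrite oppr_eq0; case: (e1 == 0); case: (e2 == 0).
have abe : a * e1 + b * e2 = 0.
  rewrite /a /b; case: ifP => [/andP[/eqP -> /eqP ->]|_]; first by rewrite !mulr0 addr0.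
  by rewrite mulNr mulrC subrr.
have szD n (R R' : {poly K}) : (size R <= n)%N -> (size R' <= n)%N -> (size (a *: R + b *: R')%R <= n)%N.
  move=> Rn Rn'; rewrite (leq_trans (size_polyD _ _)) // geq_max.
  by rewrite !(leq_trans (size_scale_leq _ _)).
have [|P0 Q0] := @no_smaller (a *: P1 + b *: P2) (a *: Q1 + b *: Q2).
  split; [by rewrite prednK ?d_gt0 //; apply: szD | exact: szD |].
  move=> j; rewrite !hornerD !hornerZ.
  have -> : a * P1.[y j] + b * P2.[y j] + z j * (a * Q1.[y j] + b * Q2.[y j])
     = a * (P1.[y j] + z j * Q1.[y j]) + b * (P2.[y j] + z j * Q2.[y j]) by ring.
  by have [->|ji] := eqVneq j i; [exact: abe | rewrite PQ1 // PQ2 // !mulr0 addr0].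
exists a, b; split=> //.
  by rewrite PE PE' !scalerAl -mulrDl P0 mul0r.
by rewrite QE QE' !scalerAl -mulrDl Q0 mul0r.
Qed.

Lemma pair_functional_sum (lam : {poly K} -> {poly K} -> K) n (v : 'I_n -> K) F G :
  pair_functional lam ->
  lam (\sum_i v i *: F i) (\sum_i v i *: G i) = \sum_i v i * lam (F i) (G i).
Proof.
move=> lamL; elim: n v F G => [|n IH] v F G.
  by rewrite !big_ord0; have := lamL 0 0 0 0 0 0; rewrite !scale0r !mul0r !addr0.
rewrite !big_ord_recr /= -IH; set S := \sum_i _; set T := \sum_i _.
by have := lamL 1 (v ord_max) S T (F ord_max) (G ord_max); rewrite !scale1r mul1r.
Qed.

(* 2 d + 1 unknown coefficients against 2 d linear conditions. *)
Lemma on_graph_exists (lam : {poly K} -> {poly K} -> K) : pair_functional lam ->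
  exists P Q, [/\ on_graph d P Q, lam P Q = 0 & (P != 0) || (Q != 0)].
Proof.
move=> lamL.
pose F (j : 'I_(d.+1 + d)) : {poly K} := if split j is inl j' then 'X^j' else 0.
pose G (j : 'I_(d.+1 + d)) : {poly K} := if split j is inr j' then 'X^j' else 0.
pose phi (i : 'I_N.+1) P Q := if unlift ord0 i is Some i' then P.[y i'] + z i' * Q.[y i'] else lam P Q.
have phiL i : pair_functional (phi i).
  move=> a b P Q P' Q'; rewrite /phi; case: unliftP => [i' _|_]; last exact: lamL.
  by rewrite !hornerD !hornerZ; ring.
have [|v v0 /colP Av] := @wide_kernel K N.+1 (d.+1 + d) (\matrix_(i, j) phi i (F j) (G j)).
  by rewrite Nd -addnn addSn.
pose P := \sum_j v j 0 *: F j; pose Q := \sum_j v j 0 *: G j.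
have phi0 i : phi i P Q = 0.
  have := Av i; rewrite !mxE => E; rewrite -[RHS]E /P /Q (pair_functional_sum _ _ _ (phiL i)).
  by apply: eq_bigr => j _; rewrite mxE mulrC.
have PE : P = \poly_(i < d.+1) v (lshift d (inord i)) 0.
  rewrite poly_def /P big_split_ord /= [X in _ + X]big1 ?addr0 => [|j _].
    apply: eq_bigr => j _; rewrite /F inord_val.
    by case: split_ordP => [j' /lshift_inj -> //|j' /eqP]; rewrite eq_lrshift.
  by rewrite /F; case: split_ordP => [j' /eqP|j' _]; rewrite ?eq_rlshift // scaler0.
have QE : Q = \sum_(j < d) v (rshift d.+1 j) 0 *: 'X^j.
  rewrite /Q big_split_ord /= big1 ?add0r => [|j _].
    apply: eq_bigr => j _; rewrite /G.
    by case: split_ordP => [j' /eqP|j' /rshift_inj -> //]; rewrite eq_rlshift.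
  by rewrite /G; case: split_ordP => [j' _|j' /eqP]; rewrite ?eq_lrshift // scaler0.
exists P, Q; split.
- split; first by rewrite PE size_poly.
    rewrite QE; apply: (leq_trans (size_sum _ _ _)); apply/bigmax_leqP => j _.
    by rewrite (leq_trans (size_scale_leq _ _)) // size_polyXn.
  by move=> i; have := phi0 (lift ord0 i); rewrite /phi liftK.
- by have := phi0 ord0; rewrite /phi unlift_none.
apply: contraNT v0; rewrite negb_or !negbK => /andP[/eqP P0 /eqP Q0].
apply/eqP/colP => j; rewrite mxE; case: (split_ordP j) => j' ->.
  have := congr1 (coefp (val j')) PE; rewrite P0 /= coef0 coef_poly ltn_ord inord_val => <- //.
have := congr1 (coefp (val j')) QE; rewrite Q0 /= coef0 coef_sum (bigD1 j') //= big1 => [|i ij'].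
  by rewrite addr0 coefZ coefXn eqxx mulr1.
rewrite coefZ coefXn; case: eqP => [E|]; last by rewrite mulr0.
by case/eqP: ij'; apply: val_inj.
Qed.

(** The space has dimension at least 2 by counting. It is at most 2 because, modulo one member,
    every other can be made to contain the line over the first point, where [on_graph_vertical]
    makes it proportional to a fixed curve. *)
Lemma graph_pencil : exists P1 Q1 P2 Q2,
  [/\ on_graph d P1 Q1, on_graph d P2 Q2, forall i, Q1.[y i] != 0,
      forall a b : K, a *: P1 + b *: P2 = 0 -> a *: Q1 + b *: Q2 = 0 -> a = 0 /\ b = 0 &
      forall P Q, on_graph d P Q -> exists a b : K, P = a *: P1 + b *: P2 /\ Q = a *: Q1 + b *: Q2].
Proof.
have N0 : (0 < N)%N by move: d_gt0 Nd; case: N => // ; case: (d) => [|[|]].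
pose i0 := Ordinal N0.
have [P1 [Q1 [PQ1 lam1 PQ1_neq0]]] := @on_graph_exists (fun P Q => Q.[y i0])
  ltac:(by move=> *; rewrite hornerD !hornerZ).
(* A leading coefficient of the first member. A second member on which it vanishes is independent of
   the first. *)
pose lam (P Q : {poly K}) := if P1 == 0 then Q`_(size Q1).-1 else P`_(size P1).-1.
have lamL : pair_functional lam.
  by move=> a b P Q P' Q'; rewrite /lam; case: ifP => _; rewrite coefD !coefZ.
have lam1_neq0 : lam P1 Q1 != 0.
  move: PQ1_neq0; rewrite /lam; case: ifP => [_ /= Q10|/negbT P10 _].
    by rewrite -lead_coefE lead_coef_eq0.
  by rewrite -lead_coefE lead_coef_eq0.
have [P2 [Q2 [PQ2 lam2 PQ2_neq0]]] := on_graph_exists lamL.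
have free12 a b : a *: P1 + b *: P2 = 0 -> a *: Q1 + b *: Q2 = 0 -> a = 0 /\ b = 0.
  move=> P0 Q0; have := lamL a b P1 Q1 P2 Q2; rewrite P0 Q0 lam2 mulr0 addr0.
  have -> : lam 0 0 = 0 by rewrite /lam; case: ifP; rewrite coef0.
  move/esym/eqP; rewrite mulf_eq0 (negPf lam1_neq0) orbF => /eqP a0; split=> //.
  move: P0 Q0; rewrite a0 !scale0r !add0r => /eqP; rewrite scaler_eq0.
  case: (b =P 0) => //= bn /eqP P20 /eqP; rewrite scaler_eq0.
  by case: (b =P 0) => //= _ /eqP Q20; rewrite P20 Q20 eqxx in PQ2_neq0.
have not_both i : (Q1.[y i] != 0) || (Q2.[y i] != 0).
  apply: contraT; rewrite negb_or !negbK => /andP[/eqP Q1i /eqP Q2i].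
  have [a [b [ab P0 Q0]]] := on_graph_vertical PQ1 PQ2 Q1i Q2i.
  by have [a0 b0] := free12 a b P0 Q0; rewrite a0 b0 eqxx in ab.
have span12 P Q : on_graph d P Q -> exists a b : K, P = a *: P1 + b *: P2 /\ Q = a *: Q1 + b *: Q2.
  move=> PQ; have Q2i0 : Q2.[y i0] != 0 by have := not_both i0; rewrite lam1 eqxx.
  pose c := Q.[y i0] / Q2.[y i0].
  have PQc : on_graph d (1 *: P + (- c) *: P2) (1 *: Q + (- c) *: Q2) by apply: on_graphD.
  have Qc0 : (1 *: Q + (- c) *: Q2).[y i0] = 0.
    by rewrite hornerD !hornerZ mul1r mulNr divfK // subrr.
  have [a [b [ab P0 Q0]]] := on_graph_vertical PQ1 PQc lam1 Qc0.
  have b0 : b != 0.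
    apply: contraTneq ab => b0; rewrite b0 eqxx orbF negbK.
    move: P0 Q0; rewrite b0 !scale0r !addr0 => /eqP + /eqP; rewrite !scaler_eq0.
    by case: (a =P 0) => //= _ /eqP P10 /eqP Q10; rewrite P10 Q10 !eqxx in PQ1_neq0.
  have solve (R R1 R2 : {poly K}) : a *: R1 + b *: (1 *: R + (- c) *: R2) = 0 ->
      R = (- (a / b)) *: R1 + c *: R2.
    move=> E; apply: (scalerI b0).
    have -> : b *: R = a *: R1 + b *: (1 *: R + (- c) *: R2) - a *: R1 + (b * c) *: R2.
      by rewrite -!mul_polyC polyCM polyCN polyC1; ring.
    by rewrite E sub0r scalerDr !scalerA mulrN [b * (a / b)]mulrC divfK // scaleNr.
  by exists (- (a / b)), c; split; apply: solve.
(* The slope of member 1 plus t times member 2 at y_i, as a polynomial in t. None of these is zero,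
   so one t keeps all slopes nonzero. *)
pose L i : {poly K} := Q1.[y i]%:P + Q2.[y i] *: 'X.
have [|t Lt] := @nonroot K (\prod_i L i).
  apply/prodf_neq0 => i _; apply: contraTneq (not_both i) => Li0.
  rewrite negb_or !negbK; have := congr1 (coefp 0) Li0; have := congr1 (coefp 1) Li0.
  rewrite /= !coefD !coefZ !coefX !coefC /= ?coef0 mulr0 mulr1 addr0 add0r => -> ->.
  by rewrite eqxx.
exists (1 *: P1 + t *: P2), (1 *: Q1 + t *: Q2), P2, Q2; split=> //.
- exact: on_graphD.
- move=> i; rewrite horner_prod in Lt; have /prodf_neq0/(_ i isT) := Lt.
  rewrite /L !hornerE => H. by rewrite mulrC.
- move=> a b; rewrite !scalerDr !scalerA mulr1 -!addrA -!scalerDl => P0 Q0.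
  by have [a0 b0] := free12 _ _ P0 Q0; move: b0; rewrite a0 mul0r add0r.
move=> P Q /span12[a [b [-> ->]]]; exists a, (b - a * t); rewrite !scale1r !scalerDr !scalerA.
by rewrite -!addrA -!scalerDl [a * t + _]addrC subrK.
Qed.

End GraphPencil.

Lemma mmap_dhomog (K : fieldType) (n m e D : nat) (q : 'I_n -> {mpoly K[m]}) g :
  (forall j, q j \is e.-homog) -> g \is D.-homog -> mmap (@mpolyC m K) q g \is (D * e).-homog.
Proof.
move=> qe /dhomogP gD; rewrite /mmap big_seq; apply: rpred_sum => b /gD bD.
rewrite mul_mpolyC dhomogZ // /mmap1; have <- : mdeg b = D := bD.
rewrite mdegE big_distrl /=.
apply: (big_rec2 (fun c g => g \is (c).-homog)) => [|j c h _ hc]; first exact: dhomog1.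
by apply: dhomogM => //; rewrite mulnC; apply: dhomogMn.
Qed.

Lemma ord_max3 : ord_max = inord 2 :> 'I_3.
Proof. by apply: val_inj; rewrite /= inordK. Qed.

(** * Forms with a point of prescribed multiplicity *)

Section AtPoint.

Variables (K : fieldType) (p : 'I_3 -> K).
Hypothesis p2 : p (inord 2) != 0.
Implicit Types (f : {mpoly K[3]}) (F : nat -> {poly K}).

(** This linear form is 1 at p, while [psi] 0 and [psi] 1 vanish there; in these three coordinates p
    is (0:0:1). *)
Definition zeta : {mpoly K[3]} := (p (inord 2))^-1 *: 'X_(inord 2).

Definition psi (j : 'I_3) : {mpoly K[3]} := 'X_j - p j *: zeta.

Lemma zeta_homog : zeta \is 1.-homog.
Proof. by rewrite /zeta dhomogZ // dhomogX /= mdeg1. Qed.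

Lemma psi_homog j : psi j \is 1.-homog.
Proof. by rewrite /psi rpredB ?rpredZ ?zeta_homog // dhomogX /= mdeg1. Qed.

Lemma psi2 : psi (inord 2) = 0.
Proof. by rewrite /psi /zeta scalerA divff // scale1r subrr. Qed.

Lemma shift_zeta : shift p zeta = zeta + 1.
Proof.
rewrite /shift /zeta mmapZ mmapX mmap1U mulrDr -!mul_mpolyC; congr (_ + _).
by rewrite -mpolyCM mulVf.
Qed.

Lemma low_psi j : low 1 (shift p (psi j)).
Proof.
rewrite /psi /shift mmapB mmapX mmap1U mmapZ -/(shift p zeta) shift_zeta mulrDr mulr1.
have -> : 'X_j + (p j)%:MP - ((p j)%:MP * zeta + (p j)%:MP) = 'X_j - (p j)%:MP * zeta :> {mpoly K[3]} by ring.
have filL := low_filtration 3 K.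
apply: (filtrationB filL); first exact: lowX.
by apply: (filtrationMl filL); rewrite /zeta -mul_mpolyC; apply/(filtrationMl filL)/lowX.
Qed.

Definition pole_form (D : nat) (P : {poly K}) : {mpoly K[3]} :=
  binary_form (psi (inord 1)) (psi (inord 0)) D P.

Definition pole_expansion (e D : nat) F : {mpoly K[3]} :=
  \sum_(j < e.+1) zeta ^+ j * pole_form (D - j) (F j).

Lemma binary_form_homog (n c k : nat) (u v : {mpoly K[n]}) P : u \is c.-homog -> v \is c.-homog ->
  binary_form u v k P \is (c * k).-homog.
Proof.
move=> uc vc; apply: rpred_sum => i _; rewrite rpredZ //.
have -> : (c * k = c * i + c * (k - i))%N by rewrite -mulnDr subnKC // -ltnS.
by apply: dhomogM; apply: dhomogMn.
Qed.

Lemma pole_expansion_homog e D F : (forall j, (size (F j) <= D.+1 - j)%N) ->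
  pole_expansion e D F \is D.-homog.
Proof.
move=> sF; apply: rpred_sum => j _; have [jD|Dj] := leqP j D.
  have := dhomogM (dhomogMn j zeta_homog) (binary_form_homog (D - j) (F j)
    (psi_homog (inord 1)) (psi_homog (inord 0))).
  by rewrite !mul1n subnKC.
have -> : F j = 0.
  apply/eqP; rewrite -size_poly_eq0 -leqn0; apply: leq_trans (sF j) _.
  by rewrite leqn0 subn_eq0.
by rewrite /pole_form binary_form0 mulr0 rpred0.
Qed.

Lemma pole_expansion_low e D F : low (D - e) (shift p (pole_expansion e D F)).
Proof.
have filL := low_filtration 3 K; have [_ _ _ IM Imono] := filL.
rewrite /pole_expansion /shift rmorph_sum; apply: filtration_sum => // j _ /=.
rewrite rmorphM; apply: (filtrationMl filL).
rewrite /pole_form /binary_form rmorph_sum; apply: filtration_sum => // i _ /=.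
rewrite -mul_mpolyC !rmorphM !rmorphXn /=; apply: (filtrationMl filL).
apply: (Imono _ (i + (D - j - i))%N).
  by have := ltn_ord j; have := ltn_ord i; lia.
apply: IM; apply: (filtrationX filL); exact: low_psi.
Qed.

(** Once p is moved to the vertex (0:0:1), [mult_last_exponent] bounds the exponent of the last
    variable by e, and each monomial is a term of the expansion. *)
Lemma pole_expansionP e D mu f : f \is D.-homog -> low mu (shift p f) -> (D <= mu + e)%N ->
  exists2 F : nat -> {poly K}, forall j, (size (F j) <= D.+1 - j)%N & f = pole_expansion e D F.
Proof.
move=> fD fmu Dmu.
pose has_expansion (g : {mpoly K[3]}) :=
  exists2 F : nat -> {poly K}, forall j, (size (F j) <= D.+1 - j)%N & g = pole_expansion e D F.
(* The linear change of coordinates that takes (0:0:1) to p; [theta] is its inverse. *)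
pose toward_pole j : {mpoly K[3]} := (if j == inord 2 then 0 else 'X_j) + p j *: 'X_(inord 2).
pose theta j := if j == inord 2 then zeta else psi j.
pose H := mmap (@mpolyC 3 K) toward_pole f.
have HD : H \is D.-homog.
  rewrite -[D]muln1; apply: mmap_dhomog => // j.
  have X_homog (i : 'I_3) : ('X_i : {mpoly K[3]}) \is 1.-homog by rewrite dhomogX /= mdeg1.
  by rewrite /toward_pole rpredD ?rpredZ //; case: ifP; rewrite ?rpred0.
have Hlow : low mu (shift (fun j => (j == ord_max)%:R) H).
  have -> : shift (fun j => (j == ord_max)%:R) H = mmap (@mpolyC 3 K) toward_pole (shift p f).
    rewrite /shift /H !mmap_mmap; apply: eq_mmap => [//|i]; rewrite ord_max3 /toward_pole.
    rewrite !mmapD mmapZ !mmapX !mmap1U eqxx mmapC mulrDr mulr1 mul_mpolyC addrA; congr (_ + _ + _).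
    case: ifP => [_|i2]; first by rewrite mmap0.
    by rewrite mmapX mmap1U i2 addr0.
  have filL := low_filtration 3 K.
  have [_ I0 ID _ _] := filL; apply: (low_mmap _ filL _ fmu) => i.
  apply: ID; last by rewrite -mul_mpolyC; apply/(filtrationMl filL)/lowX.
  by case: (i == inord 2); [exact: I0 | exact: lowX].
have fE : f = mmap (@mpolyC 3 K) theta H.
  rewrite /H mmap_mmap -[LHS]mmap_id; apply: eq_mmap => [//|j].
  rewrite mmapD mmapZ mmapX mmap1U {2}/theta eqxx mul_mpolyC.
  case: ifP => [/eqP ->|j2]; first by rewrite mmap0 add0r /zeta scalerA divff // scale1r.
  by rewrite mmapX mmap1U /theta j2 subrK.
rewrite fE /mmap big_seq; apply: (big_ind has_expansion).
- exists (fun=> 0) => [j|]; first by rewrite size_poly0.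
  by rewrite /pole_expansion big1 // => j _; rewrite /pole_form binary_form0 mulr0.
- move=> _ _ [F1 sF1 ->] [F2 sF2 ->]; exists (fun j => F1 j + F2 j) => [j|].
    by rewrite (leq_trans (size_polyD _ _)) // geq_max sF1 sF2.
  rewrite /pole_expansion -big_split; apply: eq_bigr => j _.
  by rewrite /pole_form binary_formD mulrDr.
move=> b bH; have := mult_last_exponent HD Hlow bH; rewrite ord_max3 => b2.
have := dhomog_mf HD bH; rewrite /= mdegE sum_ord3 => bD.
exists (fun j => if j == b (inord 2) then H@_b *: 'X^(b (inord 1)) else 0) => [j|].
  case: eqP => [->|_]; last by rewrite size_poly0.
  by rewrite (leq_trans (size_scale_leq _ _)) // size_polyXn; lia.
have be : (b (inord 2) < e.+1)%N by lia.
rewrite /pole_expansion (bigD1 (Ordinal be)) //= eqxx big1 ?addr0 => [|j jb]; last first.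
  by rewrite -[j == _ :> nat]/(j == Ordinal be) (negPf jb) /pole_form binary_form0 mulr0.
rewrite /pole_form binary_formZ binary_formXn; last by lia.
have -> : (D - b (inord 2) - b (inord 1) = b (inord 0))%N by lia.
rewrite /mmap1 prod_ord3 /theta eqxx -!(inj_eq val_inj) /= !inordK //= mul_mpolyC -scalerAr.
congr (_ *: _); ring.
Qed.

(* The substitution s (1, Y, 0) + t p sends zeta, psi_0, psi_1 to t, s, s Y. *)
Lemma mmap_pole_expansion (S : comNzRingType) (h : {rmorphism K -> S}) (q : 'I_3 -> S) (s t Y : S) e D F :
  (forall j, (size (F j) <= D.+1 - j)%N) ->
  (forall j, q j = s * coords 1 Y 0 j + h (p j) * t) ->
  mmap h q (pole_expansion e D F) = \sum_(j < e.+1) t ^+ j * (s ^+ (D - j) * (map_poly h (F j)).[Y]).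
Proof.
move=> sF qE.
have zE : mmap h q zeta = t.
  rewrite /zeta mmapZ mmapX mmap1U qE /coords inordK //= mulr0 add0r mulrA -rmorphM.
  by rewrite mulVf // rmorph1 mul1r.
have pE j : mmap h q (psi j) = s * coords 1 Y 0 j.
  by rewrite /psi mmapB mmapX mmap1U mmapZ zE qE addrK.
rewrite /pole_expansion rmorph_sum; apply: eq_bigr => j _ /=.
rewrite rmorphM rmorphXn /= zE; have [jD|Dj] := leqP j D.
  rewrite /pole_form (mmap_binary_form (s := s) (y := Y)) ?pE ?/coords ?inordK ?mulr1 //=.
  by have := sF j; rewrite subSn.
have -> : F j = 0.
  apply/eqP; rewrite -size_poly_eq0 -leqn0; apply: leq_trans (sF j) _.
  by rewrite leqn0 subn_eq0.
by rewrite /pole_form binary_form0 mmap0 rmorph0 horner0 !mulr0.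
Qed.

(** With s = 1 and t, Y two independent variables, the substitution below turns the expansion into
    the sum of the t^j F_j(Y), from which the F_j are read off. *)
Lemma pole_expansion_inj e D F : (forall j, (size (F j) <= D.+1 - j)%N) ->
  pole_expansion e D F = 0 -> forall j, (j <= e)%N -> F j = 0.
Proof.
move=> sF F0 j je.
have := @mmap_pole_expansion {poly {poly K}} (polyC \o polyC)
  (fun j => coords 1 ('X)%:P 0 j + (p j)%:P%:P * 'X) 1 'X ('X)%:P e D F sF.
rewrite F0 mmap0 => /(_ ltac:(by move=> i; rewrite mul1r)) => /esym E.
have := congr1 (coefp j) E; rewrite /= coef0 coef_sum (bigD1 (Ordinal (je : (j < e.+1)%N))) //=.
rewrite big1 => [|i ij]; rewrite ?addr0; rewrite !expr1n !mul1r map_poly_comp horner_map /=.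
  rewrite coefXnM ltnn subnn coefC /=.
  by rewrite -/(map_poly polyC (F j)) -[(map_poly _ _).['X]]/(F j \Po 'X) comp_polyXr.
rewrite coefXnM; case: ltnP => // ij'; rewrite coefC.
case: eqP => // /eqP; rewrite subn_eq0 => ji; case/eqP: ij; apply/val_inj/eqP.
by rewrite eqn_leq ij' ji.
Qed.

End AtPoint.

Section Cones.

Variables (K : fieldType) (p : 'I_3 -> K).
Hypothesis p2 : p (inord 2) != 0.

Definition pole_form2 (D : nat) (P Q : {poly K}) : {mpoly K[3]} :=
  pole_form p D P + zeta p * pole_form p D.-1 Q.

Lemma pole_expansion0 D F : pole_expansion p 0 D F = pole_form p D (F 0%N).
Proof. by rewrite /pole_expansion big_ord1 mul1r subn0. Qed.

Lemma pole_expansion1 D F : pole_expansion p 1 D F = pole_form2 D (F 0%N) (F 1%N).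
Proof. by rewrite /pole_expansion big_ord_recl big_ord1 mul1r subn0 expr1 subn1. Qed.

Lemma size_nth2 D (P Q : {poly K}) j : (size P <= D.+1)%N -> (size Q <= D)%N ->
  (size ([:: P; Q]`_j)%R <= D.+1 - j)%N.
Proof.
by move=> sP sQ; case: j => [|[|j]]; rewrite /= ?subn0 ?subn1 //= nth_nil size_poly0.
Qed.

Lemma pole_form_inj D (P : {poly K}) : (size P <= D.+1)%N -> pole_form p D P = 0 -> P = 0.
Proof.
move=> sP P0; have sF j : (size ([:: P; 0]`_j)%R <= D.+1 - j)%N by apply: size_nth2; rewrite ?size_poly0.
by apply: (pole_expansion_inj p2 sF (e := 0) _ (leqnn 0)); rewrite pole_expansion0.
Qed.

Lemma pole_form2_inj D (P Q : {poly K}) : (size P <= D.+1)%N -> (size Q <= D)%N ->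
  pole_form2 D P Q = 0 -> P = 0 /\ Q = 0.
Proof.
move=> sP sQ PQ0; have sF j : (size ([:: P; Q]`_j)%R <= D.+1 - j)%N by apply: size_nth2.
have := pole_expansion_inj p2 sF (e := 1); rewrite pole_expansion1 => /(_ PQ0) E.
by split; [exact: (E 0%N) | exact: (E 1%N)].
Qed.

Lemma pole_form_homog D P : pole_form p D P \is D.-homog.
Proof. by rewrite -[X in (X).-homog]mul1n; apply: binary_form_homog; apply: psi_homog. Qed.

Lemma pole_form_trunc D P : exists2 Q : {poly K}, (size Q <= D.+1)%N & pole_form p D P = pole_form p D Q.
Proof.
exists (\poly_(i < D.+1) P`_i); first exact: size_poly.
by apply: eq_bigr => i _; rewrite coef_poly ltn_ord.
Qed.

Lemma pole_formM k l (P Q : {poly K}) : (size P <= k.+1)%N -> (size Q <= l.+1)%N ->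
  pole_form p (k + l) (P * Q) = pole_form p k P * pole_form p l Q.
Proof. exact: binary_formM. Qed.

Lemma pole_formX n k (R : {poly K}) : (size R <= n.+1)%N ->
  pole_form p (k * n) (R ^+ k) = pole_form p n R ^+ k.
Proof.
move=> sR; have sX e : (size (R ^+ e)%R <= (e * n).+1)%N.
  elim: e => [|e IH]; first by rewrite expr0 size_poly1.
  by rewrite exprS (leq_trans (size_polyMleq _ _)) //; lia.
elim: k => [|k IH]; first by rewrite mul0n !expr0 /pole_form binary_form1 expr0.
by rewrite mulSn !exprS pole_formM // IH.
Qed.

Lemma pole_form2_linear D (a b : K) P Q P' Q' :
  pole_form2 D (a *: P + b *: P') (a *: Q + b *: Q') = a *: pole_form2 D P Q + b *: pole_form2 D P' Q'.
Proof.
rewrite /pole_form2 /pole_form !binary_formD !binary_formZ mulrDr -!scalerAr !scalerDr.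
by rewrite addrACA.
Qed.

Lemma pole_form2_eq D (P Q P' Q' : {poly K}) : (size P <= D.+1)%N -> (size Q <= D)%N ->
  (size P' <= D.+1)%N -> (size Q' <= D)%N ->
  pole_form2 D P Q = pole_form2 D P' Q' -> P = P' /\ Q = Q'.
Proof.
move=> sP sQ sP' sQ' E; have szB n (R R' : {poly K}) : (size R <= n)%N -> (size R' <= n)%N ->
    (size (1 *: R + (- 1) *: R')%R <= n)%N.
  move=> Rn Rn'; rewrite (leq_trans (size_polyD _ _)) // geq_max.
  by rewrite !(leq_trans (size_scale_leq _ _)).
have := pole_form2_inj (szB _ _ _ sP sP') (szB _ _ _ sQ sQ').
rewrite pole_form2_linear E !scaleN1r !scale1r subrr => /(_ erefl)[/eqP + /eqP].
by rewrite !subr_eq0 => /eqP -> /eqP ->.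
Qed.

Lemma pole_form2M a b (F G H : {poly K}) : (size F <= a.+1)%N -> (size G <= b.+1)%N -> (size H <= b)%N ->
  pole_form p a F * pole_form2 b G H = pole_form2 (a + b) (F * G) (F * H).
Proof.
move=> sF sG sH; rewrite /pole_form2 pole_formM // mulrDr mulrCA.
(* For b = 0 the truncated degree [b.-1] is harmless because H = 0. *)
case: b sH {sG} => [|b] sH; last by rewrite addnS /= pole_formM.
move: sH; rewrite leqn0 size_poly_eq0 => /eqP ->.
by rewrite mulr0 /pole_form !binary_form0 mulr0.
Qed.

Lemma cone D f : f \is D.-homog /\ low D (shift p f) <->
  exists2 P : {poly K}, (size P <= D.+1)%N & f = pole_form p D P.
Proof.
split=> [[fD flow]|[P sP ->]].
  have [|F sF ->] := @pole_expansionP K p p2 0 D D f fD flow; first by rewrite addn0.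
  by exists (F 0%N); rewrite ?pole_expansion0 //; have := sF 0%N; rewrite subn0.
have sF j : (size ([:: P; 0]`_j)%R <= D.+1 - j)%N by apply: size_nth2; rewrite ?size_poly0.
split; first exact: pole_form_homog.
by have := @pole_expansion_low _ _ p2 0 D (nth 0 [:: P; 0]); rewrite pole_expansion0 subn0.
Qed.

Lemma near_cone D f : f \is D.-homog /\ low D.-1 (shift p f) <->
  exists P Q : {poly K}, [/\ (size P <= D.+1)%N, (size Q <= D)%N & f = pole_form2 D P Q].
Proof.
split=> [[fD flow]|[P [Q [sP sQ ->]]]].
  have [|F sF ->] := @pole_expansionP K p p2 1 D D.-1 f fD flow; first by rewrite addn1 leqSpred.
  exists (F 0%N), (F 1%N); rewrite pole_expansion1; split=> //.
  by have := sF 1%N; rewrite subn1 /=.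
have sF j := size_nth2 j sP sQ.
have := pole_expansion_homog p 1 sF; have := @pole_expansion_low _ _ p2 1 D (nth 0 [:: P; Q]).
by rewrite pole_expansion1 subn1.
Qed.

Lemma psi_free (a b : K) : a *: psi p (inord 1) + b *: psi p (inord 0) = 0 -> a = 0 /\ b = 0.
Proof.
move=> ab0; have sP : (size (a *: 'X + b%:P)%R <= 2)%N.
  by rewrite -mul_polyC size_MXaddC; case: ifP => // _; rewrite ltnS size_polyC leq_b1.
have := pole_form_inj sP; rewrite /pole_form binary_formD binary_formZ -alg_polyC binary_formZ.
rewrite -[X in binary_form _ _ _ X]expr1 binary_formXn // binary_form1 expr1 mulr1 => /(_ ab0) P0.
have := congr1 (coefp 0) P0; have := congr1 (coefp 1) P0.
rewrite /= !coefD !coefZ !coefX !coefC /= ?coef0 !mulr0 !mulr1 add0r addr0.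
by move=> -> ->.
Qed.

End Cones.

Lemma general_coord (K : fieldType) N (p0 : 'I_N -> point K 2) i j : hcoord (p0 i) j != 0 ->
  general_near p0 (fun p => hcoord (p i) j != 0).
Proof.
move=> pij; exists 'X_(mxvec_index i j); split; [|by rewrite eval_atX | by move=> p; rewrite eval_atX].
by exists (fun i' => 1 * (i' == i))%N; apply: (@homogeneous_ofX K N 2 i j 1).
Qed.

Lemma cone_system (K : closedFieldType) N D (mu : 'I_N.+1 -> nat) (p : 'I_N.+1 -> point K 2) f :
  N = 0%N -> mu ord0 = D -> hcoord (p ord0) (inord 2) != 0 ->
  plane_system D mu p f <-> in_power (psi (hcoord (p ord0)) (inord 1)) (psi (hcoord (p ord0)) (inord 0)) D f.
Proof.
move=> N0 muD p2; split=> [[f0 fD flow] | [f0 [P fE]]].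
  split=> //; have [P _ ->] : exists2 P : {poly K}, (size P <= D.+1)%N & f = pole_form (hcoord (p ord0)) D P.
    by apply/(cone p2); split=> //; apply/(mult_ge_shift _ _ fD); rewrite -muD; apply: flow.
  by exists P.
have [Q sQ QE] := pole_form_trunc (hcoord (p ord0)) D P.
have [fD flow] : f \is D.-homog /\ low D (shift (hcoord (p ord0)) f).
  by apply/(cone p2); exists Q; rewrite // fE -QE.
split=> // i; have -> : i = ord0 by apply: val_inj; case: i => i /=; rewrite N0; case: i.
by rewrite muD; apply/(mult_ge_shift _ _ fD).
Qed.

(** By [cone], the system xi_{d,0} consists of the nonzero binary forms of degree d in two lines
    through p_0, so it is the d-th power of that pencil. The open condition on p_0 is that its last
    coordinate be nonzero. *)
Lemma lines_general (K : closedFieldType) d (p0 : 'I_(npoints d 0) -> point K 2) : 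
  hcoord (p0 ord0) (inord 2) != 0 ->
  general_near p0 (fun p : 'I_(npoints d 0) -> point K 2 =>
        [/\ composed_with (xi p) (lines_through (p ord0)),
            has_dimension (xi p) d &
            no_foreign_components (xi p) (lines_through (p ord0))]).
Proof.
move/general_coord; apply: general_near_imp => p p2.
apply: (power_of_pencil (psi_homog _ _) (psi_homog _ _) (psi_free p2)).
  move=> f; rewrite -in_power1; exact: cone_system.
by move=> f; apply: cone_system => //; rewrite /xi_mult eqxx subn0.
Qed.

Lemma size_mul_bound (R : nzRingType) a n (F G : {poly R}) : (size F <= a.+1)%N -> (size G <= n)%N ->
  (size (F * G)%R <= a + n)%N.
Proof. by move=> sF sG; apply: leq_trans (size_polyMleq _ _) _; lia. Qed.

Lemma size_exp_bound (R : nzRingType) n e (F : {poly R}) : (size F <= n.+1)%N -> (size (F ^+ e)%R <= (e * n).+1)%N.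
Proof.
move=> sF; elim: e => [|e IH]; first by rewrite expr0 size_poly1.
by rewrite exprS mulSn -addnS; apply: size_mul_bound.
Qed.

Lemma residue_degree d k j : (0 < d)%N -> (j <= k)%N ->
  (j * d + ((k - j) * d.-1 + (k * d - j)) = k * d.-1 + k * d)%N.
Proof.
case: d => // d _ jk; have : (j <= k * d.+1)%N by rewrite (leq_trans jk) // leq_pmulr.
have : (j * d <= k * d)%N by rewrite leq_mul2r jk orbT.
by rewrite mulnBl !mulnS /=; lia.
Qed.

Lemma prod_XsubC_dvd (K : fieldType) (r : seq K) k (P : {poly K}) : uniq r ->
  (forall a, a \in r -> ('X - a%:P) ^+ k %| P) -> (\prod_(a <- r) ('X - a%:P)) ^+ k %| P.
Proof.
elim: r => [|a r IH] /=; first by rewrite big_nil expr1n dvd1p.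
move=> /andP[ar ur] rP; rewrite big_cons exprMn Gauss_dvdp; last first.
  by rewrite coprimep_expl // coprimep_expr // coprimep_sym coprimep_XsubC root_prod_XsubC.
rewrite rP ?mem_head // IH // => b br.
by apply: rP; rewrite in_cons br orbT.
Qed.

Lemma low_homog_eq0 n (R : comNzRingType) (q : 'I_n -> R) f D : f \is D.-homog -> low D.+1 (shift q f) -> f = 0.
Proof.
move=> fD flow; apply/mpolyP => a; rewrite mcoeff0.
have [aD|aD] := eqVneq (mdeg a) D; last by rewrite (dhomog_nemf_coeff fD).
have := flow a; rewrite aD ltnSn => /(_ isT); rewrite (mcoeff_shift _ _ fD).
have aD1 : (mdeg a < D.+1)%N by rewrite aD.
rewrite (bigD1 (BMultinom aD1)) //= big1 => [|b ba].
  by rewrite addr0 /taylor_coef big1 ?mulr1 // => j _; rewrite subnn binn.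
have [bD|bD] := eqVneq (mdeg b) D; last by rewrite (dhomog_nemf_coeff fD bD) mul0r.
have [j abj] : exists j, (b j < a j)%N.
  apply/existsP; apply: contraNT ba => /existsPn ab; apply/eqP/val_inj/mnmP => j /=.
  have le i : (a i <= b i)%N by rewrite leqNgt ab.
  have /eqP : mdeg a = mdeg b by rewrite aD bD.
  rewrite !mdegE (leqif_sum (fun i _ => leqif_eq (le i))).2 => /forallP/(_ j)/eqP.
  by move=> ->.
by rewrite /taylor_coef (bigD1 j) //= bin_small // mulr0n mul0r mulr0.
Qed.

Lemma low1_eval n (K : fieldType) (q : 'I_n -> K) f : low 1 (shift q f) <-> mmap idfun q f = 0.
Proof.
have -> : mmap idfun q f = (shift q f)@_0.
  rewrite /shift (rmorph_mmap (mcoeff 0)); apply: eq_mmap => [c|j] /=.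
    by rewrite mcoeffC eqxx mulr1.
  by rewrite mcoeffD mcoeffC eqxx mulr1 mcoeffX mnm1_eq0 add0r.
split=> [/(_ 0%MM)|q0 m]; first by rewrite mdeg0; apply.
by rewrite ltnS leqn0 mdeg_eq0 => /eqP ->.
Qed.

Lemma unit_not_root n (K : fieldType) (q : 'I_n -> K) (f : {mpoly K[n]}) : mmap idfun q f = 0 -> f \isn't a GRing.unit.
Proof.
move=> f0; apply/negP => /unitrP[g [_ fg]].
have /eqP := congr1 (mmap idfun q) fg.
by rewrite rmorphM /= f0 mul0r rmorph1 eq_sym oner_eq0.
Qed.

Lemma general_linear (K : fieldType) N r (p0 : 'I_N -> point K r) i j j' a b :
  a * hcoord (p0 i) j + b * hcoord (p0 i) j' != 0 ->
  general_near p0 (fun p => a * hcoord (p i) j + b * hcoord (p i) j' != 0).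
Proof.
pose F : {mpoly K[N * r.+1]} := a *: 'X_(mxvec_index i j) + b *: 'X_(mxvec_index i j').
have FE p : eval_at F p = a * hcoord (p i) j + b * hcoord (p i) j'.
  by rewrite -!eval_atX /eval_at mevalD !mevalZ.
move=> p0n; exists F; split; [|by rewrite FE|by move=> p; rewrite FE].
exists (fun i' => 1 * (i' == i))%N; apply: homogeneous_ofD; apply: homogeneous_ofZ.
  exact: (@homogeneous_ofX K N r i j 1).
exact: (@homogeneous_ofX K N r i j' 1).
Qed.

(** * Irreducibility, rationality and multiples of the pencil of graphs *)

Section Pencil.

Variables (K : numClosedFieldType) (N d : nat) (p : 'I_3 -> K) (x : 'I_N -> 'I_3 -> K).
Variables (s t y : 'I_N -> K).
Let z i := t i / s i.
Implicit Types (P Q : {poly K}) (f : {mpoly K[3]}) (F : nat -> {poly K}).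
Hypothesis p2 : p (inord 2) != 0.
Hypothesis xE : forall i j, x i j = s i * coords 1 (y i) 0 j + p j * t i.
Hypothesis s0 : forall i, s i != 0.
Hypotheses (Nd : N.+1 = d.*2) (y_inj : injective y).
Local Notation on_graph := (on_graph y z).
Hypothesis no_smaller : forall P Q, on_graph d.-1 P Q -> P = 0 /\ Q = 0.

Let d_gt0 : (0 < d)%N := d_gt0 Nd.

(** The vector space behind k xi_{d,1}, with p in the place of p_0 and the x_i in that of the other
    points; zero is included. *)
Definition in_multiple (k : nat) (f : {mpoly K[3]}) : Prop :=
  [/\ f \is (k * d).-homog, low (k * d.-1) (shift p f) & forall i, low k (shift (x i) f)].

Lemma eval_pole_form2 i D P Q : (size P <= D.+1)%N -> (size Q <= D)%N ->
  mmap idfun (x i) (pole_form2 p D P Q) = s i ^+ D * (P.[y i] + z i * Q.[y i]).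
Proof.
move=> sP sQ; have := @pole_expansion1 _ p D (nth 0 [:: P; Q]) => /= <-.
rewrite (mmap_pole_expansion p2 (s := s i) (t := t i) (Y := y i)) //; last by move=> j; apply: size_nth2.
rewrite big_ord_recl big_ord1 /= !map_poly_id // mul1r subn0 expr1 /z.
case: D sP sQ => [|D] _ sQ; last by rewrite subn1 exprS /=; field; apply: s0.
by move: sQ; rewrite leqn0 size_poly_eq0 => /eqP ->; rewrite horner0 !mulr0 !addr0.
Qed.

Lemma on_graph_form D P Q : (size P <= D.+1)%N -> (size Q <= D)%N ->
  on_graph D P Q <-> forall i, low 1 (shift (x i) (pole_form2 p D P Q)).
Proof.
move=> sP sQ; split=> [[_ _ PQ] i|PQ].
  by apply/low1_eval; rewrite eval_pole_form2 // PQ mulr0.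
split=> // i; have /low1_eval := PQ i; rewrite eval_pole_form2 // => /eqP.
by rewrite mulf_eq0 expf_eq0 (negPf (s0 i)) andbF => /eqP.
Qed.

Lemma in_multiple1 f : in_multiple 1 f <-> exists P Q, on_graph d P Q /\ f = pole_form2 p d P Q.
Proof.
rewrite /in_multiple !mul1n; split=> [[fd fp fx]|[P [Q [PQ ->]]]].
  have [P [Q [sP sQ fE]]] := (near_cone p2 d f).1 (conj fd fp).
  exists P, Q; split; last exact: fE.
  by apply/(on_graph_form sP sQ) => i; rewrite -fE; apply: fx.
have [sP sQ _] := PQ; have [|fd fp] := (near_cone p2 d (pole_form2 p d P Q)).2; first by exists P, Q.
by split; [exact: fd | exact: fp | exact/(on_graph_form sP sQ)].
Qed.

Section Member.

Variables (P Q : {poly K}).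
Hypotheses (PQ : on_graph d P Q) (Q0 : forall i, Q.[y i] != 0).
Let w := pole_form2 p d P Q.

Let sP : (size P <= d.+1)%N. Proof. by case: PQ. Qed.
Let sQ : (size Q <= d)%N. Proof. by case: PQ. Qed.

Lemma N_gt0 : (0 < N)%N.
Proof. by move: d_gt0 Nd; case: N => //; case: (d) => [|[]]. Qed.

Lemma member_slope_neq0 : Q != 0.
Proof. by apply: contraTneq (Q0 (Ordinal N_gt0)) => ->; rewrite horner0 eqxx. Qed.

Lemma member_neq0 : w != 0.
Proof.
by apply/eqP => /(pole_form2_inj p2 sP sQ)[_ /eqP]; rewrite (negPf member_slope_neq0).
Qed.

Lemma member_in_system : in_multiple 1 w.
Proof. by apply/in_multiple1; exists P, Q. Qed.

Lemma member_homog : w \is d.-homog.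
Proof. by have [] := member_in_system; rewrite mul1n. Qed.

Lemma member_low : low d.-1 (shift p w).
Proof. by have [_ + _] := member_in_system; rewrite mul1n. Qed.

Lemma member_eval i : mmap idfun (x i) w = 0.
Proof. by apply/low1_eval; have [_ _] := member_in_system. Qed.

Lemma member_not_unit : w \isn't a GRing.unit.
Proof. exact: unit_not_root (member_eval (Ordinal N_gt0)). Qed.

(* A factor that is a cone does not pass through the x_i, so the other factor *)
(* does; it would then be a graph of smaller degree.                          *)
Lemma cone_factor_unit a b (f g : {mpoly K[3]}) : w = f * g -> (a + b)%N = d ->
  f \is (a).-homog -> g \is (b).-homog -> low a (shift p f) -> f \is a GRing.unit.
Proof.
move=> wE abd fa gb fcone.
have [F sF fE] := (cone p2 a f).1 (conj fa fcone).
have f0 : f != 0 by apply: contraNneq member_neq0 => f0; rewrite wE f0 mul0r.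
have [a0|a_gt0] := posnP a.
  have fC : f = (F`_0)%:MP.
    by rewrite fE a0 /pole_form /binary_form big_ord1 !expr0 mulr1 alg_mpolyC.
  rewrite fC; move: f0; rewrite fC mpolyC_eq0 -unitfE.
  exact: (rmorph_unit (@mpolyC 3 K)).
have glow : low b.-1 (shift p g).
  case: (b) abd => [|b'] abd //=; apply: (@low_div _ _ a _ (shift p f)); last first.
    by move/(low_homog_eq0 fa)/eqP; rewrite (negPf f0).
  rewrite -[_ * _]rmorphM -/(shift p (f * g)) -wE.
  by have := member_low; rewrite -abd addnS.
have [G [H [sG sH gE]]] := (near_cone p2 b g).1 (conj gb glow).
have sFG : (size (F * G)%R <= d.+1)%N.
  by rewrite -abd -addnS; apply: size_mul_bound.
have sFH : (size (F * H)%R <= d)%N.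
  by rewrite -abd; apply: size_mul_bound.
have [PE QE] : P = F * G /\ Q = F * H.
  by apply: (pole_form2_eq p2 sP sQ sFG sFH); rewrite -/w wE fE gE pole_form2M // abd.
have [] := @no_smaller G H.
  have bd : (b.+1 <= d)%N by rewrite -abd addnC -addn1 leq_add2l.
  split; [by rewrite prednK //; apply: leq_trans bd | by apply: leq_trans sH _; rewrite -ltnS prednK |] => i.
  have [_ _ /(_ i)] := PQ; have := Q0 i; rewrite PE QE !hornerM mulf_eq0 negb_or => /andP[Fi _] /eqP.
  by rewrite mulrCA -mulrDr mulf_eq0 (negPf Fi) => /eqP.
by move=> _ H0; have := member_slope_neq0; rewrite QE H0 mulr0 eqxx.
Qed.

(** For a factorization into degrees a + b = d, the multiplicity d - 1 at p forces one factor to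
    have multiplicity equal to its degree, that is, to be a cone; [cone_factor_unit] makes it
    constant. *)
Lemma member_irreducible : irreducible_curve w.
Proof.
split; [exact: member_neq0 | by exists d; apply: member_homog | exact: member_not_unit |].
move=> f g wE; have [||a [b [abd fa gb]]] := homog_factor (D := d) (f := f) (g := g).
- by rewrite -wE member_neq0.
- by rewrite -wE member_homog.
have [fcone|nfcone] := classic (low a (shift p f)); [left | right].
  exact: cone_factor_unit wE abd fa gb fcone.
rewrite mulrC in wE; rewrite addnC in abd; apply: (cone_factor_unit wE abd gb fa).
have a0 : (0 < a)%N by case: (a) nfcone => // -[]; case: (low_filtration 3 K).
apply: (@low_div _ _ a.-1 _ (shift p f)); last by rewrite prednK.
rewrite -[_ * _]rmorphM -/(shift p (f * g)) mulrC -wE.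
have -> : (a.-1 + b = d.-1)%N by rewrite -abd; lia.
exact: member_low.
Qed.

Lemma member_prime : prime_element w.
Proof.
have [w0 _ nw irr] := member_irreducible.
exact: irreducible_prime (@factorial_mpoly K 3) w0 nw irr.
Qed.

(* phi is the inverse of the projection psi from p: the line psi_1 X_0 = psi_0 X_1 *)
(* through p meets the curve outside p at the point psi_0 = A X_0, zeta = - B. *)
Let A : {mpoly K[2]} := binary_form 'X_(inord 1) 'X_ord0 d.-1 Q.
Let B : {mpoly K[2]} := binary_form 'X_(inord 1) 'X_ord0 d P.
Let line : 'I_3 -> {mpoly K[2]} := coords 'X_ord0 'X_(inord 1) 0.
Let phi : 3.-tuple {mpoly K[2]} := [tuple A * line j - p j *: B | j < 3].
Let projection : 2.-tuple {mpoly K[3]} := [tuple psi p (inord 0); psi p (inord 1)].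

Let phiE j : tnth phi j = A * line j - p j *: B.
Proof. by rewrite tnth_mktuple. Qed.

Let comp_X (q : 3.-tuple {mpoly K[2]}) j : 'X_j \mPo q = tnth q j.
Proof. by rewrite comp_mpolyXU -tnth_nth. Qed.

Let zeta_phi : zeta p \mPo phi = - B.
Proof.
rewrite /zeta comp_mpolyZ comp_X phiE /line /coords inordK //= mulr0 sub0r scalerN scalerA.
by rewrite mulVf // scale1r.
Qed.

Let psi_phi j : psi p j \mPo phi = A * line j.
Proof. by rewrite /psi comp_mpolyB comp_mpolyZ comp_X phiE zeta_phi scalerN opprK subrK. Qed.

Let pole_form_phi D R : pole_form p D R \mPo phi = A ^+ D * binary_form 'X_(inord 1) 'X_ord0 D R.
Proof. by rewrite /pole_form comp_binary_form !psi_phi /line /coords !inordK //= binary_form_scale. Qed.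

Let w_phi : w \mPo phi = 0.
Proof.
rewrite /w /pole_form2 comp_mpolyD rmorphM /= zeta_phi !pole_form_phi -/A -/B.
by rewrite -(prednK d_gt0) exprS /=; ring.
Qed.

Let A_neq0 : A != 0.
Proof.
apply: contraNneq member_slope_neq0 => A0; apply/eqP.
have := @mmap_binary_form K 2 'X_(inord 1) 'X_ord0 {poly K} polyC (fun j => if j == ord0 then 1 else 'X) 1 'X d.-1 Q.
rewrite prednK // -/A A0 mmap0 expr1n mul1r => /(_ sQ).
rewrite !mmapX !mmap1U /= -val_eqE /= inordK //= mul1r => /(_ erefl erefl).
by rewrite -/(Q \Po 'X) comp_polyXr.
Qed.

Let projection_tnth (j : 'I_2) : tnth projection j = psi p (inord j).
Proof. by case: j => -[|[|//]] j2; rewrite (tnth_nth 0). Qed.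

Let phi_projection j : tnth phi j \mPo projection = pole_form p d.-1 Q * 'X_j - p j *: w.
Proof.
have Xp (i : 'I_2) : 'X_i \mPo projection = psi p (inord i).
  by rewrite comp_mpolyXU -tnth_nth projection_tnth.
have bE D R : binary_form 'X_(inord 1) 'X_ord0 D R \mPo projection = pole_form p D R.
  by rewrite comp_binary_form !Xp /= inordK.
have lineE : line j \mPo projection = 'X_j - p j *: zeta p.
  rewrite -[RHS]/(psi p j) /line /coords; move: j; apply: ord3P; rewrite !inordK //= ?Xp ?inordK //.
  by rewrite comp_mpoly0 psi2.
rewrite phiE comp_mpolyB comp_mpolyZ rmorphM /= lineE /A /B !bE /w /pole_form2 -!mul_mpolyC.
ring.
Qed.

Lemma member_rational : rational_curve w.
Proof.
split; first exact: member_irreducible.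
exists d, 1%N, phi, projection; split.
- split=> j; last by rewrite projection_tnth psi_homog.
  have X1 (i : 'I_2) : ('X_i : {mpoly K[2]}) \is 1.-homog by rewrite dhomogX /= mdeg1.
  have bh D R := binary_form_homog D R (X1 (inord 1)) (X1 ord0).
  have line1 : line j \is 1.-homog.
    by rewrite /line /coords; move: j; apply: ord3P; rewrite !inordK //= ?X1 // rpred0.
  have := dhomogM (bh d.-1 Q) line1; have := bh d P; rewrite !mul1n addn1 prednK // => Bd Ad.
  by rewrite phiE rpredB // rpredZ.
- exact: w_phi.
- split; last first.
    move=> i j; rewrite !projection_tnth !psi_phi.
    have lineX (l : 'I_2) : line (inord l) = 'X_l.
      by rewrite /line /coords inordK ?(leq_trans (ltn_ord l)) //; case: l => -[|[|//]] l2 /=; congr ('X_ _); apply: val_inj; rewrite /= ?inordK.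
    by rewrite !lineX; ring.
  exists ord0; rewrite projection_tnth psi_phi mulf_neq0 ?A_neq0 // /line /coords inordK //=.
  by rewrite -msupp_eq0 msuppX.
split; last first.
  move=> i j; exists (p i *: 'X_j - p j *: 'X_i); rewrite !phi_projection -!mul_mpolyC; ring.
(* Composing with [phi] kills w and turns [phi_projection] into A^d phi_j = 0. *)
have key j : divides w (tnth phi j \mPo projection) -> tnth phi j = 0.
  rewrite phi_projection => -[q E]; apply/eqP.
  have := congr1 (comp_mpoly phi) E; rewrite comp_mpolyB comp_mpolyZ !rmorphM /= w_phi.
  rewrite scaler0 subr0 mulr0 comp_X pole_form_phi -/A => /eqP.
  by rewrite !mulf_eq0 expf_eq0 (negPf A_neq0) andbF.
have [B0|B0] := eqVneq B 0.
  exists ord0 => /key/eqP; rewrite phiE B0 scaler0 subr0 mulf_eq0 (negPf A_neq0) /line /=.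
  by rewrite /coords /= -msupp_eq0 msuppX.
exists (inord 2) => /key/eqP; rewrite phiE /line /coords inordK //= mulr0 sub0r oppr_eq0.
by rewrite scaler_eq0 (negPf p2) (negPf B0).
Qed.

End Member.

Section Trace.

Variables (P Q : {poly K}).
Hypotheses (PQ : on_graph d P Q) (Q0 : forall i, Q.[y i] != 0).
Let w := pole_form2 p d P Q.

Let sP : (size P <= d.+1)%N. Proof. by case: PQ. Qed.
Let sQ : (size Q <= d)%N. Proof. by case: PQ. Qed.

Let graph_point j : {poly K} := Q * coords 1 'X 0 j + (p j)%:P * - P.

(* Restriction to the curve, parametrised by the lines through p. *)
Definition trace f : {poly K} := mmap polyC graph_point f.

(** What remains of the trace after removal of the factor Q^(k(d-1)) that the multiplicity at p
    forces. *)
Definition residue (k : nat) (F : nat -> {poly K}) : {poly K} :=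
  \sum_(j < k.+1) (- P) ^+ j * (Q ^+ (k - j) * F j).

Let kd_split k : (k * d = k * d.-1 + k)%N.
Proof. by rewrite -mulnSr prednK. Qed.

Lemma trace_expansion k F : (forall j, (size (F j) <= (k * d).+1 - j)%N) ->
  trace (pole_expansion p k (k * d) F) = Q ^+ (k * d.-1) * residue k F.
Proof.
move=> sF; rewrite /trace (mmap_pole_expansion p2 (s := Q) (t := - P) (Y := 'X)) //.
rewrite /residue mulr_sumr; apply: eq_bigr => j _.
rewrite -/(F j \Po 'X) comp_polyXr kd_split -addnBA ?exprD; last by rewrite -ltnS.
ring.
Qed.

Lemma trace_dvd D k f i : f \is D.-homog -> low k (shift (x i) f) -> ('X - (y i)%:P) ^+ k %| trace f.
Proof.
(* At the parameter y_i the parametrisation takes the value [la] times the vector x_i; by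
   homogeneity this scalar can be pulled out. *)
move=> fD flow; pose la := Q.[y i] / s i.
have la0 : la != 0 by rewrite mulf_neq0 ?invr_eq0.
have graphE j : graph_point j = la%:P * (la^-1%:P * (graph_point j - (la * x i j)%:P) + (x i j)%:P).
  by rewrite mulrDr mulrA -!polyCM mulfV // mul1r subrK.
rewrite /trace (eq_mmap (h' := polyC) (q' := fun j => la%:P * (la^-1%:P * (graph_point j - (la * x i j)%:P) + (x i j)%:P))) //.
rewrite (mmap_homog _ _ _ fD) -mmap_shift dvdp_mull //.
apply: (low_mmap _ (dvdp_filtration ('X - (y i)%:P)) _ flow) => j.
rewrite expr1 dvdp_mull // dvdp_XsubCl; apply/rootP.
rewrite /graph_point !hornerE xE /la; have [_ _ /(_ i)/eqP] := PQ.
rewrite addr_eq0 => /eqP ->; have -> : (coords 1 'X 0 j).[y i] = coords 1 (y i) 0 j.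
  by move: j; apply: ord3P; rewrite /coords !inordK //= ?hornerX ?hornerC ?horner0.
rewrite /z; field; exact: s0.
Qed.

Lemma residue_size k F : (forall j, (size (F j) <= (k * d).+1 - j)%N) -> (size (residue k F) <= (k * N).+1)%N.
Proof.
move=> sF; apply: leq_trans (size_sum _ _ _) _; apply/bigmax_leqP => j _.
have jk : (j <= k)%N by rewrite -ltnS.
have sQ1 : (size Q <= d.-1.+1)%N by rewrite prednK.
have sP1 : (size (- P)%R <= d.+1)%N by rewrite size_polyN.
have := size_mul_bound (size_exp_bound j sP1) (size_mul_bound (size_exp_bound (k - j) sQ1) (sF j)).
move/leq_trans; apply.
have NE : N = (d.-1 + d)%N by move: Nd; rewrite -addnn -{1}(prednK d_gt0) addSn => -[].
by rewrite NE mulnDr subSn ?(leq_trans jk) ?leq_pmulr // !addnS residue_degree.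
Qed.

(* The residue has degree at most k N and a zero of order k at each y_i. *)
Lemma trace_system k f : in_multiple k f ->
  exists c, trace f = c *: (Q ^+ (k * d.-1) * (\prod_i ('X - (y i)%:P)) ^+ k).
Proof.
move=> [fD fp fx]; have [|F sF fE] := @pole_expansionP K p p2 k (k * d) (k * d.-1) f fD fp.
  by rewrite -kd_split.
have traceE := trace_expansion sF; rewrite -fE in traceE.
pose M := \prod_(a <- [seq y i | i <- enum 'I_N]) ('X - a%:P).
have MD : M ^+ k %| residue k F.
  apply: prod_XsubC_dvd; first by rewrite map_inj_uniq ?enum_uniq.
  move=> _ /mapP[i _ ->]; have := trace_dvd fD (fx i); rewrite traceE Gauss_dvdpr //.
  by rewrite coprimep_expl // coprimep_expr // coprimep_sym coprimep_XsubC; apply/rootP/eqP.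
have Mm : M ^+ k \is monic by apply: monic_exp; apply: monic_prod_XsubC.
have sM : size (M ^+ k) = (k * N).+1.
  have := size_exp M k; rewrite size_prod_XsubC size_map size_enum_ord /= [(N * k)%N]mulnC => <-.
  by rewrite prednK // lt0n size_poly_eq0 monic_neq0.
have := monic_multiple Mm _ MD; rewrite sM => /(_ (residue_size sF)) resE.
by exists (residue k F)`_(k * N); rewrite traceE scalerAr /M big_map big_enum in resE *; rewrite -resE.
Qed.

(* Modulo w, zeta A = - B turns A^k f into the binary form of the residue of f. *)
Lemma trace_eq0 k f : f \is (k * d).-homog -> low (k * d.-1) (shift p f) -> trace f = 0 -> rdvd w f.
Proof.
move=> fD fp f0; have [|F sF fE] := @pole_expansionP K p p2 k (k * d) (k * d.-1) f fD fp.
  by rewrite -kd_split.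
have res0 : residue k F = 0.
  apply/eqP; have /eqP := f0; rewrite fE trace_expansion // mulf_eq0 expf_eq0.
  by rewrite (negPf (member_slope_neq0 Q0)) andbF.
pose A := pole_form p d.-1 Q; pose B := pole_form p d P.
have wE : zeta p * A - - B = w by rewrite opprK addrC.
have zAB j : rdvd w ((zeta p * A) ^+ j - (- B) ^+ j).
  by rewrite subrXX wE; eexists; apply: mulrC.
have sQ1 : (size Q <= d.-1.+1)%N by rewrite prednK.
have sP1 : (size (- P)%R <= d.+1)%N by rewrite size_polyN.
have formN : pole_form p d (- P) = - B by rewrite -scaleN1r /pole_form binary_formZ scaleN1r.
have termE (j : 'I_k.+1) : (- B) ^+ j * (A ^+ (k - j) * pole_form p (k * d - j) (F j))
    = pole_form p (k * d.-1 + k * d) ((- P) ^+ j * (Q ^+ (k - j) * F j)).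
  have jk : (j <= k)%N by rewrite -ltnS.
  have jkd : (j <= k * d)%N by rewrite (leq_trans jk) // leq_pmulr.
  have -> : (k * d.-1 + k * d = j * d + ((k - j) * d.-1 + (k * d - j)))%N.
    exact/esym/residue_degree.
  have sFj : (size (F j) <= (k * d - j).+1)%N by rewrite -subSn.
  rewrite pole_formM ?size_exp_bound // ?pole_formM ?pole_formX ?formN // ?size_exp_bound //.
  by rewrite -addnS; apply: size_mul_bound => //; apply: size_exp_bound.
have sum0 : \sum_(j < k.+1) (- B) ^+ j * (A ^+ (k - j) * pole_form p (k * d - j) (F j)) = 0.
  rewrite (eq_bigr _ (fun j _ => termE j)) /pole_form.
  rewrite -(big_morph _ (binary_formD _ _ _) (binary_form0 _ _ _)).
  by rewrite -/(residue k F) res0 binary_form0.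
have Af : rdvd w (A ^+ k * f).
  have -> : A ^+ k * f = \sum_(j < k.+1)
      ((zeta p * A) ^+ j - (- B) ^+ j) * (A ^+ (k - j) * pole_form p (k * d - j) (F j)).
    rewrite -[LHS]subr0 -[X in _ - X]sum0 fE /pole_expansion mulr_sumr -sumrB.
    apply: eq_bigr => j _; rewrite mulrBl; congr (_ - _).
    have -> : A ^+ k = A ^+ j * A ^+ (k - j) by rewrite -exprD subnKC // -ltnS.
    by rewrite exprMn; ring.
  by apply: rdvd_sum => j _; apply: rdvdMr.
have wprime := member_prime PQ Q0.
have [_ _ wsplit] := wprime.
(* At a base point w vanishes, whereas A does not since Q is nonzero there. Hence the prime w can be
   moved from A^k f to f. *)
have nA : ~ rdvd w A.
  move=> [q /(congr1 (mmap idfun (x (Ordinal N_gt0))))]; rewrite rmorphM /= (member_eval PQ) mulr0.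
  have -> : A = pole_form2 p d.-1 Q 0 by rewrite /pole_form2 /pole_form binary_form0 mulr0 addr0.
  rewrite eval_pole_form2 ?size_poly0 // horner0 mulr0 addr0 => /eqP.
  by rewrite mulf_eq0 expf_eq0 (negPf (s0 _)) andbF (negPf (Q0 _)).
elim: k Af {fD fp f0 F sF fE res0 termE sum0} => [|k IH]; first by rewrite mul1r.
by rewrite exprS -mulrA => /wsplit[|].
Qed.

Lemma trace_linear c f g : trace (f - c *: g) = trace f - c *: trace g.
Proof. by rewrite /trace mmapB mmapZ mul_polyC. Qed.

(* The derivative of the equation along the line through p is s^(d-1) Q(y_i). *)
Lemma member_simple i : ~ low 2 (shift (x i) w).
Proof.
move=> w2; pose q j : {poly K} := (s i)%:P * coords 1 (y i)%:P 0 j + (p j)%:P * ((t i)%:P + 'X).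
have qE : q =1 (fun j => (p j)%:P * 'X + (x i j)%:P).
  move=> j; rewrite /q xE polyCD !polyCM mulrDr [RHS]addrC addrA; congr (_ + _ + _); congr (_ * _).
  by move: j; apply: ord3P; rewrite /coords !inordK.
have := low_mmap polyC (dvdp_filtration ('X : {poly K})) (q := fun j => (p j)%:P * 'X) _ w2.
rewrite mmap_shift -(eq_mmap w (fun=> erefl) qE) => /(_ _)/dvdpP[] => [j|r E].
  by rewrite expr1 dvdp_mulIr.
have := congr1 (coefp 1) E; rewrite /= coefMXn /= /w -(@pole_expansion1 _ p d (nth 0 [:: P; Q])).
rewrite (mmap_pole_expansion p2 (s := (s i)%:P) (t := (t i)%:P + 'X) (Y := (y i)%:P)) => [|j|j]; last by [].
  rewrite big_ord_recl big_ord1 /= mul1r subn0 expr1 !horner_map /= -!rmorphXn -!rmorphM /=.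
  rewrite coefD coefC /= add0r coefMC coefD coefC coefX /= add0r mul1r => /eqP.
  by rewrite mulf_eq0 expf_eq0 (negPf (s0 _)) andbF (negPf (Q0 _)).
exact: size_nth2.
Qed.

Lemma member_not_cone : ~ low d (shift p w).
Proof.
move=> wcone; have [R sR wR] := (cone p2 d w).1 (conj (member_homog PQ) wcone).
have [] := pole_form2_eq p2 sP sQ sR (_ : (size (0 : {poly K})%R <= d)%N).
- by rewrite size_poly0.
- by rewrite -/w wR /pole_form2 /pole_form binary_form0 mulr0 addr0.
by move=> _ /eqP; rewrite (negPf (member_slope_neq0 Q0)).
Qed.

End Trace.

Lemma multiple0 k : in_multiple k 0.
Proof.
have l0 n mu (q : 'I_n -> K) : low mu (shift q 0) by move=> m _; rewrite /shift mmap0 mcoeff0.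
by split; [exact: rpred0 | exact: l0 | move=> i; exact: l0].
Qed.

Lemma multiple_linear k c f g : in_multiple k f -> in_multiple k g -> in_multiple k (c *: f + g).
Proof.
have lowD mu (q : 'I_3 -> K) (h h' : {mpoly K[3]}) : low mu (shift q h) -> low mu (shift q h') ->
    low mu (shift q (c *: h + h')).
  have filL := low_filtration 3 K; have [_ _ ID _ _] := filL.
  move=> lh lh'; rewrite /shift mmapD mmapZ; apply: ID; [apply: (filtrationMl filL); exact: lh | exact: lh'].
move=> [fD fp fx] [gD gp gx]; split; [by rewrite rpredD ?rpredZ | exact: (lowD _ _ _ _ fp gp) |].
by move=> i; apply: (lowD _ _ _ _ (fx i) (gx i)).
Qed.

Lemma multipleM k l f g : in_multiple k f -> in_multiple l g -> in_multiple (k + l) (f * g).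
Proof.
have lowM mu nu (q : 'I_3 -> K) (h h' : {mpoly K[3]}) : low mu (shift q h) -> low nu (shift q h') ->
    low (mu + nu) (shift q (h * h')).
  by move=> lh lh'; rewrite /shift rmorphM; case: (low_filtration 3 K) => _ _ _ IM _; apply: IM.
move=> [fD fp fx] [gD gp gx]; rewrite /in_multiple !mulnDl.
split; [exact: dhomogM | exact: (lowM _ _ _ _ _ fp gp) | move=> i].
exact: (lowM _ _ _ _ _ (fx i) (gx i)).
Qed.

Lemma multipleX k f : in_multiple 1 f -> in_multiple k (f ^+ k).
Proof.
move=> f1; elim: k => [|k IH]; last by rewrite exprS -add1n; apply: multipleM.
split; [by rewrite dhomog1 | |move=> i]; by case: (low_filtration 3 K).
Qed.

Section Pair.

Variables P1 Q1 P2 Q2 : {poly K}.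
Hypotheses (PQ1 : on_graph d P1 Q1) (PQ2 : on_graph d P2 Q2) (Q1_neq0 : forall i, Q1.[y i] != 0).
Hypothesis PQ_free : forall a b : K, a *: P1 + b *: P2 = 0 -> a *: Q1 + b *: Q2 = 0 -> a = 0 /\ b = 0.
Hypothesis PQ_span : forall P Q, on_graph d P Q ->
  exists a b : K, P = a *: P1 + b *: P2 /\ Q = a *: Q1 + b *: Q2.

Let w := pole_form2 p d P1 Q1.
Let v := pole_form2 p d P2 Q2.

Lemma pair_free a b : a *: w + b *: v = 0 -> a = 0 /\ b = 0.
Proof.
have [sP sQ _] := on_graphD a b PQ1 PQ2.
by rewrite -pole_form2_linear => /(pole_form2_inj p2 sP sQ)[]; apply: PQ_free.
Qed.

Lemma pair_pencil f : f != 0 /\ in_multiple 1 f <-> in_pencil w v f.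
Proof.
split=> [[f0 /in_multiple1[P [Q [/PQ_span[a [b [-> ->]]] fE]]]] | [f0 [a [b fE]]]].
  by split=> //; exists a, b; rewrite fE pole_form2_linear.
split=> //; apply/in_multiple1; exists (a *: P1 + b *: P2), (a *: Q1 + b *: Q2).
by split; [exact: on_graphD | rewrite pole_form2_linear].
Qed.

Lemma v_in_system : in_multiple 1 v.
Proof. by apply/in_multiple1; exists P2, Q2. Qed.

(** As w is prime it would divide v, which has the same degree, so v would be a scalar multiple of
    w. *)
Lemma pair_not_dvd k : ~ rdvd w (v ^+ k).
Proof.
have [w0 nw wsplit] := member_prime PQ1 Q1_neq0.
elim: k => [|k IH].
  by case=> q /esym q1; case/negP: nw; apply/unitrP; exists q; rewrite [w * q]mulrC q1.
rewrite exprS => /wsplit[[q vE]|//].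
have vn : q * w != 0.
  by rewrite -vE; apply/eqP => v0; have [|_ /eqP] := @pair_free 0 1; rewrite ?v0 ?scaler0 ?scale0r ?addr0 ?oner_eq0.
have [vd _ _] := v_in_system; rewrite mul1n vE in vd.
have [a [b [ab qa wb]]] := homog_factor vn vd.
have b_d := dhomog_uniq w0 (member_homog PQ1) wb.
have a0 : a = 0%N by lia.
have [c qc] : exists c, q = c%:MP.
  exists q@_0; apply/mpolyP => m; rewrite mcoeffC; have [->|m0] := eqVneq 0%MM m; first by rewrite mulr1.
  by rewrite mulr0 (dhomog_nemf_coeff qa) //= a0 mdeg_eq0 eq_sym.
have [|_ /eqP] := @pair_free (- c) 1; last by rewrite oner_eq0.
by rewrite scale1r vE qc mul_mpolyC scaleNr addNr.
Qed.

(* Some f - c v^k has trace 0, and its quotient by w is a member for k - 1. *)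
Lemma pair_power k f : f != 0 /\ in_multiple k f <-> in_power w v k f.
Proof.
split=> [[f0 fk]|[f0 [P fE]]]; split=> //; last first.
  rewrite fE /binary_form; apply: (big_ind (in_multiple k)) => [|g h gk hk|i _].
  - exact: multiple0.
  - by rewrite -[g]scale1r; apply: multiple_linear.
  rewrite -[_ *: _]addr0; apply: multiple_linear; last exact: multiple0.
  rewrite -[k in in_multiple k _](subnKC (ltn_ord i : (i <= k)%N)).
  by apply: multipleM; apply: multipleX; [exact: member_in_system | exact: v_in_system].
elim: k f fk {f0} => [|k IH] f fk.
  have [fD _ _] := fk; exists (f@_0)%:P.
  rewrite /binary_form big_ord1 coefC mulr1 /=; apply/mpolyP => m.
  have [->|m0] := eqVneq m 0%MM; first by rewrite mcoeffZ mcoeff1 eqxx mulr1.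
  by rewrite mcoeffZ mcoeff1 (negPf m0) mulr0 (dhomog_nemf_coeff fD) //= mul0n mdeg_eq0.
have [c fc] := trace_system PQ1 Q1_neq0 fk.
have [c' vc] := trace_system PQ1 Q1_neq0 (multipleX k.+1 v_in_system).
have c'0 : c' != 0.
  apply/eqP => c'0; apply: (@pair_not_dvd k.+1).
  have [vD vp _] := multipleX k.+1 v_in_system; apply: (trace_eq0 PQ1 Q1_neq0 vD vp).
  by rewrite vc c'0 scale0r.
pose g := f - (c / c') *: v ^+ k.+1.
have gk : in_multiple k.+1 g.
  rewrite /g addrC -scaleNr; apply: multiple_linear; [exact/multipleX/v_in_system | exact: fk].
have [q gE] : rdvd w g.
  have [gD gp _] := gk; apply: (trace_eq0 PQ1 Q1_neq0 gD gp).
  by rewrite trace_linear fc vc scalerA divfK // subrr.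
have fE : f = g + (c / c') *: v ^+ k.+1 by rewrite subrK.
have [q0|q0] := eqVneq q 0.
  exists (c / c')%:P; rewrite fE gE q0 mul0r add0r.
  by rewrite -alg_polyC binary_formZ binary_form1.
(* At p and at the x_i the member w has multiplicity exactly d - 1 and 1, so division by w lowers
   the multiplicities of g by no more than that. *)
have qk : in_multiple k q.
  have [gD gp gx] := gk; have qw0 : q * w != 0 by rewrite mulf_neq0 ?(member_neq0 PQ1).
  have [a [b [abd qa wb]]] := homog_factor qw0 (eq_ind _ (fun h => h \is (k.+1 * d).-homog) gD _ gE).
  have wD := member_homog PQ1; have bd := dhomog_uniq (member_neq0 PQ1 Q1_neq0) wD wb.
  have akd : a = (k * d)%N by apply: (@addIn d); rewrite -mulSnr -abd bd.
  have wq mu (r : 'I_3 -> K) : low mu (shift r g) -> low mu (shift r w * shift r q).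
    by rewrite gE /shift mulrC rmorphM.
  split; first by rewrite -akd.
    apply: (@low_div _ _ d.-1 _ (shift p w)); last by rewrite prednK //; apply: member_not_cone.
    exact: (wq _ _ gp).
  move=> i; apply: (@low_div _ _ 1 _ (shift (x i) w)); last exact: member_simple.
  exact: (wq _ _ (gx i)).
have [R qR] : exists R, q = binary_form w v k R by apply: IH.
exists ('X * R + (c / c')%:P); rewrite fE gE qR binary_formD binary_formMX mulrC.
by rewrite -alg_polyC binary_formZ binary_form1.
Qed.

(** The member with parameter t is rational as soon as its slope is nonzero at every y_i. These are
    finitely many linear conditions on t, and the parameter (0:1), which gives w, satisfies them. *)
Lemma pair_rational L : (forall f, L f <-> f != 0 /\ in_multiple 1 f) -> pencil_of_rational_curves L.
Proof.
move=> LE; have wd := member_homog PQ1; have vd : v \is d.-homog by have [] := v_in_system; rewrite mul1n.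
pose X := [tuple DHomog (power_homog wd vd (ltn_ord i)) | i < 2].
exists (d * 1)%N, X; split.
  apply: (@power_basis _ d w v pair_free 1) => [i | f]; first by rewrite tnth_mktuple.
  by rewrite LE pair_pencil in_power1.
have t0 : \row_(j < 2) (j == ord_max)%:R != 0 :> 'rV[K]_2.
  by apply/eqP => /rowP/(_ ord_max)/eqP; rewrite !mxE oner_eq0.
pose T (_ : 'I_1) : point K 1 := exist (fun r => is_true (r != 0)) _ t0.
apply: (@for_general_near _ _ _ T).
apply: (@general_near_imp _ _ _ _ (fun t : 'I_1 -> point K 1 =>
    forall i, Q2.[y i] * hcoord (t ord0) ord0 + Q1.[y i] * hcoord (t ord0) ord_max != 0)); last first.
  apply: general_near_forall => i; apply: general_linear.
  by rewrite /hcoord /= !mxE mulr0 mulr1 add0r.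
move=> r rQ; rewrite big_ord_recl big_ord1 !tnth_mktuple /=.
rewrite -[_ + _]addrC; have -> : lift ord0 ord0 = ord_max :> 'I_2 by apply: val_inj.
rewrite !expr0 !expr1 mulr1 mul1r -pole_form2_linear.
apply: member_rational; first exact: on_graphD.
by move=> i; rewrite hornerD !hornerZ addrC mulrC [X in _ + X]mulrC.
Qed.

End Pair.

Lemma pencil_structure k L1 L : (forall f, L1 f <-> f != 0 /\ in_multiple 1 f) ->
  (forall f, L f <-> f != 0 /\ in_multiple k f) ->
  [/\ pencil_of_rational_curves L1, composed_with L L1, has_dimension L k & no_foreign_components L L1].
Proof.
move=> L1E LE; have [P1 [Q1 [P2 [Q2 [PQ1 PQ2 Q1_neq0 PQ_free PQ_span]]]]] := graph_pencil Nd y_inj no_smaller.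
have vd : pole_form2 p d P2 Q2 \is d.-homog by have [] := v_in_system PQ2; rewrite mul1n.
have [] := power_of_pencil (member_homog PQ1) vd (pair_free PQ1 PQ2 PQ_free) (k := k) (L := L) (P := L1).
- by move=> f; rewrite L1E; apply: pair_pencil.
- by move=> f; rewrite LE; apply: pair_power.
by split=> //; apply: (pair_rational PQ1 PQ2).
Qed.

End Pencil.

(** * Special positions and conclusion *)

Section Pull.

Variables (M N : nat) (g : 'I_M -> 'I_N).
Hypothesis g_inj : injective g.

(** Extends a special configuration along the injection g, with a at the remaining places, so that
    openness for some of the points gives openness for all of them. *)
Definition pull (A : Type) (a : A) (q : 'I_M -> A) (i' : 'I_N) : A :=
  if [pick i | g i == i'] is Some i then q i else a.

Lemma pullK (A : Type) (a : A) q i : pull a q (g i) = q i.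
Proof.
by rewrite /pull; case: pickP => [j /eqP/g_inj -> //|/(_ i)]; rewrite eqxx.
Qed.

Lemma only_zero_near_pull (K : fieldType) D (mu : 'I_M -> nat) kill (a : point K 2) (q : 'I_M -> point K 2) :
  only_zero D mu kill q ->
  general_near (pull a q) (fun p => only_zero D mu kill (fun i => p (g i))).
Proof.
have iff (p : 'I_N -> point K 2) : only_zero D (pull 0%N mu) kill p <-> only_zero D mu kill (fun i => p (g i)).
  split=> p0 f [fD fkill flow]; apply: p0; split; [exact: fD | exact: fkill | move=> i | exact: fD | exact: fkill | move=> i].
    rewrite /pull; case: pickP => [j /eqP <-|_]; first exact: flow.
    by case: (low_filtration 3 K).
  by have := flow (g i); rewrite pullK.
move=> q0; have : general_near (pull a q) (@only_zero N D (pull 0%N mu) kill K).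
  apply: only_zero_near; have [_ imp] := iff (pull a q); apply: imp => f [fD fkill flow].
  apply: q0; split; [exact: fD | exact: fkill | move=> i].
  by have := flow i; rewrite pullK.
by apply: general_near_imp => p /iff.
Qed.

End Pull.

Lemma linear_form (K : fieldType) n (f : {mpoly K[n]}) : f \is 1.-homog -> f = \sum_j f@_U_(j) *: 'X_j.
Proof.
move=> f1; apply/mpolyP => m; rewrite (raddf_sum (mcoeff m)) /=.
under eq_bigr => j _ do rewrite mcoeffZ mcoeffX.
have [/eqP/mdeg1P[j /eqP ->]|m1] := eqVneq (mdeg m) 1%N.
  rewrite (bigD1 j) //= eqxx mulr1 big1 ?addr0 // => i ij.
  by rewrite eq_mnm1 (negPf ij) mulr0.
rewrite (dhomog_nemf_coeff f1) // big1 // => j _.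
have -> : (U_(j)%MM == m) = false by apply: contraNF m1 => /eqP <-; rewrite mdeg1.
by rewrite mulr0.
Qed.

Lemma sum_ring_ord3 (V : nmodType) (F : 'I_3 -> V) :
  \sum_j F j = F (inord 0) + F (inord 1) + F (inord 2).
Proof.
by rewrite !big_ord_recl big_ord0 addr0 addrA; congr (F _ + F _ + F _);
  apply: val_inj; rewrite /= inordK.
Qed.

Lemma linear_form_eval (K : fieldType) (q : 'I_3 -> K) f : f \is 1.-homog -> mmap idfun q f =
  f@_U_(inord 0) * q (inord 0) + f@_U_(inord 1) * q (inord 1) + f@_U_(inord 2) * q (inord 2).
Proof.
move=> /linear_form {1}->; rewrite (rmorph_sum (mmap idfun q)) /=.
rewrite -(sum_ring_ord3 (fun j => f@_U_(j) * q j)).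
by apply: eq_bigr => j _; rewrite mmapZ mmapX mmap1U.
Qed.

Lemma linear_form_eq0 (K : fieldType) (f : {mpoly K[3]}) : f \is 1.-homog ->
  f@_U_(inord 0) = 0 -> f@_U_(inord 1) = 0 -> f@_U_(inord 2) = 0 -> f = 0.
Proof.
move=> /linear_form fE f0 f1 f2; rewrite fE big1 // => j _.
suff -> : f@_U_(j) = 0 by rewrite scale0r.
by move: j; apply: ord3P.
Qed.

Lemma eval_psi (K : fieldType) (p q : 'I_3 -> K) j :
  mmap idfun q (psi p j) = q j - p j * (q (inord 2) / p (inord 2)).
Proof.
by rewrite /psi /zeta mmapB !mmapZ !mmapX !mmap1U /= [_^-1 * _]mulrC.
Qed.

(** * A special configuration for xi_{d,1} *)

Section SpecialPoints.

Variables (K : numClosedFieldType) (d : nat).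
Hypothesis d0 : (0 < d)%N.
Implicit Types (i j : 'I_(npoints d 1)).

(* Through p_0 = (0:0:1) pass the lines X_1 = i X_0, and p_i is the point of   *)
(* height 0 or 1 on the i-th one.                                             *)
Definition special_point i : point K 2 :=
  if i == ord0 then vertex K else affine_point i%:R (if (i <= d)%N then 0 else 1).

Lemma special_vertex c : hcoord (special_point ord0) c = coords 0 0 1 c.
Proof. by rewrite /special_point eqxx hcoord_vertex. Qed.

Lemma special_affine i c : i != ord0 ->
  hcoord (special_point i) c = coords 1 i%:R (if (i <= d)%N then 0 else 1) c.
Proof. by move=> /negPf i0; rewrite /special_point i0 hcoord_affine_point. Qed.

(** Applied to the line [psi] 0, which has no X_1 term, this openness condition will give s_i
    nonzero at general points. *)
Lemma special_no_vertical i : i != ord0 ->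
  only_zero 1 (fun l => (l == ord0) || (l == i) : nat) (pred1 U_(inord 1)%MM) special_point.
Proof.
move=> i0 f [f1 fkill flow]; have f10 := fkill _ (eqxx _).
have /low1_eval := flow ord0; rewrite linear_form_eval // !special_vertex /coords !inordK //=.
rewrite !mulr0 !add0r mulr1 => f20.
have := flow i; rewrite eqxx orbT => /low1_eval; rewrite linear_form_eval // f10 f20 !special_affine //.
by rewrite !mul0r !addr0 /coords inordK //= mulr1 => f00; apply: linear_form_eq0.
Qed.

(** No line through p_0 contains two of the other points; at general points this makes the y_i
    distinct. *)
Lemma special_separated i j : i != ord0 -> j != ord0 -> i != j ->
  only_zero 1 (fun l => [|| l == ord0, l == i | l == j] : nat) pred0 special_point.
Proof.
move=> i0 j0 ij f [f1 _ flow].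
have /low1_eval := flow ord0; rewrite linear_form_eval // !special_vertex /coords !inordK //=.
rewrite !mulr0 !add0r mulr1 => f20.
have := flow i; rewrite eqxx orbT => /low1_eval; rewrite linear_form_eval // f20 !special_affine //.
rewrite mul0r addr0 /coords !inordK //= mulr1 => /eqP; rewrite addr_eq0 => /eqP f0i.
have := flow j; rewrite eqxx !orbT => /low1_eval; rewrite linear_form_eval // f20 !special_affine //.
rewrite mul0r addr0 /coords !inordK //= mulr1 f0i addrC -mulrBr => /eqP.
rewrite mulf_eq0 subr_eq0 Num.Theory.eqr_nat (inj_eq val_inj) [_ == i]eq_sym (negPf ij) orbF => /eqP f10.
by apply: linear_form_eq0; rewrite // f0i f10 mul0r oppr0.
Qed.

Definition smaller_mult i : nat := if i == ord0 then d.-2 else 1%N.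

(** In the form P + zeta Q of degree d - 1, the d points of height 0 are too many zeros for P, which
    vanishes; then the d - 1 points of height 1 are too many zeros for Q. *)
Lemma special_no_smaller : only_zero d.-1 smaller_mult pred0 special_point.
Proof.
move=> f [fD _ flow]; pose h : 'I_3 -> K := hcoord (special_point ord0).
have h2 : h (inord 2) != 0 by rewrite /h special_vertex /coords inordK //= oner_eq0.
have fp : low d.-1.-1 (shift h f) by have := flow ord0; rewrite /smaller_mult eqxx.
have [P [Q [sP sQ fE]]] := (near_cone h2 d.-1 f).1 (conj fD fp).
pose x (i : 'I_(1 * (2 * d - 1))) := hcoord (special_point (lift ord0 i)).
pose z (i : 'I_(1 * (2 * d - 1))) : K := if (i < d)%N then 0 else 1.
pose y (i : 'I_(1 * (2 * d - 1))) : K := i.+1%:R.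
have xE (l : 'I_(1 * (2 * d - 1))) c : x l c = 1 * coords 1 (y l) 0 c + h c * z l.
  rewrite /x /h special_affine // special_vertex mul1r /y /z.
  by move: c; apply: ord3P; rewrite /coords !inordK //= ?mul0r ?mul1r ?addr0 ?add0r.
have [_ _ PQ] : on_graph y (fun l => z l / 1) d.-1 P Q.
  apply/(on_graph_form h2 xE (fun=> oner_neq0 _) sP sQ) => i; rewrite -fE.
  by have := flow (lift ord0 i); rewrite /smaller_mult.
have vanish (R : {poly K}) a n : (size R <= n)%N -> (forall r, (a <= r < a + n)%N -> R.[r.+1%:R] = 0) -> R = 0.
  move=> sR R0; apply: (@roots_geq_poly_eq0 _ _ [seq r.+1%:R | r <- iota a n]).
  - by rewrite all_map; apply/allP => r; rewrite mem_iota => ar; apply/rootP/R0.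
  - rewrite map_inj_uniq ?iota_uniq // => r r' /eqP.
    by rewrite Num.Theory.eqr_nat eqSS => /eqP.
  by rewrite size_map size_iota.
have PQi r : (r < 2 * d - 1)%N -> P.[r.+1%:R] + (if (r < d)%N then 0 else 1) * Q.[r.+1%:R] = 0.
  rewrite -[(2 * d - 1)%N]mul1n => iN; have := PQ (Ordinal iN).
  by rewrite /y /z /= divr1.
have P0 : P = 0.
  apply: (vanish _ 0%N d); first by rewrite -(prednK d0).
  move=> i /andP[_ id]; have := PQi i; rewrite id mul0r addr0; apply; lia.
have Q0 : Q = 0.
  apply: (vanish _ d d.-1) => // i /andP[di id]; have := PQi i.
  by rewrite P0 horner0 add0r [(i < d)%N]ltnNge di /= mul1r; apply; lia.
by rewrite fE P0 Q0 /pole_form2 /pole_form !binary_form0 mulr0 addr0.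
Qed.

End SpecialPoints.

Lemma multiple_xi_in_system (K : fieldType) k d m (p : 'I_(npoints d m) -> point K 2) f :
  multiple_xi k p f <->
  f != 0 /\ in_system (k * d) (fun i => k * xi_mult i)%N pred0 (fun i => hcoord (p i)) f.
Proof.
split=> [[f0 fD fp] | [f0 [fD _ fp]]]; split=> //.
  by split=> // i; apply/(mult_ge_shift _ _ fD).
by move=> i; apply/(mult_ge_shift _ _ fD).
Qed.

Lemma xi_multiple1 (K : fieldType) d m (p : 'I_(npoints d m) -> point K 2) f :
  xi p f <-> multiple_xi 1 p f.
Proof.
rewrite /multiple_xi /xi /plane_system mul1n; split=> -[f0 fD fp]; split=> // i.
  by rewrite mul1n; apply: fp.
by have := fp i; rewrite mul1n.
Qed.

Section PencilAtPoints.

Variables (K : numClosedFieldType) (d : nat) (q : 'I_(npoints d 1) -> point K 2).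
Hypothesis d0 : (0 < d)%N.
Let h : 'I_3 -> K := hcoord (q ord0).
Let x (l : 'I_(1 * (2 * d - 1))) : 'I_3 -> K := hcoord (q (lift ord0 l)).
Hypothesis h2 : h (inord 2) != 0.
Hypothesis no_vertical : forall i, i != ord0 ->
  only_zero 1 (fun l => (l == ord0) || (l == i) : nat) (pred1 U_(inord 1)%MM) q.
Hypothesis separated : forall i j, i != ord0 -> j != ord0 -> i != j ->
  only_zero 1 (fun l => [|| l == ord0, l == i | l == j] : nat) pred0 q.
Hypothesis smaller : only_zero d.-1 (@smaller_mult d) pred0 q.

Let t l : K := x l (inord 2) / h (inord 2).
Let s l : K := mmap idfun (x l) (psi h (inord 0)).
Let y l : K := mmap idfun (x l) (psi h (inord 1)) / s l.

Let low_at (f : {mpoly K[3]}) (b : bool) r : (b -> low 1 (shift r f)) -> low b (shift r f).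
Proof. by case: b => [H|_]; [exact: H | case: (low_filtration 3 K)]. Qed.

Lemma base_line_not_vertical l : s l != 0.
Proof.
apply/eqP => s0; have l0 : lift ord0 l != ord0 by rewrite eq_sym neq_lift.
have : psi h (inord 0) = 0.
  apply: (no_vertical l0); split.
  - exact: psi_homog.
  - move=> _ /eqP ->; rewrite mcoeffB !mcoeffZ !mcoeffX !eq_mnm1 -!val_eqE /= !inordK //=.
    by rewrite !mulr0 subrr.
  move=> i; apply: low_at => /orP[/eqP -> | /eqP ->]; first exact: low_psi.
  exact/low1_eval.
move=> psi0; have [|_ /eqP] := psi_free h2 (a := 0) (b := 1); last by rewrite oner_eq0.
by rewrite psi0 scaler0 scale0r addr0.
Qed.

Lemma base_coords l c : x l c = s l * coords 1 (y l) 0 c + h c * t l.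
Proof.
have s0 := base_line_not_vertical l.
move: c; apply: ord3P; rewrite /coords !inordK //= ?mulr1 ?mulr0 ?add0r.
- by rewrite /s eval_psi subrK.
- by rewrite /y mulrC divfK // eval_psi subrK.
by rewrite /t mulrC divfK.
Qed.

Lemma base_lines_distinct : injective y.
Proof.
move=> l l' yE; apply/eqP; apply: contraT => ll'.
have l0 (r : 'I_(1 * (2 * d - 1))) : lift ord0 r != ord0 by rewrite eq_sym neq_lift.
have : psi h (inord 1) - y l *: psi h (inord 0) = 0.
  have vanish r : y r = y l -> low 1 (shift (x r) (psi h (inord 1) - y l *: psi h (inord 0))).
    move=> yr; apply/low1_eval; rewrite mmapB mmapZ -/(s r) -yr /y divfK ?subrr //.
    exact: base_line_not_vertical.
  apply: (separated (l0 l) (l0 l')).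
    by rewrite (inj_eq lift_inj).
  split=> // [|i]; first by rewrite rpredB ?rpredZ ?psi_homog.
  apply: low_at => /or3P[] /eqP ->; [|exact: vanish | exact: vanish].
  have filL := low_filtration 3 K; rewrite /shift mmapB mmapZ; apply: (filtrationB filL).
    exact: low_psi.
  exact/(filtrationMl filL)/low_psi.
have := psi_free h2 (a := 1) (b := - y l); rewrite scale1r scaleNr => E /E[/eqP].
by rewrite oner_eq0.
Qed.

Lemma no_smaller_graph P Q : on_graph y (fun l => t l / s l) d.-1 P Q -> P = 0 /\ Q = 0.
Proof.
move=> PQ; have [sP sQ _] := PQ; apply: (pole_form2_inj h2 sP sQ); apply: smaller.
have [|fD fp] := (near_cone h2 d.-1 (pole_form2 h d.-1 P Q)).2; first by exists P, Q.
split; [exact: fD | by [] | move=> i]; rewrite /smaller_mult; case: (unliftP ord0 i) => [l ->|->]; last by rewrite eqxx.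
rewrite eq_sym (negPf (neq_lift _ _)) -/(x l).
by move: l; apply/(on_graph_form h2 base_coords base_line_not_vertical sP sQ).
Qed.

Lemma xi_in_multiple k f : multiple_xi k q f <-> f != 0 /\ in_multiple d h x k f.
Proof.
rewrite multiple_xi_in_system; split=> -[f0]; [case=> fD _ fp | case=> fD fh fx]; split=> //.
  split; first exact: fD.
    by have := fp ord0; rewrite /xi_mult eqxx subn1.
  by move=> l; have := fp (lift ord0 l); rewrite /xi_mult muln1.
split; [exact: fD | by [] | move=> i]; rewrite /xi_mult; case: (unliftP ord0 i) => [l ->|->].
  by rewrite muln1; apply: fx.
by rewrite eqxx subn1.
Qed.

Lemma pencil_at k L1 L : (forall f, L1 f <-> xi q f) -> (forall f, L f <-> multiple_xi k q f) ->
  [/\ pencil_of_rational_curves L1, composed_with L L1, has_dimension L k & no_foreign_components L L1].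
Proof.
move=> L1E LE; have Nd : (1 * (2 * d - 1)).+1 = d.*2 by lia.
apply: (pencil_structure h2 base_coords base_line_not_vertical Nd base_lines_distinct no_smaller_graph) => f.
  by rewrite L1E xi_multiple1 xi_in_multiple.
by rewrite LE xi_in_multiple.
Qed.

End PencilAtPoints.

Lemma general_near_const (K : fieldType) N r (p0 : 'I_N -> point K r) (Q : Prop) : Q -> general_near p0 (fun=> Q).
Proof.
exists 1; split=> //; first by exists (fun=> 0%N); apply: homogeneous_ofC.
by rewrite /eval_at rmorph1 oner_neq0.
Qed.

Lemma general_near_if (K : fieldType) N r (p0 : 'I_N -> point K r) (B : Prop) Q :
  (B -> general_near p0 Q) -> general_near p0 (fun p => B -> Q p).
Proof.
have [b|nb] := classic B; first by move/(_ b); apply: general_near_imp.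
by move=> _; apply: (general_near_imp (Q1 := fun=> True)) => //; apply: general_near_const.
Qed.

(** The injection g and the abstract systems L1, L let the same lemma serve xi_{d,1}, with g the
    identity, and xi_{2,2}, where g forgets p_0. *)
Lemma pencil_near (K : numClosedFieldType) k d N (g : 'I_(npoints d 1) -> 'I_N) : (0 < d)%N -> injective g ->
  general_near (pull g (vertex K) (@special_point K d)) (fun p => forall L1 L,
    (forall f, L1 f <-> xi (fun i => p (g i)) f) -> (forall f, L f <-> multiple_xi k (fun i => p (g i)) f) ->
    [/\ pencil_of_rational_curves L1, composed_with L L1, has_dimension L k & no_foreign_components L L1]).
Proof.
move=> d0 g_inj; set p0 := pull _ _ _.
have near1 : general_near p0 (fun p => hcoord (p (g ord0)) (inord 2) != 0).
  by apply: general_coord; rewrite /p0 pullK // special_vertex /coords inordK //= oner_eq0.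
have near2 : general_near p0 (fun p => forall i, i != ord0 ->
    only_zero 1 (fun l => (l == ord0) || (l == i) : nat) (pred1 U_(inord 1)%MM) (fun l => p (g l))).
  apply: general_near_forall => i; apply: general_near_if => i0.
  exact/only_zero_near_pull/special_no_vertical.
have near3 : general_near p0 (fun p => forall i j, i != ord0 -> j != ord0 -> i != j ->
    only_zero 1 (fun l => [|| l == ord0, l == i | l == j] : nat) pred0 (fun l => p (g l))).
  apply: general_near_forall => i; apply: general_near_forall => j.
  apply: general_near_if => i0; apply: general_near_if => j0; apply: general_near_if => ij.
  exact/only_zero_near_pull/special_separated.
have near4 : general_near p0 (fun p => only_zero d.-1 (@smaller_mult d) pred0 (fun l => p (g l))).
  exact/only_zero_near_pull/special_no_smaller.
apply: general_near_imp (general_near_and (general_near_and near1 near2) (general_near_and near3 near4)).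
by move=> p [[c1 c2] [c3 c4]] L1 L; apply: pencil_at.
Qed.

(** * Cubics through nine points and forgetting p_0 *)

Section Cubics.

Variable K : numClosedFieldType.

Lemma dim_cubics : \dim (fullv : {vspace dhomog 3 K 3}) = 10.
Proof. by rewrite dimvf. Qed.

Lemma cubic_through (q : 'I_9 -> 'I_3 -> K) : exists C : {mpoly K[3]},
  [/\ C != 0, C \is 3.-homog & forall i, low 1 (shift (q i) C)].
Proof.
pose b := vbasis (fullv : {vspace dhomog 3 K 3}).
have [|v v0 /colP Av] := @wide_kernel K 9 (\dim (fullv : {vspace dhomog 3 K 3}))
    (\matrix_(i, j) mmap idfun (q i) (tnth b j : {mpoly K[3]})).
  by rewrite dim_cubics.
pose h := \sum_j v j 0 *: tnth b j.
exists (h : {mpoly K[3]}); split; last 1 first.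
- move=> i; apply/low1_eval; have := Av i; rewrite !mxE => E; rewrite -[RHS]E /h.
  rewrite (raddf_sum (@mpoly_of_dhomog 3 K 3)) (rmorph_sum (mmap idfun (q i))) /=.
  by apply: eq_bigr => j _; rewrite mxE mmapZ mulrC.
- apply: contraNneq v0 => h0; apply/eqP/colP => j; rewrite mxE.
  have /freeP := basis_free (vbasisP (fullv : {vspace dhomog 3 K 3})).
  move=> /(_ (fun j => v j 0)); apply; under eq_bigr => l _ do rewrite -tnth_nth.
  exact: val_inj.
exact: (valP h).
Qed.

End Cubics.

Lemma plane_system_ext (K : fieldType) N D (mu mu' : 'I_N -> nat) (q q' : 'I_N -> point K 2) f :
  mu =1 mu' -> q =1 q' -> plane_system D mu q f <-> plane_system D mu' q' f.
Proof.
by move=> muE qE; split=> -[f0 fD fq]; split=> // i; [rewrite -muE -qE | rewrite muE qE]; apply: fq.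
Qed.

Lemma multiple_xiX (K : fieldType) d m (p : 'I_(npoints d m) -> point K 2) f k :
  xi p f -> multiple_xi k p (f ^+ k).
Proof.
move=> [f0 fD fp]; have f1 i : low (xi_mult i) (shift (hcoord (p i)) f) by apply/(mult_ge_shift _ _ fD).
have fkD : f ^+ k \is (k * d).-homog by rewrite mulnC; apply: dhomogMn.
split=> [||i]; [by rewrite expf_neq0 | exact: fkD |].
apply/(mult_ge_shift _ _ fkD); rewrite /shift rmorphXn /=.
have [I0 _ _ IM _] := low_filtration 3 K; elim: (k) => [|l IH]; first exact: I0.
by rewrite exprS mulSn; apply: IM.
Qed.

Lemma same_divisor_scale (K : fieldType) N D mu (p : 'I_N -> point K 2) f g :
  same_divisor f g -> plane_system D mu p g -> plane_system D mu p f.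
Proof.
move=> [c c0 ->] [g0 gD gp]; have cgD : c *: g \is D.-homog by rewrite rpredZ.
split=> [||i]; [by rewrite scaler_eq0 negb_or c0 | exact: cgD |].
apply/(mult_ge_shift _ _ cgD); rewrite /shift mmapZ; apply: (filtrationMl (low_filtration 3 K)).
exact/(mult_ge_shift _ _ gD)/gp.
Qed.

(** A member without the monomial b is zero. So C has a nonzero coefficient at b, and subtracting
    the right multiple of C from any member gives zero. *)
Lemma unique_divisor (K : fieldType) N D mu b (p : 'I_N -> point K 2) C :
  only_zero D mu (pred1 b) p -> plane_system D mu p C ->
  consists_of_unique_divisor (plane_system D mu p) C.
Proof.
move=> p0 Cp f; split=> [fp|/same_divisor_scale]; last exact.
have system g : plane_system D mu p g -> g != 0 /\ in_system D mu pred0 (fun i => hcoord (p i)) g.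
  by move=> [g0 gD gp]; split=> //; split=> // i; apply/(mult_ge_shift _ _ gD).
have [C0 [CD _ Clow]] := system _ Cp; have [f0 [fD _ flow]] := system _ fp.
have Cb : C@_b != 0.
  by apply: contraNneq C0 => Cb; apply/eqP/p0; split=> // _ /eqP ->.
have fE : f = (f@_b / C@_b) *: C.
  apply/eqP; rewrite -subr_eq0; apply/eqP/p0; split.
  - by rewrite rpredB ?rpredZ.
  - by move=> _ /eqP ->; rewrite mcoeffB mcoeffZ divfK // subrr.
  move=> i; rewrite /shift mmapB mmapZ; have filL := low_filtration 3 K.
  by apply: (filtrationB filL); [exact: flow | apply: (filtrationMl filL); exact: Clow].
exists (f@_b / C@_b) => //; apply: contraNneq f0 => c0.
by rewrite fE c0 scale0r.
Qed.

Section Forget.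

Variable d : nat.

(* Through p_0, of multiplicity k d - k d = 0 for k xi_{d,d}, nothing is imposed. *)
Definition forget (i : 'I_(npoints d.+1 d)) : 'I_(npoints d.+1 d.+1) := inord i.+1.

Lemma forgetE i : forget i = i.+1 :> nat.
Proof. by rewrite /forget inordK //; case: i => i /=; rewrite /npoints; nia. Qed.

Lemma forget_inj : injective forget.
Proof. by move=> i j ij; apply: val_inj; apply: succn_inj; rewrite -[LHS]forgetE ij forgetE. Qed.

Lemma forget_xi (K : fieldType) k (p : 'I_(npoints d.+1 d.+1) -> point K 2) f :
  multiple_xi k p f <-> multiple_xi k (fun i => p (forget i)) f.
Proof.
have mult1 (i : 'I_(npoints d.+1 d)) : xi_mult i = 1%N by rewrite /xi_mult subSnn; case: ifP.
split=> -[f0 fD fp]; split=> // i.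
  have := fp (forget i); rewrite mult1 /xi_mult; case: eqP => // /(congr1 (@nat_of_ord _)).
  by rewrite forgetE.
rewrite /xi_mult subnn; case: ifP => [_|i0]; first by rewrite muln0 => c _ m _; apply: leq0n.
have i1 : (i.-1 < npoints d.+1 d)%N by have := ltn_ord i; move/negbT: i0; rewrite -val_eqE /npoints /=; nia.
have -> : i = forget (Ordinal i1).
  by apply: ord_inj; rewrite forgetE /= prednK // lt0n; move/negbT: i0.
by have := fp (Ordinal i1); rewrite mult1.
Qed.

End Forget.

Section Assembly.

Variables (K : numClosedFieldType) (k : nat).
Hypothesis k0 : (0 < k)%N.

Lemma empty_of_only_zero d m (p : 'I_(npoints d m) -> point K 2) :
  only_zero (k * d) (fun i => k * xi_mult i)%N pred0 p -> ~ exists f, multiple_xi k p f.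
Proof. by move=> p0 [f /multiple_xi_in_system[/eqP f0 /p0]]. Qed.

Lemma not_effective d m : (4 <= d)%N -> (2 <= m <= d)%N ->
  for_general (fun p : 'I_(npoints d m) -> point K 2 => ~ exists f, multiple_xi k p f).
Proof.
move=> d4 /andP[m2 md]; have [dm|dm] := ltnP m d.
  have [l dE] : exists l, d = (l + m)%N by exists (d - m)%N; rewrite subnK.
  subst d; have l0 : (0 < l)%N by lia.
  have [t pt] := @grid_empty K l m l0 m2 k k0 d4.
  apply: (@for_general_near _ _ _ (grid_points (K := K) t)).
  by apply: general_near_imp (only_zero_near pt) => p; apply: empty_of_only_zero.
(* For m = d the point p_0 is forgotten, which leads to the grid with a single line y = 0, that is l
   = 1. *)
have -> : m = d by apply/eqP; rewrite eqn_leq md dm.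
case: d d4 {md dm} => // d d4.
have d1 : (1 < d)%N by lia.
have [t pt] := @grid_empty K 1 d isT d1 k k0 d4.
apply: (@for_general_near _ _ _ (pull (@forget d) (vertex K) (@grid_points K 1 d t))).
have := only_zero_near_pull (@forget_inj d) (vertex K) pt.
apply: general_near_imp => p /empty_of_only_zero pE [f /forget_xi fp].
by apply: pE; exists f.
Qed.

Lemma unique_cubic (q : 'I_(npoints 3 2) -> point K 2) b b' :
  only_zero 3 (@xi_mult 3 2) (pred1 b) q -> only_zero (k * 3) (fun i => k * @xi_mult 3 2 i)%N (pred1 b') q ->
  exists C, consists_of_unique_divisor (xi q) C /\ consists_of_unique_divisor (multiple_xi k q) (C ^+ k).
Proof.
move=> q1 qk; have [C [C0 CD Cq]] := cubic_through (fun i => hcoord (q i)).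
have Cxi : xi q C.
  split=> // i; apply/(mult_ge_shift _ _ CD); have := Cq i.
  by rewrite /xi_mult; case: ifP.
by exists C; split; apply: unique_divisor; [exact: q1 | | exact: qk | exact: multiple_xiX].
Qed.

Definition cubic_points : 'I_(npoints 3 2) -> point K 2 := @grid_points K 1 2 0.

Lemma cubics_xi (q : 'I_9 -> point K 2) : same_system (xi (q : 'I_(npoints 3 2) -> point K 2)) (cubics_through q).
Proof.
by move=> f; apply: plane_system_ext => // i; rewrite /xi_mult; case: ifP.
Qed.

Lemma cubics_near N (g : 'I_(npoints 3 2) -> 'I_N) : injective g ->
  general_near (pull g (vertex K) cubic_points) (fun p => exists C : {mpoly K[3]},
    consists_of_unique_divisor (cubics_through (fun i => p (g i))) C /\
    consists_of_unique_divisor (multiple_xi k (fun i => p (g i))) (C ^+ k)).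
Proof.
move=> g_inj; have u1 := @grid_unique K 1 2 isT isT 1; have uk := @grid_unique K 1 2 isT isT k.
have := general_near_and (only_zero_near_pull g_inj (vertex K) u1) (only_zero_near_pull g_inj (vertex K) uk).
apply: general_near_imp => p [p1 pk]; rewrite mul1n in p1.
have p1' : only_zero 3 (@xi_mult 3 2) (pred1 [multinom nth 0 [:: 0; 1 * 1; 1 * 2] j | j < 3]%N) (fun i => p (g i)).
  move=> f [fD fkill flow]; apply: p1; split; [exact: fD | exact: fkill | move=> i].
  by rewrite mul1n; apply: flow.
have [C [C1 Ck]] := unique_cubic p1' pk.
exists C; split; last exact: Ck.
by move=> f; apply: iff_trans (C1 f); apply: iff_sym; apply: cubics_xi.
Qed.

End Assembly.

Theorem theorem1 (R : realType) (k : nat) (hk : (1 <= k)%N) :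
  (* (a) *)
  (forall d m : nat, (4 <= d)%N -> (2 <= m <= d)%N ->
     for_general (fun p : 'I_(npoints d m) -> point R[i] 2 =>
       ~ exists f, multiple_xi k p f))
  /\
  (* (b) *)
  ((forall d : nat, (1 <= d)%N ->
      for_general (fun p : 'I_(npoints d 1) -> point R[i] 2 =>
        [/\ pencil_of_rational_curves (xi p),
            composed_with (multiple_xi k p) (xi p),
            has_dimension (multiple_xi k p) k &
            no_foreign_components (multiple_xi k p) (xi p)]))
   /\
   (forall d : nat, (1 <= d)%N ->
      for_general (fun p : 'I_(npoints d 0) -> point R[i] 2 =>
        [/\ composed_with (xi p) (lines_through (p ord0)),
            has_dimension (xi p) d &
            no_foreign_components (xi p) (lines_through (p ord0))]))
   /\
   for_general (fun p : 'I_(npoints 2 2) -> point R[i] 2 =>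
     [/\ pencil_of_rational_curves (xi p),
         composed_with (multiple_xi k p) (xi p),
         has_dimension (multiple_xi k p) k &
         no_foreign_components (multiple_xi k p) (xi p)]))
  /\
  (* (c) *)
  (for_general (fun p : 'I_(npoints 3 3) -> point R[i] 2 =>
     let q : 'I_9 -> point R[i] 2 := fun i => p (lift ord0 i) in
     same_system (xi p) (cubics_through q) /\
     exists C : {mpoly R[i][3]},
       consists_of_unique_divisor (cubics_through q) C /\
       consists_of_unique_divisor (multiple_xi k p) (C ^+ k))
   /\
   for_general (fun p : 'I_(npoints 3 2) -> point R[i] 2 =>
     let q : 'I_9 -> point R[i] 2 := p in
     same_system (xi p) (cubics_through q) /\
     exists C : {mpoly R[i][3]},
       consists_of_unique_divisor (cubics_through q) C /\
       consists_of_unique_divisor (multiple_xi k p) (C ^+ k))).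
Proof.
split; first by move=> d m; apply: not_effective.
split.
  split; last split.
  - move=> d d0; apply: for_general_imp (for_general_near (pencil_near R[i] k d0 (@inj_id _))) => p.
    exact.
  - move=> d _; apply: (@for_general_near _ _ _ (fun=> vertex _)); apply: lines_general.
    by rewrite hcoord_vertex /coords inordK //= oner_eq0.
  (* Four points of multiplicity 1: xi_{2,2} is xi_{2,1} for p_1, ..., p_4. *)
  - apply: for_general_imp (for_general_near (pencil_near R[i] k (isT : (0 < 2)%N) (@forget_inj 1))) => p.
    by apply=> f; [rewrite !xi_multiple1 |]; apply: forget_xi.
split.
- apply: for_general_imp (for_general_near (@cubics_near R[i] k _ _ (@forget_inj 2))) => p [C [C1 Ck]].
  have liftE (i : 'I_9) : p (lift ord0 i) = p (@forget 2 i).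
    by congr (p _); apply: ord_inj; rewrite forgetE.
  have cubicsE f : cubics_through (fun i : 'I_9 => p (lift ord0 i)) f
      <-> cubics_through (fun i : 'I_9 => p (@forget 2 i)) f by apply: plane_system_ext.
  split=> [f|].
    apply: iff_trans (iff_sym (cubicsE f)); apply: iff_trans (cubics_xi _ _).
    by rewrite !xi_multiple1; apply: forget_xi.
  exists C; split=> f; first exact: iff_trans (cubicsE f) (C1 f).
  exact: iff_trans (forget_xi k p f) (Ck f).
- apply: for_general_imp (for_general_near (@cubics_near R[i] k _ _ (@inj_id 'I_(npoints 3 2)))) => p pE.
  by split; [exact: cubics_xi | exact: pE].
Qed.
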